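(* Let $(\mathcal M,\tau)$ be a tracial von Neumann algebra, $\mathcal U$ a non-principal ultrafilter on $\mathbb N$, $\mathbf X=(X_1,\dots,X_m)$ an $m$-tuple of self-adjoint elements of $\mathcal M$, and $\mathbf Y=(Y_j)_{j\in\mathbb N}$ a self-adjoint tuple of generators for a von Neumann subalgebra $\mathcal B\subseteq\mathcal M$. Fix a sequence $\mathbf Y^{(n)}\in M_n(\mathbb C)_{\mathrm{sa}}^{\mathbb N}$ of deterministic microstates for $\mathbf Y$ such that $\sup_n\|Y_j^{(n)}\|_{\mathrm{op}}<\infty$ for each $j$. Suppose that $\mathbf X^{(n)}\in M_n(\mathbb C)_{\mathrm{sa}}^m$ is a sequence of random matrix tuples with finite moments such that the law of $(\mathbf X^{(n)},\mathbf Y^{(n)})$ converges in probability (as $n\to\mathcal U$) to the law of $(\mathbf X,\mathbf Y)$, and that for each $k\in\mathbb N$ and each $j$, $$\lim_{n\to\mathcal U}\mathbb E\operatorname{tr}_n\big((X_j^{(n)})^{2k}\big)<\infty\quad\text{and}\quad\lim_{n\to\mathcal U}\operatorname{tr}_n\big((Y_j^{(n)})^{2k}\big)<\infty.$$ Then $$\Phi^*(\mathbf X:\mathbf Y)\le\lim_{n\to\mathcal U}\frac1{n^4}\mathcal I(\mathbf X^{(n)})=\lim_{n\to\mathcal U}\mathcal I^{(n)}(\mathbf X^{(n)}).$$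
   Context: A tracial von Neumann algebra $(\mathcal M,\tau)$ is a von Neumann algebra with a faithful normal tracial state; $\|x\|_2=\tau(x^*x)^{1/2}$. $\operatorname{tr}_n$ is the normalized trace on $M_n(\mathbb C)$. Laws. The (non-commutative) law of a self-adjoint tuple is the functional $p\mapsto\tau(p(\cdot))$ on non-commutative polynomials in self-adjoint variables (with $\tau=\operatorname{tr}_n$ for matrices); laws carry the topology of pointwise convergence on polynomials. ''Microstates for $\mathbf Y$'' means the laws of $\mathbf Y^{(n)}$ converge to that of $\mathbf Y$. For random matrix tuples the law is a random functional; it converges in probability to $\mu$ as $n\to\mathcal U$ if for every neighborhood $\mathcal O$ of $\mu$ the probability that it lies in $\mathcal O$ tends to $1$ as $n\to\mathcal U$. Classical Fisher information. $M_n(\mathbb C)_{\mathrm{sa}}^m$ is regarded as a real inner product space of dimension $mn^2$ with $\langle\mathbf A,\mathbf B\rangle_{\operatorname{tr}_n}=\sum_j\operatorname{tr}_n(A_jB_j)$, identified with $\mathbb R^{mn^2}$ via an orthonormal basis. For an $\mathbb R^d$-valued random variable $\mathbf X$, a score function is a random vector $\Xi\in L^2$ with $\mathbb E\langle\Xi,f(\mathbf X)\rangle=\mathbb E[\nabla\cdot f(\mathbf X)]$ for all $f\in C_c^\infty(\mathbb R^d;\mathbb C^d)$ and each coordinate of $\Xi$ in the $L^2$-closure of $\{f(\mathbf X):f\in C_c^\infty(\mathbb R^d)\}$; $\mathcal I(\mathbf X)=\mathbb E|\Xi|^2$ if it exists, and $\mathcal I(\mathbf X)=\infty$ otherwise.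 For $M_n(\mathbb C)_{\mathrm{sa}}^m$-valued $\mathbf X$, $\mathcal I^{(n)}(\mathbf X)=n^{-4}\mathcal I(\mathbf X)$. Free Fisher information. $\mathcal B\langle x_1,\dots,x_m\rangle$ is the algebra of non-commutative polynomials with coefficients in $\mathcal B$ (not commuting with the $x_j$). $\partial_i:\mathcal B\langle\vec x\rangle\to\mathcal B\langle\vec x\rangle\otimes\mathcal B\langle\vec x\rangle$ is linear with $\partial_ib=0$ for $b\in\mathcal B$, $\partial_ix_j=\delta_{ij}1\otimes1$, $\partial_i(PQ)=\partial_i(P)(1\otimes Q)+(P\otimes1)\partial_i(Q)$. The free score function of $\mathbf X$ with respect to $\mathcal B$, if it exists, is the $\xi\in L^2(\mathrm W^*(\mathcal B,\mathbf X))^m$ with $\tau(\xi_ip(\mathbf X))=\tau\otimes\tau(\partial_ip(\mathbf X))$ for all $p\in\mathcal B\langle\vec x\rangle$, $1\le i\le m$. $\Phi^*(\mathbf X:\mathbf Y)=\Phi^*(\mathbf X:\mathcal B)=\sum_i\|\xi_i\|_2^2$ if it exists and $\infty$ otherwise. *)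

(* Defs.v *)
From HB Require Import structures.
From mathcomp Require Import all_boot all_order all_algebra.
From mathcomp Require Import all_classical all_reals all_analysis.
From mathcomp.real_closed Require Import complex.
Set Implicit Arguments.
Unset Strict Implicit.
Unset Printing Implicit Defensive.
Import Order.TTheory GRing.Theory Num.Theory.
Import numFieldNormedType.Exports.
Local Open Scope classical_set_scope.
Local Open Scope ring_scope.

(* The complex numbers, packed as an abstract numClosedFieldType so that the
   canonical topology of MathComp-Analysis on such fields applies. *)
Definition cplx (R : realType) : numClosedFieldType := R[i]%C.

Definition re (R : realType) (z : cplx R) : R := complex.Re z.
Definition im (R : realType) (z : cplx R) : R := complex.Im z.
Definition mkC (R : realType) (a b : R) : cplx R := Complex a b.
Definition sqmod (R : realType) (z : cplx R) : R := re z ^+ 2 + im z ^+ 2.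

(* Expressions denoting the elements of K<x_i : i in I>, the coefficients in K
   not commuting with the variables.  Expressions are not quotiented by the
   algebra laws: they are only used through [nceval] and [ncderiv], and, for
   the coefficient maps used below, evaluations and (tau (x) tau)-values of
   derivatives agree on expressions denoting the same polynomial. *)
Inductive ncpoly (K I : Type) : Type :=
| NCone
| NCconst of K
| NCvar of I
| NCadd of ncpoly K I & ncpoly K I
| NCmul of ncpoly K I & ncpoly K I.
Arguments NCone {K I}.
Arguments NCconst {K I} _.
Arguments NCvar {K I} _.

Fixpoint nceval (K I : Type) (A : pzRingType) (coef : K -> A) (x : I -> A)
    (p : ncpoly K I) : A :=
  match p with
  | NCone => 1
  | NCconst c => coef c
  | NCvar i => x i
  | NCadd p q => nceval coef x p + nceval coef x q
  | NCmul p q => nceval coef x p * nceval coef x q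
  end.

(* The free difference quotient; a list of pairs (a, b) stands for the tensor
   \sum a (x) b. *)
Fixpoint ncderiv (K : Type) (I : eqType) (i : I) (p : ncpoly K I) :
    seq (ncpoly K I * ncpoly K I) :=
  match p with
  | NCone | NCconst _ => [::]
  | NCvar j => if j == i then [:: (NCone, NCone)] else [::]
  | NCadd p q => ncderiv i p ++ ncderiv i q
  | NCmul p q => [seq (t.1, NCmul t.2 q) | t <- ncderiv i p] ++
                 [seq (NCmul p t.1, t.2) | t <- ncderiv i q]
  end.

Definition nclaw_space (R : realType) (I : Type) :=
  {ptws (ncpoly (cplx R) I) -> cplx R}.

Record bop (K : numFieldType) (H : normedModType K) := Bop {
  bop_fun :> H -> H ;
  bop_linear : linear bop_fun ;
  bop_continuous : continuous bop_fun }.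

Section BoundedOperators.
Context {K : numFieldType} {H : normedModType K}.
Implicit Types x y z : bop H.

Lemma bopP x y : bop_fun x =1 bop_fun y -> x = y.
Proof.
case: x y => [f lf cf] [g lg cg] /= /funext fg; subst g.
by rewrite (Prop_irrelevance lf lg) (Prop_irrelevance cf cg).
Qed.

HB.instance Definition _ := gen_eqMixin (bop H).
HB.instance Definition _ := gen_choiceMixin (bop H).

Fact bop0_linear : linear (fun _ : H => 0 : H).
Proof. by move=> a u v; rewrite scaler0 addr0. Qed.
Definition bop0 : bop H := Bop bop0_linear (fun u => cvg_cst 0).

Fact bop1_linear : linear (fun u : H => u).
Proof. by []. Qed.
Definition bop1 : bop H := Bop bop1_linear (fun u => cvg_id).

Fact bop_opp_linear x : linear (fun u => - x u).
Proof. by move=> a u v; rewrite bop_linear opprD scalerN. Qed.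
Fact bop_opp_continuous x : continuous (fun u => - x u).
Proof. by move=> u; apply: cvgN; exact: bop_continuous. Qed.
Definition bop_opp x := Bop (@bop_opp_linear x) (@bop_opp_continuous x).

Fact bop_add_linear x y : linear (fun u => x u + y u).
Proof. by move=> a u v; rewrite !bop_linear scalerDr addrACA. Qed.
Fact bop_add_continuous x y : continuous (fun u => x u + y u).
Proof. by move=> u; apply: cvgD; exact: bop_continuous. Qed.
Definition bop_add x y := Bop (@bop_add_linear x y) (@bop_add_continuous x y).

Fact bop_mul_linear x y : linear (fun u => x (y u)).
Proof. by move=> a u v; rewrite !bop_linear. Qed.
Fact bop_mul_continuous x y : continuous (fun u => x (y u)).
Proof. by move=> u; apply: continuous_comp; exact: bop_continuous. Qed.
Definition bop_mul x y := Bop (@bop_mul_linear x y) (@bop_mul_continuous x y).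

Fact bop_scale_linear (c : K) x : linear (fun u => c *: x u).
Proof. by move=> a u v; rewrite bop_linear scalerDr !scalerA mulrC. Qed.
Fact bop_scale_continuous (c : K) x : continuous (fun u => c *: x u).
Proof. by move=> u; apply: cvgZr; exact: bop_continuous. Qed.
Definition bop_scale c x :=
  Bop (@bop_scale_linear c x) (@bop_scale_continuous c x).

Fact bop_addA : associative bop_add.
Proof. by move=> x y z; apply: bopP => u /=; rewrite addrA. Qed.
Fact bop_addC : commutative bop_add.
Proof. by move=> x y; apply: bopP => u /=; rewrite addrC. Qed.
Fact bop_add0 : left_id bop0 bop_add.
Proof. by move=> x; apply: bopP => u /=; rewrite add0r. Qed.
Fact bop_addN : left_inverse bop0 bop_opp bop_add.
Proof. by move=> x; apply: bopP => u /=; rewrite addNr. Qed.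
HB.instance Definition _ :=
  GRing.isZmodule.Build (bop H) bop_addA bop_addC bop_add0 bop_addN.

Fact bop_mulA : associative bop_mul.
Proof. by move=> x y z; apply: bopP. Qed.
Fact bop_mul1l : left_id bop1 bop_mul.
Proof. by move=> x; apply: bopP. Qed.
Fact bop_mul1r : right_id bop1 bop_mul.
Proof. by move=> x; apply: bopP. Qed.
Fact bop_mulDl : left_distributive bop_mul +%R.
Proof. by move=> x y z; apply: bopP. Qed.
Fact bop_mulDr : right_distributive bop_mul +%R.
Proof.
move=> x y z; apply: bopP => u /=.
by have := bop_linear x 1 (y u) (z u); rewrite !scale1r.
Qed.
HB.instance Definition _ := GRing.Zmodule_isPzRing.Build (bop H)
  bop_mulA bop_mul1l bop_mul1r bop_mulDl bop_mulDr.

Fact bop_scaleA (a b : K) x :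
  bop_scale a (bop_scale b x) = bop_scale (a * b) x.
Proof. by apply: bopP => u /=; rewrite scalerA. Qed.
Fact bop_scale1 : left_id 1 bop_scale.
Proof. by move=> x; apply: bopP => u /=; rewrite scale1r. Qed.
Fact bop_scaleDr : right_distributive bop_scale +%R.
Proof. by move=> c x y; apply: bopP => u /=; rewrite scalerDr. Qed.
Fact bop_scaleDl x : {morph bop_scale^~ x : a b / a + b}.
Proof. by move=> a b; apply: bopP => u /=; rewrite scalerDl. Qed.
HB.instance Definition _ := GRing.Zmodule_isLmodule.Build K (bop H)
  bop_scaleA bop_scale1 bop_scaleDr bop_scaleDl.

End BoundedOperators.

Section VonNeumann.
Context {R : realType}.
Local Notation C := (cplx R).
Context {H : completeNormedModType C}.

(* [ip] is the inner product, linear in its first argument, of the Hilbert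
   space [H]. *)
Definition hilbert (ip : {dot H for Num.conj}) : Prop :=
  forall u, `|u| ^+ 2 = ip u u.

Context (ip : {dot H for Num.conj}).

Definition is_adjoint (x y : bop H) : Prop :=
  forall u v, ip (x u) v = ip u (y v).

Definition adj (x : bop H) : bop H := xget 0 [set y | is_adjoint x y].

Definition selfadjoint (x : bop H) : Prop := is_adjoint x x.

Definition wot_cvg (F : set_system (bop H)) (x : bop H) : Prop :=
  forall u v : H, (fun y : bop H => ip (y u) v) @ F --> ip (x u) v.

Definition square_summable (u : nat -> H) : Prop :=
  cvgn (series (fun k => `|u k| ^+ 2)).

Definition sigma_weak_cvg (F : set_system (bop H)) (x : bop H) : Prop :=
  forall u v : nat -> H, square_summable u -> square_summable v ->
    (fun y : bop H => limn (series (fun k => ip (y (u k)) (v k)))) @ F -->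
    limn (series (fun k => ip (x (u k)) (v k))).

(* A von Neumann algebra on H: a unital *-subalgebra of B(H) which is closed in
   the weak operator topology. *)
Record is_vNalgebra (M : set (bop H)) : Prop := {
  vN_one : M 1 ;
  vN_add : forall x y, M x -> M y -> M (x + y) ;
  vN_scale : forall (c : C) x, M x -> M (c *: x) ;
  vN_mul : forall x y, M x -> M y -> M (x * y) ;
  vN_adj : forall x, M x -> exists2 y, M y & is_adjoint x y ;
  vN_closed : forall (F : set_system (bop H)), ProperFilter F -> F M ->
    forall x, wot_cvg F x -> M x }.

Definition Wstar (S : set (bop H)) : set (bop H) :=
  \bigcap_(N in [set N | is_vNalgebra N /\ S `<=` N]) N.

(* A faithful normal tracial state on M; only the values of [tau] on M matter.
   Normality is continuity for the sigma-weak topology. *)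
Record is_tracial_state (M : set (bop H)) (tau : bop H -> C) : Prop := {
  tau_linear : forall (c : C) x y, M x -> M y ->
    tau (c *: x + y) = c * tau x + tau y ;
  tau_one : tau 1 = 1 ;
  tau_positive : forall x, M x -> 0 <= tau (adj x * x) ;
  tau_faithful : forall x, M x -> tau (adj x * x) = 0 -> x = 0 ;
  tau_tracial : forall x y, M x -> M y -> tau (x * y) = tau (y * x) ;
  tau_normal : forall (F : set_system (bop H)), ProperFilter F -> F M ->
    forall x, M x -> sigma_weak_cvg F x -> tau y @[y --> F] --> tau x }.

Definition norm2 (tau : bop H -> C) (x : bop H) : R :=
  Num.sqrt (re (tau (adj x * x))).

(* L^2(N), as the completion of N for [norm2]: its elements are represented by
   Cauchy sequences. *)
Record L2 (N : set (bop H)) (tau : bop H -> C) := MkL2 {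
  L2_seq :> nat -> bop H ;
  L2_mem : forall k, N (L2_seq k) ;
  L2_cauchy : forall eps : R, 0 < eps -> exists K : nat, forall k l,
    (K <= k)%N -> (K <= l)%N -> norm2 tau (L2_seq k - L2_seq l) < eps }.

Definition L2_norm N tau (xi : L2 N tau) : R :=
  limn (fun k => norm2 tau (xi k)).

(* tau (xi a), for xi in L^2(N) and a in N. *)
Definition L2_tau N tau (xi : L2 N tau) (a : bop H) : C :=
  limn (fun k => tau (xi k * a)).

Definition op_law (I : Type) (tau : bop H -> C) (x : I -> bop H) :
    nclaw_space R I :=
  fun p => tau (nceval (fun c : C => c *: (1 : bop H)) x p).

Definition ncpoly_eval (I : Type) (B : set (bop H)) (x : I -> bop H)
    (p : ncpoly B I) : bop H :=
  nceval (fun b : B => \val b) x p.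

Section FreeFisher.
Context (tau : bop H -> C) (B : set (bop H)) (m : nat) (X : 'I_m -> bop H).

Definition is_free_score
    (xi : 'I_m -> L2 (Wstar (B `|` range X)) tau) : Prop :=
  forall (p : ncpoly B 'I_m) (i : 'I_m),
    L2_tau (xi i) (ncpoly_eval X p) =
    \sum_(t <- ncderiv i p)
      tau (ncpoly_eval X t.1) * tau (ncpoly_eval X t.2).

Definition free_fisher : \bar R :=
  match pselect (exists xi, is_free_score xi) with
  | left h => (\sum_(i < m) L2_norm (projT1 (cid h) i) ^+ 2)%:E
  | right _ => +oo%E
  end.

End FreeFisher.
End VonNeumann.

Section ClassicalFisher.
Context {R : realType}.
Local Notation C := (cplx R).

Definition partial (n : nat) (i : 'I_n) (f : 'rV[R]_n -> R) : 'rV[R]_n -> R :=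
  fun x => 'D_(delta_mx 0 i) f x.

Definition smooth (n : nat) (f : 'rV[R]_n -> R) : Prop :=
  forall s : seq 'I_n, let g := foldr (@partial n) f s in
    continuous g /\ forall x i, derivable g x (delta_mx 0 i).

Definition smooth_cc (n : nat) (f : 'rV[R]_n -> R) : Prop :=
  smooth f /\ compact (closure [set x | f x != 0]).

(* C_c^oo(R^n), with complex values. *)
Definition test_function (n : nat) (f : 'rV[R]_n -> C) : Prop :=
  smooth_cc (fun x => re (f x)) /\ smooth_cc (fun x => im (f x)).

Definition cpartial (n : nat) (i : 'I_n) (f : 'rV[R]_n -> C) : 'rV[R]_n -> C :=
  fun x => mkC (partial i (fun y => re (f y)) x)
               (partial i (fun y => im (f y)) x).

Definition divergence (n : nat) (f : 'I_n -> 'rV[R]_n -> C) : 'rV[R]_n -> C :=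
  fun x => \sum_(i < n) cpartial i (f i) x.

Context (d : measure_display) (T : measurableType d) (P : probability T R).

Definition cmeasurable (z : T -> C) : Prop :=
  measurable_fun [set: T] (fun w => re (z w)) /\
  measurable_fun [set: T] (fun w => im (z w)).

Definition cexpectation (z : T -> C) : C :=
  mkC (Rintegral P setT (fun w => re (z w)))
      (Rintegral P setT (fun w => im (z w))).

Record is_score (n : nat) (X : T -> 'rV[R]_n) (Xi : T -> 'rV[C]_n) : Prop := {
  score_measurable : forall k, cmeasurable (fun w => Xi w 0 k) ;
  score_L2 : forall k, (\int[P]_w (sqmod (Xi w 0 k))%:E < +oo)%E ;
  score_ibp : forall f : 'I_n -> 'rV[R]_n -> C,
    (forall k, test_function (f k)) ->
    cexpectation (fun w => \sum_(k < n) (Xi w 0 k)^* * f k (X w)) =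
    cexpectation (fun w => divergence f (X w)) ;
  score_closure : forall k (eps : R), 0 < eps ->
    exists2 f : 'rV[R]_n -> C, test_function f &
      (\int[P]_w (sqmod (Xi w 0 k - f (X w)))%:E < eps%:E)%E }.

Definition fisher (n : nat) (X : T -> 'rV[R]_n) : \bar R :=
  match pselect (exists Xi, is_score X Xi) with
  | left h => (\int[P]_w (\sum_(k < n) sqmod (projT1 (cid h) w 0%R k))%:E)%E
  | right _ => +oo%E
  end.

End ClassicalFisher.

Section Matrices.
Context {R : realType}.
Local Notation C := (cplx R).

Definition ntr (n : nat) (A : 'M[C]_n) : C := \tr A / n%:R.

Definition mx_law (I : Type) (n : nat) (A : I -> 'M[C]_n) : nclaw_space R I :=
  fun p => ntr (nceval (fun c : C => c%:M) A p).

Definition cV_norm (n : nat) (v : 'cV[C]_n) : R :=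
  Num.sqrt (\sum_(i < n) sqmod (v i 0)).

Definition op_norm (n : nat) (A : 'M[C]_n) : \bar R :=
  ereal_sup [set (cV_norm (A *m v))%:E | v in [set v | cV_norm v <= 1]].

Definition mx_ip (m n : nat) (A B : 'I_m -> 'M[C]_n) : R :=
  \sum_(j < m) re (ntr (A j *m B j)).

Definition mx_norm2 (m n : nat) (A : 'I_m -> 'M[C]_n) : R :=
  Num.sqrt (mx_ip A A).

(* Orthonormal bases of M_n(C)_sa^m for [mx_ip], over the reals. *)
Record is_onb (m n : nat) (e : 'I_(m * n ^ 2) -> 'I_m -> 'M[C]_n) : Prop := {
  onb_selfadjoint : forall k j, e k j \is hermsymmx ;
  onb_orthonormal : forall k l, mx_ip (e k) (e l) = (k == l)%:R ;
  onb_span : forall A : 'I_m -> 'M[C]_n, (forall j, A j \is hermsymmx) ->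
    forall j, A j = \sum_k mkC (mx_ip A (e k)) 0 *: e k j }.

Definition mx_coord (m n : nat) (e : 'I_(m * n ^ 2) -> 'I_m -> 'M[C]_n)
    (A : 'I_m -> 'M[C]_n) : 'rV[R]_(m * n ^ 2) :=
  \row_k mx_ip A (e k).

Definition random_mx_tuple (d : measure_display) (T : measurableType d)
    (m n : nat) (X : T -> 'I_m -> 'M[C]_n) : Prop :=
  (forall w j, X w j \is hermsymmx) /\
  (forall j a b, cmeasurable (fun w => X w j a b)).

Definition finite_moments (d : measure_display) (T : measurableType d)
    (P : probability T R) (m n : nat) (X : T -> 'I_m -> 'M[C]_n) : Prop :=
  forall k : nat, (\int[P]_w (mx_norm2 (X w) ^+ k)%:E < +oo)%E.

(* I(X) and I^(n)(X) for a random matrix tuple, M_n(C)_sa^m being identified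
   with R^(mn^2) by the orthonormal basis [e]. *)
Definition mx_fisher (d : measure_display) (T : measurableType d)
    (P : probability T R) (m n : nat) (e : 'I_(m * n ^ 2) -> 'I_m -> 'M[C]_n)
    (X : T -> 'I_m -> 'M[C]_n) : \bar R :=
  fisher P (fun w => mx_coord e (X w)).

Definition mx_fisher_n (d : measure_display) (T : measurableType d)
    (P : probability T R) (m n : nat) (e : 'I_(m * n ^ 2) -> 'I_m -> 'M[C]_n)
    (X : T -> 'I_m -> 'M[C]_n) : \bar R :=
  ((n%:R ^- 4)%:E * mx_fisher P e X)%E.

End Matrices.

Definition join_tuple (I J A : Type) (x : I -> A) (y : J -> A) (k : I + J) : A :=
  match k with inl i => x i | inr j => y j end.

(* Convergence in probability along [U] of the random laws [mu n] to [nu].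
   Only open neighbourhoods are considered, for which the events are
   measurable whenever the random laws are continuous functions of random
   matrices. *)
Definition cvg_law_in_probability (R : realType) (I : Type)
    (U : set_system nat) (d : nat -> measure_display)
    (T : forall n, measurableType (d n)) (P : forall n, probability (T n) R)
    (mu : forall n, T n -> nclaw_space R I) (nu : nclaw_space R I) : Prop :=
  forall O : set (nclaw_space R I), open O -> O nu ->
    P n [set w | O (mu n w)] @[n --> U] --> 1%E.

(* Main.v *)
(* For non-commutative polynomials f_1, .., f_m in (X, Y) one shows

     2 Re \sum_i (tau (x) tau) (d_i f_i (X, Y))
       <= lim I^(n) (X^(n)) + \sum_i |f_i (X, Y)|_2^2.

   By Riesz's theorem in L^2 this gives a free score for polynomials in (X, Y)
   with squared norm at most lim I^(n).  Von Neumann's density theorem and the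
   normality of tau pass from polynomials in Y to coefficients in B = W^*(Y).

   The inequality is the limit of the matricial one.  Since the divergence of
   A |-> f (A, Y^(n)) is n^2 \sum_i (tr_n (x) tr_n) (d_i f_i), it is integration
   by parts against this field combined with 2 <Xi, f> <= |Xi|^2 + |f|^2, the
   field being truncated by smooth cutoffs, which the finite moments allow to
   remove.  In the limit one needs that traces of polynomials converge in L^2
   and not only in probability: |tr_n w| is bounded by even moments of the
   letters of the word w (chessboard estimate), so all moments of traces stay
   bounded along U. *)

Require Import Defs.
From HB Require Import structures.
From mathcomp Require Import all_boot all_order all_algebra.
From mathcomp Require Import all_classical all_reals all_analysis.
From mathcomp.real_closed Require Import complex.
From mathcomp Require Import ring lra zify measurable_realfun.
Import Order.TTheory GRing.Theory Num.Theory.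
Import numFieldNormedType.Exports.
Local Open Scope classical_set_scope.
Local Open Scope ring_scope.

Set Implicit Arguments.
Unset Strict Implicit.
Unset Printing Implicit Defensive.

(** The inequality for tuples is used twice. With one nonzero entry it bounds the functional p -> Re
    (tau (x) tau)(d_i p), which produces a score; with every f_i close to the adjoint of the i-th
    score it bounds the sum of the squared norms by the same constant. It is proved for each real
    constant above the limit. Normality of tau concerns the sigma-weak topology, so density is
    proved for operators amplified to square-summable sequences: there, the projection onto a closed
    cyclic subspace has its matrix entries in the commutant. If y tends sigma-strongly to x, the
    product of the adjoint of y - x with y - x tends sigma-weakly to 0, so y tends to x in |.|_2.
    Coefficients in B are then replaced in the score identity one occurrence at a time, both sides
    being continuous in a single factor placed between two fixed ones. On the matrix side, tr (x) tr
    of a derivative is a sum of products of two traces, whence the need for L^2 convergence. It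
    follows from a bound on fourth moments, the fourth power of a real trace being at most the trace
    of another polynomial. *)

(** * Complex numbers in real coordinates *)

Section ComplexNumbers.
Context {R : realType}.
Local Notation C := (cplx R).
Implicit Types (z w : C) (a b : R).

Lemma cplxP z w : re z = re w -> im z = im w -> z = w.
Proof. by case: z => ? ?; case: w => ? ? /= -> ->. Qed.
Lemma reD z w : re (z + w) = re z + re w. Proof. by case: z; case: w. Qed.
Lemma imD z w : im (z + w) = im z + im w. Proof. by case: z; case: w. Qed.
Lemma reN z : re (- z) = - re z. Proof. by case: z. Qed.
Lemma imN z : im (- z) = - im z. Proof. by case: z. Qed.
Lemma reB z w : re (z - w) = re z - re w. Proof. by rewrite reD reN. Qed.
Lemma imB z w : im (z - w) = im z - im w. Proof. by rewrite imD imN. Qed.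
Lemma reM z w : re (z * w) = re z * re w - im z * im w.
Proof. by case: z; case: w. Qed.
Lemma imM z w : im (z * w) = re z * im w + im z * re w.
Proof. by case: z => a b; case: w => c d; rewrite /im /re /=. Qed.
Lemma reJ z : re z^* = re z. Proof. by case: z. Qed.
Lemma imJ z : im z^* = - im z. Proof. by case: z. Qed.
Lemma re_sum I (r : seq I) (Q : pred I) (F : I -> C) :
  re (\sum_(i <- r | Q i) F i) = \sum_(i <- r | Q i) re (F i).
Proof. by elim/big_rec2: _ => // i a z _ <-; rewrite reD. Qed.
Lemma im_sum I (r : seq I) (Q : pred I) (F : I -> C) :
  im (\sum_(i <- r | Q i) F i) = \sum_(i <- r | Q i) im (F i).
Proof. by elim/big_rec2: _ => // i a z _ <-; rewrite imD. Qed.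
Lemma re_mkC a b : re (mkC a b) = a. Proof. by []. Qed.
Lemma ge0_cplx z : (0 <= z) = (im z == 0) && (0 <= re z).
Proof. by rewrite lecE /= eq_sym. Qed.
Lemma le_cplx z w : (z <= w) = (im w == im z) && (re z <= re w).
Proof. by rewrite lecE /=. Qed.
Lemma lt_cplx z w : (z < w) = (im w == im z) && (re z < re w).
Proof. by rewrite ltcE /=. Qed.
Lemma norm_cplx z : `|z| = mkC (Num.sqrt (sqmod z)) 0.
Proof. by rewrite normc_def. Qed.
Lemma sqmod_ge0 z : 0 <= sqmod z.
Proof. by rewrite addr_ge0 ?sqr_ge0. Qed.
Lemma mulcJ z : z * z^* = mkC (sqmod z) 0.
Proof.
by apply: cplxP; rewrite ?reM ?imM reJ imJ /= /sqmod; ring.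
Qed.
Lemma natr_mkC n : (n%:R : C) = mkC n%:R 0.
Proof. by elim: n => [|n IH]//; rewrite !mulrS IH; apply: cplxP; rewrite ?reD ?imD /= ?addr0. Qed.

Lemma mkC1 : mkC 1 0 = 1 :> C.
Proof. by []. Qed.
Lemma mkCN1 : mkC (-1) 0 = -1 :> C.
Proof. by apply: cplxP; rewrite ?reN ?imN /= ?oppr0. Qed.

Lemma normr_re z : mkC `|re z| 0 <= `|z|.
Proof.
rewrite norm_cplx le_cplx /= eqxx /= -sqrtr_sqr ler_wsqrtr//.
by rewrite lerDl sqr_ge0.
Qed.
Lemma normr_im z : mkC `|im z| 0 <= `|z|.
Proof.
rewrite norm_cplx le_cplx /= eqxx /= -sqrtr_sqr ler_wsqrtr//.
by rewrite lerDr sqr_ge0.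
Qed.
Lemma norm_le_re_im z : `|z| <= mkC (`|re z| + `|im z|) 0.
Proof.
rewrite norm_cplx le_cplx /= eqxx /= -[leRHS]ger0_norm ?addr_ge0//.
rewrite -sqrtr_sqr ler_wsqrtr// /sqmod -(real_normK (num_real (re z))).
rewrite -(real_normK (num_real (im z))).
have : 0 <= `|re z| * `|im z| by rewrite mulr_ge0.
nra.
Qed.

Lemma cplx_cvgP (T : Type) (F : set_system T) (FF : Filter F) (f : T -> C) z :
  (f @ F --> z) <-> ((fun t => re (f t)) @ F --> re z /\ (fun t => im (f t)) @ F --> im z).
Proof.
split.
  move=> /cvgrPdist_lt fz; split; apply/cvgrPdist_lt => e e0.
    have := fz (mkC e 0); rewrite lt_cplx/= eqxx/= => /(_ e0).
    apply: filterS => t; rewrite lt_cplx => /andP[_]; apply: le_lt_trans.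
    by have := normr_re (z - f t); rewrite le_cplx reB => /andP[].
  have := fz (mkC e 0); rewrite lt_cplx/= eqxx/= => /(_ e0).
  apply: filterS => t; rewrite lt_cplx => /andP[_]; apply: le_lt_trans.
  by have := normr_im (z - f t); rewrite le_cplx imB => /andP[].
move=> [/cvgrPdist_lt fr /cvgrPdist_lt fi]; apply/cvgrPdist_lt => -[e e'].
rewrite lt_cplx /= => /andP[/eqP->] e0.
have e2 : 0 < e / 2 by rewrite divr_gt0.
apply: filterS2 (fr _ e2) (fi _ e2) => t tr ti.
apply: le_lt_trans (norm_le_re_im _) _; rewrite lt_cplx /= eqxx /= reB imB.
by rewrite [ltRHS](splitr e) ltrD.
Qed.

Lemma cplx_cvg_unique (T : Type) (F : set_system T) (FF : ProperFilter F) (f : T -> C) z w :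
  f @ F --> z -> f @ F --> w -> z = w.
Proof.
by move=> fz fw; rewrite -(cvg_lim (@norm_hausdorff _ _) fz) (cvg_lim (@norm_hausdorff _ _) fw).
Qed.

End ComplexNumbers.

(** * Semidefinite real forms and Riesz representation *)

Section RealForm.
Context {R : realType} {E : Type}.
(** [comb c f g] plays the role of c f + g on a bare type: among the instances are unquotiented
    polynomial expressions, elements of an algebra as a subtype and square-summable sequences, which
    carry no vector space structure here. *)
Variables (comb : R -> E -> E -> E) (s : E -> E -> R).
Hypotheses (s_comb : forall c f g h, s (comb c f g) h = c * s f h + s g h)
  (s_sym : forall f g, s f g = s g f) (s_ge0 : forall f, 0 <= s f f).

Lemma form_combr c f g h : s h (comb c f g) = c * s h f + s h g.
Proof. by rewrite s_sym s_comb !(s_sym h). Qed.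

Lemma form_comb2 c f g :
  s (comb c f g) (comb c f g) = c ^+ 2 * s f f + c * s f g *+ 2 + s g g.
Proof. by rewrite s_comb !form_combr (s_sym g f); ring. Qed.

Lemma form_CauchySchwarz f g : s f g ^+ 2 <= s f f * s g g.
Proof.
have H c : 0 <= c ^+ 2 * s f f + c * s f g *+ 2 + s g g.
  by rewrite -form_comb2.
have := s_ge0 f; rewrite le_eqVlt => /predU1P[f0|f0].
  have [->|fg0] := eqVneq (s f g) 0; first by rewrite expr0n mulr_ge0.
  (* When [s f f] vanishes the quadratic is affine in [c], and this [c] would give it the value
     -1. *)
  have := H (- (s g g + 1) / (s f g *+ 2)); rewrite -f0 mulr0 add0r -mulr_natr.
  rewrite -(mulr_natr (s f g)).
  have -> : - (s g g + 1) / (s f g * 2) * s f g * 2 + s g g = -1.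
    by field; rewrite fg0.
  by rewrite oppr_ge0 ler10.
(* The minimizer of the quadratic. *)
have := H (- s f g / s f f).
have -> : (- s f g / s f f) ^+ 2 * s f f + - s f g / s f f * s f g *+ 2 + s g g
  = (s f f * s g g - s f g ^+ 2) / s f f.
  by rewrite -mulr_natr; field; rewrite gt_eqF.
by rewrite pmulr_lge0 ?invr_gt0// subr_ge0.
Qed.

(* The representing vector of a bounded functional minimizes
   s f f - 2 phi f; minimizing sequences are Cauchy by the parallelogram
   identity. *)
Lemma form_Riesz (phi : E -> R) (K : R) (f0 : E) :
  (forall c f g, phi (comb c f g) = c * phi f + phi g) ->
  (forall f, phi f *+ 2 <= K + s f f) ->
  exists a : nat -> E,
    (forall eps, 0 < eps -> exists N, forall k l, (N <= k)%N -> (N <= l)%N ->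
       s (comb (-1) (a k) (a l)) (comb (-1) (a k) (a l)) < eps) /\
    (forall f, s f (a k) @[k --> \oo] --> phi f).
Proof.
move=> phi_comb phi_le.
pose J f := s f f - phi f *+ 2.
pose S := [set J f | f in [set: E]].
have infS : has_inf S.
  split; first by exists (J f0), f0.
  by exists (- K) => _ [f _ <-]; have := phi_le f; rewrite /J; lra.
pose d := inf S.
have dJ f : d <= J f by apply: ge_inf; [case: infS | exists f].
pose del (k : nat) : R := k.+1%:R^-1.
have exa k : exists f, J f < d + del k.
  have /(inf_adherent)/(_ infS) [_ [f _ <-] ?] : 0 < del k.
    by rewrite invr_gt0 ltr0n.
  by exists f.
pose a k := projT1 (cid (exa k)).
have aJ k : J (a k) < d + del k := projT2 (cid (exa k)).
have del_small eps : 0 < eps -> exists N, forall k, (N <= k)%N -> del k < eps.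
  move=> e0; exists (Num.truncn eps^-1).+1 => k Nk.
  rewrite /del -(invrK eps) ltf_pV2 ?posrE ?ltr0n ?invr_gt0//.
  apply: lt_le_trans (truncnS_gt _) _; rewrite ler_nat; exact: leq_trans Nk _.
exists a; split.
  move=> eps e0; have [N HN] := del_small (eps / 4) (divr_gt0 e0 (ltr0n _ 4)).
  exists N => k l Nk Nl.
  (* This is the midpoint of [a k] and [a l]. Its value is at least [d], so the parallelogram
     identity bounds the squared distance by 2 (del k + del l), which is below [eps] thanks to the
     choice of [eps / 4]. *)
  have := dJ (comb (- 2^-1) (comb (-1) (a k) (a l)) (a l)).
  have := aJ k; have := aJ l; have := HN _ Nk; have := HN _ Nl.
  rewrite /J !form_comb2 ?s_comb ?form_combr !phi_comb ?s_comb.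
  have := s_sym (a l) (a k). lra.
move=> f; apply/cvgrPdist_lt => eps e0.
have q1 : 0 < s f f + 1 by rewrite ltr_wpDl.
have [N HN] := del_small (eps ^+ 2 / (s f f + 1)) (divr_gt0 (exprn_gt0 _ e0) q1).
exists N => // k /= Nk; rewrite -(ltr_pXn2r (n := 2)) ?nnegrE ?(ltW e0)//.
rewrite real_normK ?num_real//.
apply: (@lt_trans _ _ (del k * (s f f + 1))); last by rewrite -ltr_pdivlMr// HN.
set x := phi f - _.
(* Moving from [a k] along [f] cannot bring [J] below [d]; this step length forces x^2 < del k (s f
   f + 1). The added 1 keeps the divisor positive when [s f f] is 0. *)
have := dJ (comb (x / (s f f + 1)) f (a k)); have := aJ k.
rewrite /J form_comb2 phi_comb => A B.
have {B}A : 0 < del k + (x / (s f f + 1)) ^+ 2 * s f f - x / (s f f + 1) * x *+ 2.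
  move: A B; rewrite /x; lra.
have : 0 < (del k + (x / (s f f + 1)) ^+ 2 * s f f - x / (s f f + 1) * x *+ 2) * (s f f + 1) by rewrite mulr_gt0.
have -> : (del k + (x / (s f f + 1)) ^+ 2 * s f f - x / (s f f + 1) * x *+ 2) * (s f f + 1)
 = del k * (s f f + 1) - x ^+ 2 - x ^+ 2 / (s f f + 1).
  by rewrite -mulr_natr; field; rewrite gt_eqF.
have : 0 <= x ^+ 2 / (s f f + 1) by rewrite divr_ge0 ?sqr_ge0// ltW.
lra.
Qed.

End RealForm.

(** * Von Neumann's density theorem *)

Section HilbertSpace.
Context {R : realType}.
Local Notation C := (cplx R).
Context {H : completeNormedModType C} (ip : {dot H for Num.conj}).
Hypothesis hip : hilbert ip.

(** The underlying real inner product, to which the results on real forms apply; imaginary parts are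
    recovered through [rip_i]. *)
Definition rip (u v : H) : R := re (ip u v).
Local Notation sqn u := (rip u u).

Lemma ipC u v : ip v u = (ip u v)^*.
Proof. by rewrite hermC /= expr0 mul1r. Qed.
Lemma ipDl u v w : ip (u + v) w = ip u w + ip v w.
Proof. exact: linearDl. Qed.
Lemma ipDr u v w : ip w (u + v) = ip w u + ip w v.
Proof. exact: linearDr. Qed.
Lemma ipZl c u v : ip (c *: u) v = c * ip u v.
Proof. exact: linearZl_LR. Qed.
Lemma ipZr c u v : ip u (c *: v) = c^* * ip u v.
Proof. by rewrite linearZr. Qed.
Lemma ripC u v : rip u v = rip v u.
Proof. by rewrite /rip ipC reJ. Qed.
Lemma ripDl u v w : rip (u + v) w = rip u w + rip v w.
Proof. by rewrite /rip linearDl reD. Qed.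
Lemma ripDr u v w : rip w (u + v) = rip w u + rip w v.
Proof. by rewrite ripC ripDl !(ripC w). Qed.
Lemma ripZl (a : R) u v : rip (mkC a 0 *: u) v = a * rip u v.
Proof. by rewrite /rip linearZl_LR reM /= mul0r subr0. Qed.
Lemma ripNl u v : rip (- u) v = - rip u v.
Proof. by rewrite /rip linearNl reN. Qed.
Lemma ripNr u v : rip v (- u) = - rip v u.
Proof. by rewrite ripC ripNl ripC. Qed.
Lemma rip0l u : rip 0 u = 0.
Proof. by rewrite /rip linear0l. Qed.
Lemma rip0r u : rip u 0 = 0.
Proof. by rewrite ripC rip0l. Qed.
Lemma rip_i u v : rip u (mkC 0 1 *: v) = im (ip u v).
Proof. by rewrite /rip linearZr /= reM reJ imJ /=; ring. Qed.
Lemma ripiZ u v : rip (mkC 0 1 *: u) (mkC 0 1 *: v) = rip u v.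
Proof. by rewrite rip_i /rip linearZl_LR imM /=; ring. Qed.
Lemma im_ip_diag u : im (ip u u) = 0.
Proof. by have := dnorm_ge0 ip u; rewrite ge0_cplx => /andP[/eqP]. Qed.
Lemma rip_ge0 u : 0 <= sqn u.
Proof. by have := dnorm_ge0 ip u; rewrite ge0_cplx => /andP[]. Qed.
Lemma normE u : `|u| = mkC (Num.sqrt (sqn u)) 0.
Proof.
apply/eqP; rewrite -(@eqrXn2 _ 2)//; last first.
  by rewrite ge0_cplx /= eqxx sqrtr_ge0.
rewrite hip; apply/eqP/cplxP; rewrite expr2 ?reM ?imM/=.
  by rewrite -expr2 sqr_sqrtr ?rip_ge0// mulr0 subr0.
by rewrite im_ip_diag mulr0 mul0r addr0.
Qed.
Lemma sqn_eq0 u : sqn u = 0 -> u = 0.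
Proof.
move=> u0; apply/eqP; rewrite -normr_eq0 normE u0 sqrtr0; exact/eqP/cplxP.
Qed.
Lemma rip_inj u v : (forall w, rip u w = rip v w) -> u = v.
Proof.
move=> uv; apply/eqP; rewrite -subr_eq0; apply/eqP/sqn_eq0.
by rewrite ripDl ripNl uv subrr.
Qed.
Lemma sqnZ (c : C) u : sqn (c *: u) = sqmod c * sqn u.
Proof.
rewrite {1}/rip linearZl_LR linearZr /= mulrA mulcJ reM /= mul0r subr0.
by [].
Qed.

Lemma rip_comb (c : R) u v w : rip (mkC c 0 *: u + v) w = c * rip u w + rip v w.
Proof. by rewrite ripDl ripZl. Qed.

Lemma norm_lt_sqn u (e : R) : 0 < e -> (`|u| < mkC e 0) = (sqn u < e ^+ 2).
Proof.
move=> e0; rewrite normE lt_cplx /= eqxx /=.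
by rewrite -[RHS]ltr_sqrt ?exprn_gt0// sqrtr_sqr gtr0_norm.
Qed.

Lemma sqn_cauchy_cvg (u : nat -> H) :
  (forall eps, 0 < eps -> exists N, forall k l, (N <= k)%N -> (N <= l)%N ->
     sqn (u k - u l) < eps) ->
  exists v, forall eps, 0 < eps -> exists N, forall k, (N <= k)%N ->
     sqn (v - u k) < eps.
Proof.
move=> uC.
have : cvg (u @ \oo).
  apply: cauchy_cvg; apply: cauchy_exP => -[e e'].
  rewrite lt_cplx /= => /andP[/eqP-> e0].
  have [N HN] := uC _ (exprn_gt0 2 e0); exists (u N), N => // k /= Nk.
  by rewrite -ball_normE /= norm_lt_sqn// HN.
move=> /cvg_ex[v /cvgrPdist_lt uv]; exists v => e e0.
have := uv (mkC (Num.sqrt e) 0); rewrite lt_cplx /= eqxx sqrtr_gt0 => /(_ e0).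
move=> [N _ HN]; exists N => k /HN /=.
by rewrite norm_lt_sqn ?sqrtr_gt0// sqr_sqrtr// ltW.
Qed.

Lemma bop_map0 (x : bop H) : x 0 = 0.
Proof.
by have := bop_linear x (-1) 0 0; rewrite scaler0 addr0 scaleN1r addNr.
Qed.
Lemma bop_mapZ (x : bop H) (c : C) u : x (c *: u) = c *: x u.
Proof. by have := bop_linear x c u 0; rewrite !addr0 bop_map0 addr0. Qed.

Lemma is_adjoint_sym (x y : bop H) : is_adjoint ip x y -> is_adjoint ip y x.
Proof. by move=> xy u v; rewrite ipC -xy -ipC. Qed.

Lemma bop_bounded (x : bop H) : exists2 K, 0 <= K & forall u, sqn (x u) <= K * sqn u.
Proof.
have x0 := bop_map0 x; have xZ := bop_mapZ x.
have : bop_fun x @ (0 : H) --> bop_fun x 0 := @bop_continuous _ _ x 0.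
rewrite x0 => /cvgrPdist_lt /(_ 1 ltr01).
move=> /nbhs_norm0P [[e e'] /=]; rewrite lt_cplx /= => /andP[/eqP-> e0] He.
exists ((e / 2) ^- 2); first by rewrite invr_ge0 sqr_ge0.
move=> u; have [u0|u0] := eqVneq (sqn u) 0.
  by rewrite (sqn_eq0 u0) x0 rip0l mulr0.
have su : 0 < sqn u by rewrite lt_neqAle eq_sym u0 rip_ge0.
(* The rescaled vector has norm e / 2, strictly inside the ball on which [x] is bounded by 1. *)
pose c := e / 2 / Num.sqrt (sqn u).
have := He (mkC c 0 *: u); rewrite /= sub0r normrN xZ.
have e2 : 0 < e / 2 by rewrite divr_gt0.
rewrite norm_lt_sqn// -[1]/(mkC 1 0) norm_lt_sqn// !sqnZ /sqmod /= expr0n addr0.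
rewrite /c expr_div_n sqr_sqrtr ?rip_ge0// divfK// expr1n.
have -> : (e / 2) ^+ 2 < e ^+ 2 by rewrite ltr_pXn2r ?nnegrE ?ltW//; lra.
move=> /(_ isT); rewrite -mulrA -ltr_pdivlMl ?exprn_gt0// mulr1.
by rewrite mulrC ltr_pdivrMr// => /ltW.
Qed.

End HilbertSpace.

Section SquareSummable.
Context {R : realType}.
Local Notation C := (cplx R).
Context {H : completeNormedModType C} (ip : {dot H for Num.conj}).
Hypothesis hip : hilbert ip.
Local Notation rip := (rip ip).
Local Notation sqn u := (rip u u).

Lemma eq_limn_series (f g : nat -> R) : f =1 g -> limn (series f) = limn (series g).
Proof. by move=> /funext ->. Qed.

(** The Hilbert space of square-summable sequences in [H]. Operators act on it termwise
    ([ell2_act]), and the sigma-weak topology on operators is the weak operator topology of this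
    amplification. *)
Record ell2 := Ell2 {
  ell2_seq :> nat -> H ;
  ell2_bound : exists K, forall n, \sum_(0 <= k < n) sqn (ell2_seq k) <= K }.
Implicit Types u v w : ell2.

Definition dot u v : R := limn (series (fun k => rip (u k) (v k))).

Lemma rip_le (u v : H) : rip u v <= (sqn u + sqn v) / 2.
Proof.
have := rip_ge0 ip (u - v); rewrite !ripDl !ripDr !ripNl !ripNr (ripC _ v u); lra.
Qed.
Lemma normr_rip_le (u v : H) : `|rip u v| <= (sqn u + sqn v) / 2.
Proof.
rewrite ler_norml rip_le andbT lerNl -ripNl (le_trans (rip_le _ _))//.
by rewrite ripNl ripNr opprK.
Qed.

Lemma dot_cvg u v : cvgn (series (fun k => rip (u k) (v k))).
Proof.
apply: normed_cvg; apply: nondecreasing_is_cvgn.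
  by apply: nondecreasing_series => n _ _ /=.
case: u => u [K uK]; case: v => v [L vL] /=; exists ((K + L) / 2) => _ [n _ <-].
rewrite /series /=.
apply: (@le_trans _ _ (\sum_(0 <= k < n) ((sqn (u k) + sqn (v k)) / 2))).
  by apply: ler_sum => k _; exact: normr_rip_le.
rewrite -mulr_suml ler_pM2r// big_split /=; exact: lerD.
Qed.

Lemma dot_sym u v : dot u v = dot v u.
Proof. by apply: eq_limn_series => k; rewrite ripC. Qed.

Lemma dot_partial u n : \sum_(0 <= k < n) sqn (u k) <= dot u u.
Proof.
have nd : nondecreasing_seq (series (fun k => sqn (u k))).
  by apply: nondecreasing_series => k _ _; exact: rip_ge0.
exact: (nondecreasing_cvgn_le nd (@dot_cvg u u) n).
Qed.

Lemma dot_ge0 u : 0 <= dot u u.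
Proof. by have := dot_partial u 0; rewrite big_geq. Qed.

Lemma dot_le u K : (forall n, \sum_(0 <= k < n) sqn (u k) <= K) -> dot u u <= K.
Proof. by move=> uK; apply: limr_le; [exact: dot_cvg | near=> n; exact: uK].
Unshelve. all: by end_near. Qed.

Lemma sqn_le_dot u k : sqn (u k) <= dot u u.
Proof.
apply: le_trans (dot_partial u k.+1); rewrite big_nat_recr //= lerDr.
by apply: sumr_ge0 => *; exact: rip_ge0.
Qed.

Lemma sqnD_le (u v : H) : sqn (u + v) <= 2 * sqn u + 2 * sqn v.
Proof.
by rewrite ripDl !ripDr (ripC _ v u); have := rip_le u v; lra.
Qed.

Fact ell2_comb_bound (c : C) u v :
  exists K, forall n, \sum_(0 <= k < n) sqn (c *: u k + v k) <= K.
Proof.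
exists (2 * sqmod c * dot u u + 2 * dot v v) => n.
apply: (@le_trans _ _ (\sum_(0 <= k < n) (2 * sqmod c * sqn (u k) + 2 * sqn (v k)))).
  by apply: ler_sum => k _; apply: le_trans (sqnD_le _ _) _; rewrite (sqnZ ip) mulrA.
rewrite big_split /= -!mulr_sumr lerD// ler_wpM2l ?mulr_ge0 ?sqmod_ge0//; exact: dot_partial.
Qed.
Definition ell2_comb (c : C) u v := Ell2 (ell2_comb_bound c u v).

Fact ell2_act_bound (x : bop H) u :
  exists K, forall n, \sum_(0 <= k < n) sqn (x (u k)) <= K.
Proof.
have [K K0 xK] := bop_bounded hip x; exists (K * dot u u) => n.
apply: (@le_trans _ _ (\sum_(0 <= k < n) (K * sqn (u k)))).
  by apply: ler_sum => k _.
by rewrite -mulr_sumr ler_wpM2l// dot_partial.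
Qed.
Definition ell2_act (x : bop H) u := Ell2 (ell2_act_bound x u).

Lemma ell2_act_le (x : bop H) : exists2 K, 0 <= K &
  forall u, dot (ell2_act x u) (ell2_act x u) <= K * dot u u.
Proof.
have [K K0 xK] := bop_bounded hip x; exists K => // u; apply: dot_le => n.
apply: (@le_trans _ _ (\sum_(0 <= k < n) (K * sqn (u k)))).
  by apply: ler_sum => k _; exact: xK.
by rewrite -mulr_sumr ler_wpM2l// dot_partial.
Qed.

Fact ell2_delta_bound j (v : H) :
  exists K, forall n, \sum_(0 <= k < n) sqn (if k == j then v else 0) <= K.
Proof.
exists (sqn v) => n; rewrite big_mkord.
have [jn|jn] := ltnP j n.
  rewrite (bigD1 (Ordinal jn)) //= eqxx big1 ?addr0// => i /eqP ij.
  by case: eqP => [e|_]; [case: ij; exact: val_inj | rewrite rip0l].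
rewrite big1 ?rip_ge0// => i _; case: eqP => [e|_]; last by rewrite rip0l.
by have := ltn_ord i; rewrite e ltnNge jn.
Qed.
Definition ell2_delta j (v : H) := Ell2 (ell2_delta_bound j v).

Definition ell2_0 := ell2_delta 0 0.

Lemma dot_delta u j (v : H) : dot u (ell2_delta j v) = rip (u j) v.
Proof.
apply/cvg_lim => //; apply: cvg_near_cst; exists j.+1 => // n /= jn.
rewrite /series /= big_mkord (bigD1 (Ordinal jn)) //= eqxx big1 ?addr0// => i /eqP ij.
by case: eqP => [e|_]; [case: ij; exact: val_inj | rewrite rip0r].
Qed.

Lemma dot_comb (c : R) u v w :
  dot (ell2_comb (mkC c 0) u v) w = c * dot u w + dot v w.
Proof.
apply/cvg_lim => //.
have -> : series (fun k => rip (ell2_comb (mkC c 0) u v k) (w k)) =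
  (fun n => c * series (fun k => rip (u k) (w k)) n + series (fun k => rip (v k) (w k)) n).
  apply/funext => n; rewrite /series /= mulr_sumr -big_split /=.
  by apply: eq_bigr => k _; rewrite rip_comb.
apply: cvgD; last exact: dot_cvg.
by apply: cvgM; [exact: cvg_cst | exact: dot_cvg].
Qed.

Lemma dot_act x y u v : is_adjoint ip x y -> dot (ell2_act x u) v = dot u (ell2_act y v).
Proof.
move=> xy; apply: eq_limn_series => k.
by rewrite /rip /= xy.
Qed.

Lemma eq_dot u u' v v' : u =1 u' -> v =1 v' -> dot u v = dot u' v'.
Proof.
move=> uu vv; apply: eq_limn_series => k.
by rewrite uu vv.
Qed.

Lemma dot_CauchySchwarz u v : dot u v ^+ 2 <= dot u u * dot v v.
Proof. exact: (form_CauchySchwarz dot_comb dot_sym dot_ge0). Qed.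

Definition ell2_sub u v := ell2_comb (mkC (-1) 0) v u.
Lemma ell2_subE u v k : ell2_sub u v k = u k - v k.
Proof. by rewrite /= mkCN1 scaleN1r addrC. Qed.
Lemma dot_sub u v w : dot (ell2_sub u v) w = dot u w - dot v w.
Proof. rewrite dot_comb; ring. Qed.
Lemma dot_subr u v w : dot w (ell2_sub u v) = dot w u - dot w v.
Proof. by rewrite dot_sym dot_sub !(dot_sym w). Qed.

Lemma dot_eq0 u : dot u u = 0 -> forall k, u k = 0.
Proof.
move=> u0 k; apply: (sqn_eq0 hip); apply/eqP; rewrite eq_le rip_ge0 andbT -u0.
exact: sqn_le_dot.
Qed.

Lemma ell2_square_summable (u : nat -> H) : square_summable u ->
  exists K, forall n, \sum_(0 <= k < n) sqn (u k) <= K.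
Proof.
move=> /cvg_ex[l /cplx_cvgP[+ _]].
have -> : (fun t => re (series (fun k => `|u k| ^+ 2 : C) t)) = series (fun k => sqn (u k)).
  apply/funext => n; rewrite /series /= re_sum; apply: eq_bigr => k _.
  by rewrite hip.
move=> cv; exists (re l) => n.
rewrite -(cvg_lim _ cv)//; have nd : nondecreasing_seq (series (fun k => sqn (u k))).
  by apply: nondecreasing_series => k _ _; exact: rip_ge0.
exact: (nondecreasing_cvgn_le nd (cvgP _ cv) n).
Qed.

End SquareSummable.

Section Density.
Context {R : realType}.
Local Notation C := (cplx R).
Context {H : completeNormedModType C} (ip : {dot H for Num.conj}).
Hypothesis hip : hilbert ip.
Local Notation rip := (rip ip).
Local Notation sqn u := (rip u u).
Local Notation ell2 := (ell2 ip).
Local Notation act := (ell2_act hip).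
Local Notation normsq u := (dot u u).

Lemma dot_mul2_le (u v : ell2) : dot u v *+ 2 <= normsq u + normsq v.
Proof.
have := dot_ge0 (ell2_sub u v); rewrite dot_sub !dot_subr (dot_sym v u); lra.
Qed.

Lemma normsq_add_le (u v w : ell2) : (forall k, u k = v k + w k) ->
  normsq u <= 2 * normsq v + 2 * normsq w.
Proof.
move=> e; apply: dot_le => n.
apply: (@le_trans _ _ (\sum_(0 <= k < n) (2 * sqn (v k) + 2 * sqn (w k)))).
  by apply: ler_sum => k _; rewrite e sqnD_le.
by rewrite big_split /= -!mulr_sumr lerD// ler_wpM2l// dot_partial.
Qed.

(** The limit is taken coordinate by coordinate. A finite sum of [sqn (z j - v k j)] is bounded by
    comparison with a far term [v l], where [l] depends on the length of the sum; the resulting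
    bound does not, so it holds for the series. *)
Lemma ell2_complete (v : nat -> ell2) :
  (forall eps, 0 < eps -> exists N, forall k l, (N <= k)%N -> (N <= l)%N ->
     normsq (ell2_sub (v k) (v l)) < eps) ->
  exists z : ell2, forall eps, 0 < eps -> exists N, forall k, (N <= k)%N ->
     normsq (ell2_sub z (v k)) < eps.
Proof.
move=> vC.
have sqv k l j : sqn (v k j - v l j) <= normsq (ell2_sub (v k) (v l)).
  have := sqn_le_dot (ell2_sub (v k) (v l)) j; congr (_ <= _).
  by rewrite ell2_subE.
have /choice[z zv] : forall j, exists zj, forall eps, 0 < eps -> exists N, forall k,
    (N <= k)%N -> sqn (zj - v k j) < eps.
  move=> j; apply: (sqn_cauchy_cvg hip) => e e0; have [N HN] := vC _ e0.
  by exists N => k l Nk Nl; apply: le_lt_trans (HN _ _ Nk Nl).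
have zsum n e N : 0 < e ->
    exists2 l, (N <= l)%N & \sum_(0 <= j < n) sqn (z j - v l j) <= e.
  suff: 0 < e -> exists M, forall l, (M <= l)%N -> \sum_(0 <= j < n) sqn (z j - v l j) <= e.
    move=> /[apply] -[M HM]; exists (maxn M N); first exact: leq_maxr.
    by apply: HM; exact: leq_maxl.
  elim: n e => [|n IH] e e0; first by exists 0%N => l _; rewrite big_geq// ltW.
  have e2 : 0 < e / 2 by rewrite divr_gt0.
  have [M1 H1] := IH _ e2; have [M2 H2] := zv n _ e2.
  exists (maxn M1 M2) => l; rewrite geq_max => /andP[l1 l2].
  by rewrite big_nat_recr //= [leRHS](splitr e) lerD ?H1// ltW// H2.
(* By [sqnD_le] the constant 4 is 2 for the distance from [z] to [v l] plus 2 for that from [v l] to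
   [v k]. *)
have zbd e N k : 0 < e -> (forall k l, (N <= k)%N -> (N <= l)%N ->
     normsq (ell2_sub (v k) (v l)) < e) -> (N <= k)%N ->
   forall n, \sum_(0 <= j < n) sqn (z j - v k j) <= 4 * e.
  move=> e0 HN Nk n; have [l Nl lz] := zsum n e N e0.
  apply: (@le_trans _ _ (\sum_(0 <= j < n) (2 * sqn (z j - v l j) + 2 * sqn (v l j - v k j)))).
    apply: ler_sum => j _; apply: le_trans (sqnD_le _ _ _); rewrite addrA subrK.
    exact: lexx.
  rewrite big_split /= -!mulr_sumr.
  suff : \sum_(0 <= j < n) sqn (v l j - v k j) <= e by move: lz; lra.
  apply: le_trans (ltW (HN _ _ Nl Nk)); have := dot_partial (ell2_sub (v l) (v k)) n.
  congr (_ <= _); apply: eq_bigr => j _.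
  by rewrite ell2_subE.
have z2 : exists K, forall n, \sum_(0 <= j < n) sqn (z j) <= K.
  have [N HN] := vC _ (@ltr01 R); exists (2 * (4 * 1) + 2 * normsq (v N)) => n.
  apply: (@le_trans _ _ (\sum_(0 <= j < n) (2 * sqn (z j - v N j) + 2 * sqn (v N j)))).
    apply: ler_sum => j _; apply: le_trans (sqnD_le _ _ _); rewrite subrK.
    exact: lexx.
  rewrite big_split /= -!mulr_sumr lerD ?ler_wpM2l ?dot_partial//.
  exact: (zbd _ N).
exists (Ell2 z2) => e e0.
have e8 : 0 < e / 8 by rewrite divr_gt0.
have [N HN] := vC _ e8; exists N => k Nk.
apply: (@le_lt_trans _ _ (4 * (e / 8))); last by lra.
apply: dot_le => n; have := zbd _ _ _ e8 HN Nk n; congr (_ <= _).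
apply: eq_bigr => j _; by rewrite ell2_subE.
Qed.

Variable A : set (bop H).
Hypotheses (A1 : A 1) (A_comb : forall (c : C) a b, A a -> A b -> A (c *: a + b))
  (A_mul : forall a b, A a -> A b -> A (a * b))
  (A_adj : forall a, A a -> exists2 b, A b & is_adjoint ip a b).

Local Notation scal c := (c *: (1 : bop H) : bop H).

Lemma dot_scale (c : R) (v w : ell2) :
  dot (act (scal (mkC c 0)) v) w = c * dot v w.
Proof.
rewrite (@eq_dot _ _ _ _ (ell2_comb (mkC c 0) v (ell2_0 ip)) w w)//.
  by rewrite dot_comb [dot (ell2_0 ip) w]dot_sym dot_delta rip0r addr0.
by move=> k /=; rewrite if_same addr0.
Qed.

Section Projection.
Variable u : ell2.

(** The closure of the orbit of [u] under [A] is a closed [A]-invariant subspace; the orthogonal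
    projection onto it is described by predicates, and its values are compared pointwise. *)
Definition in_closure (z : ell2) := forall eps, 0 < eps ->
  exists2 a, A a & normsq (ell2_sub z (act a u)) < eps.
Definition orthA (z : ell2) := forall a, A a -> dot z (act a u) = 0.
Definition isproj (w z : ell2) := in_closure z /\ orthA (ell2_sub w z).

Lemma closure_orth z y : in_closure z -> orthA y -> dot z y = 0.
Proof.
move=> zA yA; apply/eqP; rewrite -sqrf_eq0 eq_le sqr_ge0 andbT.
apply/ler_addgt0Pr => e e0; rewrite add0r.
have y1 : 0 < normsq y + 1 by rewrite ltr_wpDl ?dot_ge0.
have [a Aa za] := zA _ (divr_gt0 e0 y1).
have -> : dot z y = dot (ell2_sub z (act a u)) y.
  by rewrite dot_sub (dot_sym (act a u)) yA// subr0.
apply: le_trans (dot_CauchySchwarz _ _) _.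
apply: (@le_trans _ _ (e / (normsq y + 1) * (normsq y + 1))); last by rewrite divfK ?gt_eqF.
by apply: ler_pM; rewrite ?dot_ge0// ?(ltW za)// lerDl.
Qed.

(** Riesz representation of a -> <a u, w> for the form <a u, b u> on [A] gives a sequence in [A]
    whose values at [u] converge to the projection. *)
Lemma proj_exists w : exists z, isproj w z.
Proof.
pose E := {a | A a}.
pose comb (c : R) (f g : E) : E :=
  exist A _ (A_comb (mkC c 0) (projT2 f) (projT2 g)).
pose s (f g : E) := dot (act (sval f) u) (act (sval g) u).
have s_comb c f g h : s (comb c f g) h = c * s f h + s g h.
  by rewrite /s -dot_comb; apply: eq_dot.
have s_sym f g : s f g = s g f by exact: dot_sym.
have s_ge0 f : 0 <= s f f by exact: dot_ge0.
pose phi (f : E) := dot (act (sval f) u) w.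
have [||a [aC aphi]] := form_Riesz s_comb s_sym s_ge0 (phi := phi) (K := normsq w) (exist A _ A1).
- by move=> c f g; rewrite /phi -dot_comb; apply: eq_dot.
- by move=> f; rewrite addrC; exact: dot_mul2_le.
have [e e0|z zv] := ell2_complete (v := fun k => act (sval (a k)) u).
  have [N HN] := aC _ e0; exists N => k l Nk Nl; have := HN _ _ Nl Nk.
  by congr (_ < _); apply: eq_dot.
exists z; split=> [e e0|b Ab].
  by have [N HN] := zv _ e0; exists (sval (a N)); [exact: svalP | exact: HN].
have := aphi (exist A _ Ab); rewrite dot_sub => H1.
suff H2 : s (exist A _ Ab) (a k) @[k --> \oo] --> dot z (act b u).
  have e : phi (exist A _ Ab) = dot z (act b u).
    by rewrite -(cvg_lim _ H1)// (cvg_lim _ H2).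
  by rewrite dot_sym -e /phi subrr.
apply/cvgrPdist_lt => e e0.
have y1 : 0 < normsq (act b u) + 1 by rewrite ltr_wpDl ?dot_ge0.
have [N HN] := zv _ (divr_gt0 (exprn_gt0 2 e0) y1).
exists N => // k /= /HN zk.
rewrite /s /= (dot_sym (act b u)) -dot_sub.
rewrite -(ltr_pXn2r (n := 2)) ?nnegrE ?(ltW e0)// real_normK ?num_real//.
apply: le_lt_trans (dot_CauchySchwarz _ _) _.
rewrite ltr_pdivlMr// in zk; apply: le_lt_trans zk.
by rewrite ler_wpM2l ?dot_ge0// lerDl.
Qed.

Definition proj w := projT1 (cid (proj_exists w)).
Lemma projP w : isproj w (proj w). Proof. exact: projT2 (cid (proj_exists w)). Qed.

Lemma proj_unique (w w' z z' : ell2) : w =1 w' -> isproj w z -> isproj w' z' -> z =1 z'.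
Proof.
move=> ww [zA wz] [zA' wz'].
have o : orthA (ell2_sub z z').
  move=> a Aa; have := wz _ Aa; have := wz' _ Aa; rewrite !dot_sub.
  by rewrite (eq_dot (u := w') (u' := w) (v' := act a u))//; lra.
have d0 : normsq (ell2_sub z z') = 0.
  by rewrite dot_sub !closure_orth// subrr.
move=> k; have := dot_eq0 hip d0 k; rewrite ell2_subE.
by move=> /eqP; rewrite subr_eq0 => /eqP.
Qed.

Lemma proj_sym (w w' z z' : ell2) : isproj w z -> isproj w' z' -> dot z w' = dot w z'.
Proof.
move=> [zA wz] [zA' wz'].
have := closure_orth zA wz'; have := closure_orth zA' wz.
rewrite !dot_subr (dot_sym z' w) (dot_sym z' z); lra.
Qed.

Lemma proj_normsq (w z : ell2) : isproj w z -> normsq z <= normsq w.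
Proof.
move=> [zA wz].
have := closure_orth zA wz; rewrite dot_subr (dot_sym z w).
have := dot_mul2_le w z; lra.
Qed.

(** A closed subspace invariant under [x] and its adjoint is reducing, so the projection onto it
    commutes with [x]. *)
Lemma proj_act (x y : bop H) (w z : ell2) : is_adjoint ip x y -> (forall a, A a -> A (x * a)) ->
  (forall a, A a -> A (y * a)) -> isproj w z -> isproj (act x w) (act x z).
Proof.
move=> xy xA yA [zA wz]; split=> [e e0|a Aa].
  have [K K0 xK] := ell2_act_le hip x.
  have K1 : 0 < K + 1 by rewrite ltr_wpDl.
  have [a Aa za] := zA _ (divr_gt0 e0 K1); exists (x * a); first exact: xA.
  apply: (@le_lt_trans _ _ (normsq (act x (ell2_sub z (act a u))))).
    rewrite le_eqVlt; apply/orP; left; apply/eqP.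
    by apply: eq_dot => k /=; rewrite [in RHS]bop_linear.
  apply: le_lt_trans (xK _) _; rewrite ltr_pdivlMr// in za; apply: le_lt_trans za.
  by rewrite mulrC ler_wpM2l ?dot_ge0// lerDl.
have := wz _ (yA _ Aa); rewrite !dot_sub !(dot_act hip _ _ xy) => <-.
by congr (_ - _); apply: eq_dot.
Qed.

Lemma proj_comb (c : R) (w z w' z' : ell2) : isproj w z -> isproj w' z' ->
  isproj (ell2_comb (mkC c 0) w w') (ell2_comb (mkC c 0) z z').
Proof.
move=> [zA wz] [zA' wz']; split=> [e e0|a Aa]; last first.
  have := wz _ Aa; have := wz' _ Aa; rewrite !dot_sub !dot_comb => e1 e2.
  by rewrite -[RHS](mulr0 c) -[in RHS]e2; lra.
have c1 : 0 < 4 * (c ^+ 2 + 1) by rewrite mulr_gt0// ltr_wpDl// sqr_ge0.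
have e4 : 0 < e / 4 by rewrite divr_gt0.
have [a Aa za] := zA _ (divr_gt0 e0 c1); have [b Ab zb] := zA' _ e4.
exists (mkC c 0 *: a + b); first exact: A_comb.
apply: (@le_lt_trans _ _ (2 * normsq (act (scal (mkC c 0)) (ell2_sub z (act a u))) +
    2 * normsq (ell2_sub z' (act b u)))).
  apply: normsq_add_le => k /=; rewrite !mkCN1.
  by rewrite !scaleN1r !scalerDr scalerN opprD addrACA.
rewrite dot_scale dot_sym dot_scale.
have := dot_ge0 (ell2_sub z (act a u)).
move: za zb; rewrite ltr_pdivlMr//; move: (normsq _) (normsq _) => p q za zb q0.
move: za; rewrite expr2; lra.
Qed.

End Projection.

Local Notation delta := (ell2_delta ip).

Section Components.
Variable u : ell2.

Lemma scalar_adjoint (c : C) : is_adjoint ip (scal c) (scal c^*).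
Proof. by move=> v w /=; rewrite linearZl_LR linearZr /= conjCK. Qed.

Lemma A_scale (c : C) a : A a -> A (scal c * a).
Proof.
move=> Aa; have A0 : A 0 by have := A_comb (-1) A1 A1; rewrite scaleN1r addNr.
rewrite (_ : _ * _ = c *: a + 0); first exact: A_comb.
by rewrite addr0; apply: bopP.
Qed.

(** The entry (j, l) of the projection, read as an infinite matrix of operators on [H]. *)
Definition block j l (v : H) := proj u (delta l v) j.

Fact block_linear j l : linear (block j l).
Proof.
move=> c v v'.
(* [proj_comb] has real coefficients, so the complex scalar enters as the operator [scal c], which
   commutes with the projection by [proj_act]. *)
have -> : c *: block j l v + block j l v' = ell2_comb (mkC 1 0) (proj u (delta l v'))
    (act (scal c) (proj u (delta l v))) j.
  by rewrite /= mkC1 scale1r addrC.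
apply: (@proj_unique u (delta l (c *: v + v'))
  (ell2_comb (mkC 1 0) (delta l v') (act (scal c) (delta l v)))).
- move=> k /=; case: eqP => _; first by rewrite mkC1 scale1r addrC.
  by rewrite !scaler0 addr0.
- exact: projP.
- apply: proj_comb; first exact: projP.
  by apply: (proj_act (scalar_adjoint c)); [move=> a; exact: A_scale..|exact: projP].
Qed.

Lemma block_le j l v : sqn (block j l v) <= sqn v.
Proof.
apply: le_trans (sqn_le_dot _ _) _; apply: le_trans (proj_normsq (projP u _)) _.
by rewrite dot_delta /= eqxx.
Qed.

Fact block_continuous j l : continuous (block j l).
Proof.
move=> v; apply/cvgrPdist_lt => -[e e']; rewrite lt_cplx /= => /andP[/eqP-> e0].
apply/nbhs_normP; exists (mkC e 0); first by rewrite /= lt_cplx /= eqxx.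
move=> w /=; rewrite !(norm_lt_sqn hip)//; apply: le_lt_trans.
have := block_linear j l (-1) w v; rewrite !scaleN1r => E.
by rewrite [block j l v - _]addrC -E addrC block_le.
Qed.

Definition block_bop j l : bop H := Bop (@block_linear j l) (@block_continuous j l).

Lemma block_adjoint j l : is_adjoint ip (block_bop j l) (block_bop l j).
Proof.
have re_eq v w : rip (block j l v) w = rip v (block l j w).
  rewrite /block -(dot_delta (proj u (delta l v))) (ripC _ v).
  rewrite -(dot_delta (proj u (delta j w))).
  by rewrite (proj_sym (projP _ _) (projP _ _)) dot_sym.
move=> v w; apply: cplxP; first exact: re_eq.
(* The imaginary part is the real part at i w. *)
by rewrite -!rip_i -bop_mapZ; exact: re_eq.
Qed.

End Components.

(** An adjoint is required of each element because the bicommutant is handled by taking adjoints in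
    commutation relations. *)
Definition commutant : set (bop H) :=
  [set t | (exists s, is_adjoint ip t s) /\ forall a, A a -> t * a = a * t].

(** The closed orbit is invariant under [A], which is closed under adjoints, so the projection
    commutes with the amplified action of [A]; it remains to compare entries. *)
Lemma block_commutant u j l : commutant (block_bop u j l).
Proof.
split; first by exists (block_bop u l j); exact: block_adjoint.
move=> a Aa; apply: bopP => v; have [b Ab ab] := A_adj Aa.
apply: (@proj_unique u (delta l (a v)) (act a (delta l v)) (proj u _) (act a (proj u _))) => [k||].
- by rewrite /=; case: eqP => _; rewrite ?bop_map0.
- exact: projP.
- apply: (proj_act ab); [by move=> c; exact: A_mul..|exact: projP].
Qed.

(** If [x] commutes with all entries of the projection onto the closed orbit of [u], its
    amplification commutes with the projection. Since [A] contains 1, [u] lies in that subspace, and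
    so does its image under [x]. *)
Lemma bicommutant_closure x y u : is_adjoint ip x y ->
  (forall t, commutant t -> x * t = t * x) -> in_closure u (act x u).
Proof.
move=> xy xt.
(* Commutation with the entries passes to the adjoint [y], because the adjoint of an entry is the
   transposed entry. *)
have yt l j v : y (block u l j v) = block u l j (y v).
  have inj : forall v w : H, (forall z, ip v z = ip w z) -> v = w.
    by move=> v1 w1 e; apply: (rip_inj hip) => z; rewrite /(rip _ _) e.
  apply: inj => z; rewrite (is_adjoint_sym xy) (block_adjoint u l j (y v) z).
  rewrite (block_adjoint u l j v (x z)) (is_adjoint_sym xy) /=.
  by have /(congr1 (fun t : bop H => t z)) /= -> := xt _ (block_commutant u j l).
have uu : isproj u u u.
  split=> [e e0|a Aa]; last by rewrite dot_sub subrr.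
  exists 1 => //; apply: le_lt_trans e0; apply: dot_le => n.
  by rewrite big1// => k _; rewrite ell2_subE subrr rip0l.
have zx : proj u (act x u) =1 act x u.
  move=> j; apply: (rip_inj hip) => v.
  rewrite -dot_delta (proj_sym (projP _ _) (projP u (delta j v))).
  rewrite (dot_act hip _ _ xy).
  rewrite (@eq_dot _ _ _ u u _ (proj u (delta j (y v))))//; last first.
    by move=> l /=; rewrite -/(block u l j v) yt.
  rewrite -(proj_sym uu (projP _ _)) dot_delta /=.
  have h u1 v1 : rip (x u1) v1 = rip u1 (y v1) by congr (re _); exact: xy.
  by rewrite h.
move=> e e0; have [+ _] := projP u (act x u) => /(_ _ e0)[a Aa za]; exists a => //.
by move: za; congr (_ < _); apply: eq_dot => k; rewrite !ell2_subE zx.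
Qed.

End Density.

Section Interleaving.
Context {R : realType}.
Local Notation C := (cplx R).
Context {H : completeNormedModType C} (ip : {dot H for Num.conj}).
Hypothesis hip : hilbert ip.
Local Notation rip := (rip ip).
Local Notation sqn u := (rip u u).
Local Notation ell2 := (ell2 ip).
Local Notation act := (ell2_act hip).
Local Notation normsq u := (dot u u).

Lemma sum_double (g : nat -> R) n :
  \sum_(0 <= k < n.*2) g k = \sum_(0 <= k < n) (g k.*2 + g k.*2.+1).
Proof.
elim: n => [|n IH]; first by rewrite !big_geq.
by rewrite doubleS !big_nat_recr //= IH addrA.
Qed.

(** Merges two test sequences into one, so that the intersection of two strong neighbourhoods
    contains a third. *)
Definition interleave (u v : nat -> H) k := if odd k then v k./2 else u k./2.

Fact interleave_bound (u v : ell2) :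
  exists K, forall n, \sum_(0 <= k < n) sqn (interleave u v k) <= K.
Proof.
exists (normsq u + normsq v) => n.
apply: (@le_trans _ _ (\sum_(0 <= k < n.*2) sqn (interleave u v k))).
  rewrite -addnn (@big_cat_nat _ _ _ n 0 (n + n)) ?leq_addr//= lerDl.
  by apply: sumr_ge0 => *; exact: rip_ge0.
rewrite sum_double.
rewrite (eq_bigr (fun k => sqn (u k) + sqn (v k))) => [|k _].
  by rewrite big_split /= lerD ?dot_partial.
by rewrite /interleave /= odd_double /= doubleK uphalf_double.
Qed.
Definition ell2_interleave u v := Ell2 (interleave_bound u v).

Lemma normsq_act_interleave (x : bop H) u v :
  normsq (act x u) <= normsq (act x (ell2_interleave u v)) /\
  normsq (act x v) <= normsq (act x (ell2_interleave u v)).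
Proof.
split; apply: dot_le => n; apply: le_trans (dot_partial _ n.*2);
  rewrite sum_double ler_sum// => k _;
  rewrite /= /interleave /= odd_double /= doubleK uphalf_double.
  by rewrite lerDl rip_ge0.
by rewrite lerDr rip_ge0.
Qed.

End Interleaving.

Section Adjoints.
Context {R : realType}.
Local Notation C := (cplx R).
Context {H : completeNormedModType C} (ip : {dot H for Num.conj}).
Hypothesis hip : hilbert ip.
Implicit Types x y : bop H.

Lemma ip_inj (v w : H) : (forall z, ip v z = ip w z) -> v = w.
Proof. by move=> e; apply: (rip_inj hip) => z; rewrite /rip e. Qed.

Lemma adjoint_unique x y z : is_adjoint ip x y -> is_adjoint ip x z -> y = z.
Proof.
move=> xy xz; apply: bopP => v; apply: ip_inj => w.
by rewrite (is_adjoint_sym xy) -(is_adjoint_sym xz).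
Qed.
Lemma adjE x y : is_adjoint ip x y -> adj ip x = y.
Proof.
move=> xy; apply: xget_unique => // z xz; exact: adjoint_unique xz xy.
Qed.
Lemma is_adjoint_comb (c : C) x y x' y' : is_adjoint ip x x' -> is_adjoint ip y y' ->
  is_adjoint ip (c *: x + y) (c^* *: x' + y').
Proof.
move=> xx yy u v /=.
by rewrite ipDl ipZl xx yy ipDr ipZr conjCK.
Qed.
Lemma is_adjoint_mul x y x' y' : is_adjoint ip x x' -> is_adjoint ip y y' ->
  is_adjoint ip (x * y) (y' * x').
Proof. by move=> xx yy u v /=; rewrite xx yy. Qed.
Lemma is_adjoint1 : is_adjoint ip 1 1. Proof. by []. Qed.

Lemma bop_scale_mull (c : C) x y : (c *: x) * y = c *: (x * y).
Proof. exact: bopP. Qed.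
Lemma bop_scale_mulr (c : C) x y : x * (c *: y) = c *: (x * y).
Proof. by apply: bopP => u /=; rewrite bop_mapZ. Qed.

Section Algebra.
Variable M : set (bop H).
Hypothesis hM : is_vNalgebra ip M.

Lemma vN_comb (c : C) x y : M x -> M y -> M (c *: x + y).
Proof. by move=> Mx My; apply: (vN_add hM) => //; exact: (vN_scale hM). Qed.
Lemma vN_sub x y : M x -> M y -> M (x - y).
Proof. by move=> Mx My; rewrite addrC -scaleN1r; exact: vN_comb. Qed.
Lemma vN_isadj x : M x -> is_adjoint ip x (adj ip x).
Proof. by move=> /(vN_adj hM)[y _ xy]; rewrite (adjE xy). Qed.
Lemma vN_adjM x : M x -> M (adj ip x).
Proof. by move=> /(vN_adj hM)[y My xy]; rewrite (adjE xy). Qed.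
Lemma vN_adjK x : M x -> adj ip (adj ip x) = x.
Proof. by move=> /vN_isadj/is_adjoint_sym/adjE. Qed.
Lemma vN_adjD x y : M x -> M y -> adj ip (x + y) = adj ip x + adj ip y.
Proof.
move=> /vN_isadj xx /vN_isadj yy; apply: adjE => u v.
by rewrite /= ipDl xx yy ipDr.
Qed.
Lemma vN_adjZ (c : C) x : M x -> adj ip (c *: x) = c^* *: adj ip x.
Proof.
move=> /vN_isadj xx; apply: adjE => u v.
by rewrite /= ipZl xx ipZr conjCK.
Qed.
Lemma vN_adjB x y : M x -> M y -> adj ip (x - y) = adj ip x - adj ip y.
Proof.
move=> /vN_isadj xx /vN_isadj yy; apply: adjE.
have := is_adjoint_comb (-1) yy xx; rewrite rmorphN rmorph1 !scaleN1r.
by rewrite ![_ + adj _ x]addrC ![- _ + x]addrC.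
Qed.
Lemma vN_adjMul x y : M x -> M y -> adj ip (x * y) = adj ip y * adj ip x.
Proof. by move=> /vN_isadj xx /vN_isadj yy; apply: adjE; exact: is_adjoint_mul. Qed.
Lemma vN_adj1 : adj ip 1 = 1.
Proof. by apply: adjE. Qed.

Lemma Wstar_min (S N : set (bop H)) : is_vNalgebra ip N -> S `<=` N -> Wstar ip S `<=` N.
Proof. by move=> hN SN x; apply. Qed.
Lemma Wstar_sub (S : set (bop H)) : S `<=` Wstar ip S.
Proof. by move=> x Sx N [_]; apply. Qed.
Lemma Wstar_vN (S : set (bop H)) : S `<=` M -> is_vNalgebra ip (Wstar ip S).
Proof.
move=> SM; split.
- by move=> N [hN _]; exact: (vN_one hN).
- by move=> x y Sx Sy N hN; apply: (vN_add hN.1); [exact: Sx|exact: Sy].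
- by move=> c x Sx N hN; apply: (vN_scale hN.1); exact: Sx.
- by move=> x y Sx Sy N hN; apply: (vN_mul hN.1); [exact: Sx|exact: Sy].
(* [M] belongs to the intersected family, which gives [x] an adjoint; by uniqueness it lies in every
   other member. *)
- move=> x Sx; exists (adj ip x); last by apply: vN_isadj; exact: (Sx M).
  by move=> N hN; have [y Ny xy] := vN_adj hN.1 (Sx N hN); rewrite (adjE xy).
- move=> F FF FS x Fx N hN; apply: (@vN_closed _ _ _ _ hN.1 F) => //.
  by apply: filterS FS => y; apply.
Qed.

End Algebra.

Section PolynomialAlgebra.
Context {I : Type} (Z : I -> bop H).
Hypothesis Zsa : forall i, selfadjoint ip (Z i).

Definition ev (p : ncpoly C I) : bop H := nceval (fun c : C => c *: (1 : bop H)) Z p.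

Definition polys : set (bop H) := range ev.

Fixpoint ncadj (p : ncpoly C I) : ncpoly C I :=
  match p with
  | NCone => NCone
  | NCconst c => NCconst c^*
  | NCvar i => NCvar i
  | NCadd p q => NCadd (ncadj p) (ncadj q)
  | NCmul p q => NCmul (ncadj q) (ncadj p)
  end.

Definition nccomb (c : C) p q : ncpoly C I := NCadd (NCmul (NCconst c) p) q.

Lemma ev_comb c p q : ev (nccomb c p q) = c *: ev p + ev q.
Proof. by rewrite /ev /= bop_scale_mull mul1r. Qed.

Lemma ev_adj p : is_adjoint ip (ev p) (ev (ncadj p)).
Proof.
elim: p => [|c|i|p IHp q IHq|p IHp q IHq] /=.
- exact: is_adjoint1.
- exact: scalar_adjoint.
- exact: Zsa.
- by move=> u v; rewrite /= ipDl IHp IHq ipDr.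
- exact: is_adjoint_mul.
Qed.

Lemma polys1 : polys 1. Proof. by exists NCone. Qed.
Lemma polys_comb (c : C) a b : polys a -> polys b -> polys (c *: a + b).
Proof. by move=> [p _ <-] [q _ <-]; exists (nccomb c p q); rewrite // ev_comb. Qed.
Lemma polys_mul a b : polys a -> polys b -> polys (a * b).
Proof. by move=> [p _ <-] [q _ <-]; exists (NCmul p q). Qed.
Lemma polys_adj a : polys a -> exists2 b, polys b & is_adjoint ip a b.
Proof. by move=> [p _ <-]; exists (ev (ncadj p)); [exists (ncadj p)|exact: ev_adj]. Qed.

Variable M : set (bop H).
Hypothesis hM : is_vNalgebra ip M.
Hypothesis ZM : forall i, M (Z i).

Lemma ev_M p : M (ev p).
Proof.
elim: p => [|c|i|p IHp q IHq|p IHp q IHq] /=.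
- exact: (vN_one hM).
- exact/(vN_scale hM)/(vN_one hM).
- exact: ZM.
- exact: (vN_add hM).
- exact: (vN_mul hM).
Qed.

(** Yields the inclusion of [Wstar] in the bicommutant. The intersection with [M] supplies the
    adjoints of its elements. *)
Lemma bicommutant_vN :
  is_vNalgebra ip [set x | M x /\ forall t, commutant ip polys t -> x * t = t * x].
Proof.
split.
- by split=> [|t _]; [exact: (vN_one hM)|rewrite mul1r mulr1].
- move=> x y [Mx xt] [My yt]; split=> [|t tA]; first exact: (vN_add hM).
  by rewrite mulrDl mulrDr xt// yt.
- move=> c x [Mx xt]; split=> [|t tA]; first exact: (vN_scale hM).
  by rewrite bop_scale_mull bop_scale_mulr xt.
- move=> x y [Mx xt] [My yt]; split=> [|t tA]; first exact: (vN_mul hM).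
  by rewrite -mulrA yt// mulrA xt// mulrA.
- move=> x [Mx xt]; have [y My xy] := vN_adj hM Mx; exists y => //; split=> // t [[s ts] tA].
  (* Polynomials are closed under adjoints, so the adjoint [s] of [t] is in the commutant as well;
     taking adjoints in s x = x s gives the relation for [y]. *)
  have sA : commutant ip polys s.
    split=> [|a Aa]; first by exists t; exact: is_adjoint_sym.
    have [b Ab ab] := polys_adj Aa.
    apply: (@adjoint_unique (b * t)).
      by apply: is_adjoint_mul => //; exact: is_adjoint_sym.
    by rewrite -tA//; apply: is_adjoint_mul => //; exact: is_adjoint_sym.
  apply: (@adjoint_unique (s * x)).
    by apply: is_adjoint_mul => //; exact: is_adjoint_sym.
  by rewrite -xt//; apply: is_adjoint_mul => //; exact: is_adjoint_sym.
- move=> F FF FM x Fx; split=> [|t [[s ts] tA]].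
    by apply: (@vN_closed _ _ _ _ hM F) => //; apply: filterS FM => y [].
  apply: bopP => u; apply: ip_inj => v /=.
  rewrite (ts (x u)).
  have h1 := Fx (t u) v; have h2 := Fx u (s v).
  (* In the limit [t] is carried to the second argument by its adjoint, where weak convergence
     applies directly. *)
  suff h3 : (fun y : bop H => ip (y (t u)) v) @ F --> ip (x u) (s v).
    by rewrite -(cvg_lim _ h3)// -(cvg_lim _ h1).
  apply: cvg_trans h2; apply: near_eq_cvg; apply: filterS FM => y [My yt] /=.
  by rewrite -ts; have /(congr1 (fun z : bop H => z u)) /= -> := yt t (conj (ex_intro _ s ts) tA).
Qed.

Lemma Wstar_bicommutant x : Wstar ip (range Z) x ->
  M x /\ forall t, commutant ip polys t -> x * t = t * x.
Proof.
apply: (Wstar_min bicommutant_vN) => _ [i _ <-]; split=> // t [_ tA].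
by rewrite tA//; exists (NCvar i).
Qed.

Lemma ev_Wstar p : Wstar ip (range Z) (ev p).
Proof.
move=> N [hN ZN]; elim: p => [|c|i|p IHp q IHq|p IHp q IHq] /=.
- exact: (vN_one hN).
- exact/(vN_scale hN)/(vN_one hN).
- by apply: ZN; exists i.
- exact: (vN_add hN).
- exact: (vN_mul hN).
Qed.

(** The sigma-strong neighbourhood filter of [x] restricted to polynomials. Rescaling [u] produces
    all radii from the bound 1. *)
Definition strong_filter (x : bop H) : set_system (bop H) := fun Q =>
  exists u : ell2 ip, forall y, polys y -> dot (ell2_act hip (y - x) u) (ell2_act hip (y - x) u) <= 1 -> Q y.

(** That its members are nonempty is the density theorem; stability under intersection comes from
    interleaving. *)
Lemma strong_filter_proper x : Wstar ip (range Z) x -> ProperFilter (strong_filter x).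
Proof.
move=> xW; have [Mx xt] := Wstar_bicommutant xW.
split; last first.
  split.
  - by exists (ell2_0 ip).
  - move=> P Q [u Pu] [v Qv]; exists (ell2_interleave u v) => y yA yuv.
    have [h1 h2] := normsq_act_interleave hip (y - x) u v.
    by split; [apply: Pu|apply: Qv]; rewrite // (le_trans _ yuv).
  - by move=> P Q PQ [u Pu]; exists u => y yA yu; exact/PQ/Pu.
move=> [u Hu].
have xx := vN_isadj hM Mx.
have [a Aa au] := bicommutant_closure hip polys1 polys_comb polys_mul polys_adj u xx xt ltr01.
apply: (Hu a Aa); apply: ltW; apply: le_lt_trans au; apply: dot_le => n.
apply: le_trans (dot_partial _ n); rewrite ler_sum// => k _.
by rewrite ell2_subE /= -opprB ripNl ripNr opprK.
Qed.

End PolynomialAlgebra.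

End Adjoints.

(** * Traces and L^2 *)

Lemma real_cauchy_cvg (R : realType) (u : nat -> R) :
  (forall eps, 0 < eps -> exists N, forall k l, (N <= k)%N -> (N <= l)%N ->
     `|u k - u l| < eps) -> cvgn u.
Proof.
move=> uC; apply: cauchy_cvg; apply: cauchy_exP => e e0.
have [N HN] := uC _ e0; exists (u N), N => // k /= Nk.
by rewrite -ball_normE /= HN.
Qed.

Section Trace.
Context {R : realType}.
Local Notation C := (cplx R).
Context {H : completeNormedModType C} (ip : {dot H for Num.conj}).
Hypothesis hip : hilbert ip.
Variables (M : set (bop H)) (tau : bop H -> C).
Hypotheses (hM : is_vNalgebra ip M) (htau : is_tracial_state ip M tau).
Local Notation adj := (adj ip).
Local Notation norm2 := (norm2 ip tau).
Implicit Types x y : bop H.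
Local Notation im_unit := (mkC 0 1 : C).

Ltac inM := solve [repeat first [assumption | apply: (vN_sub hM)
  | apply: (vN_add hM) | apply: (vN_mul hM) | apply: (vN_scale hM)
  | apply: (vN_adjM hip hM) | exact: (vN_one hM)]].

Lemma vN0 : M 0.
Proof. by have := vN_sub hM (vN_one hM) (vN_one hM); rewrite subrr. Qed.
Lemma tau0 : tau 0 = 0.
Proof.
by have := tau_linear htau (-1) vN0 vN0; rewrite scaler0 addr0 mulN1r addNr.
Qed.
Lemma tauD x y : M x -> M y -> tau (x + y) = tau x + tau y.
Proof. by move=> Mx My; have := tau_linear htau 1 Mx My; rewrite scale1r mul1r. Qed.
Lemma tauZ c x : M x -> tau (c *: x) = c * tau x.
Proof. by move=> Mx; have := tau_linear htau c Mx vN0; rewrite !addr0 tau0 addr0. Qed.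
Lemma tauN x : M x -> tau (- x) = - tau x.
Proof. by move=> Mx; rewrite -scaleN1r tauZ// mulN1r. Qed.
Lemma tauB x y : M x -> M y -> tau (x - y) = tau x - tau y.
Proof.
by move=> Mx My; rewrite tauD// ?tauN// -scaleN1r; exact: (vN_scale hM).
Qed.

Lemma im_tau_sq x : M x -> im (tau (adj x * x)) = 0.
Proof. by move=> /(tau_positive htau); rewrite ge0_cplx => /andP[/eqP]. Qed.
Lemma re_tau_sq x : M x -> 0 <= re (tau (adj x * x)).
Proof. by move=> /(tau_positive htau); rewrite ge0_cplx => /andP[]. Qed.

(** Positivity at 1 + y forces tau y and tau (adj y) to have opposite imaginary parts; the same fact
    for i x gives the real parts. *)
Lemma tau_adj x : M x -> tau (adj x) = (tau x)^*.
Proof.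
have M1 := vN_one hM.
have key y : M y -> im (tau (adj y)) = - im (tau y).
  move=> My; have My' := vN_adjM hip hM My.
  have := im_tau_sq (vN_add hM M1 My).
  rewrite (vN_adjD hip hM)// (vN_adj1 hip) mulrDl !mulrDr !mul1r mulr1.
  rewrite !tauD ?imD; try inM.
  by rewrite im_tau_sq// (tau_one htau) /=; lra.
move=> Mx; apply: cplxP; last by rewrite key// imJ.
have Mi := vN_scale hM im_unit Mx.
have := key _ Mi; rewrite (vN_adjZ hip hM)// !tauZ//; last exact: (vN_adjM hip hM).
by rewrite !imM !reJ !imJ /=; lra.
Qed.

Definition tform x y : R := re (tau (adj y * x)).

Lemma tform_comb (c : R) x y z : M x -> M y -> M z ->
  tform (mkC c 0 *: x + y) z = c * tform x z + tform y z.
Proof.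
move=> Mx My Mz; have Mz' := vN_adjM hip hM Mz.
rewrite /tform mulrDr bop_scale_mulr tauD ?tauZ; last 3 first.
- exact: (vN_mul hM).
- exact/(vN_scale hM)/(vN_mul hM).
- exact: (vN_mul hM).
by rewrite reD reM /= mul0r subr0.
Qed.

Lemma tform_sym x y : M x -> M y -> tform x y = tform y x.
Proof.
move=> Mx My; rewrite /tform -reJ -tau_adj; last exact/(vN_mul hM)/Mx/(vN_adjM hip hM).
by rewrite (vN_adjMul hip hM) ?(vN_adjK hip hM)//; exact: (vN_adjM hip hM).
Qed.

Lemma tform_ge0 x : M x -> 0 <= tform x x.
Proof. exact: re_tau_sq. Qed.

Let E := {x | M x}.
Let Ecomb (c : R) (x y : E) : E := exist M _ (vN_comb hM (mkC c 0) (svalP x) (svalP y)).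

Lemma tform_CauchySchwarz x y : M x -> M y -> tform x y ^+ 2 <= tform x x * tform y y.
Proof.
move=> Mx My.
apply: (form_CauchySchwarz (comb := Ecomb) (s := fun x y : E => tform (sval x) (sval y))
  _ _ _ (exist M _ Mx) (exist M _ My)).
- by move=> c [f ?] [g ?] [h ?]; exact: tform_comb.
- by move=> [f ?] [g ?]; exact: tform_sym.
- by move=> [f ?]; exact: tform_ge0.
Qed.

Lemma norm2_ge0 x : 0 <= norm2 x. Proof. exact: sqrtr_ge0. Qed.
Lemma sqr_norm2 x : M x -> norm2 x ^+ 2 = tform x x.
Proof. by move=> Mx; rewrite sqr_sqrtr// tform_ge0. Qed.

Lemma normr_tform_le x y : M x -> M y -> `|tform x y| <= norm2 x * norm2 y.
Proof.
move=> Mx My; rewrite -(ler_pXn2r (n := 2)) ?nnegrE ?mulr_ge0 ?norm2_ge0//.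
rewrite real_normK ?num_real// exprMn !sqr_norm2//; exact: tform_CauchySchwarz.
Qed.

Lemma norm2_adj x : M x -> norm2 (adj x) = norm2 x.
Proof.
move=> Mx; rewrite /Defs.norm2 (vN_adjK hip hM)// (tau_tracial htau)//.
exact: (vN_adjM hip hM).
Qed.

Lemma tformDl x y z : M x -> M y -> M z -> tform (x + y) z = tform x z + tform y z.
Proof. by move=> *; rewrite -[x]scale1r -mkC1 tform_comb// mul1r mkC1 scale1r. Qed.

Lemma norm2D x y : M x -> M y -> norm2 (x + y) <= norm2 x + norm2 y.
Proof.
move=> Mx My; have Mxy := vN_add hM Mx My.
rewrite -(ler_pXn2r (n := 2)) ?nnegrE ?addr_ge0 ?norm2_ge0//.
rewrite sqrrD !sqr_norm2// tformDl// !(tform_sym _ Mxy)// !tformDl// (tform_sym My Mx).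
have := ler_norm (tform x y); have := normr_tform_le Mx My; lra.
Qed.

Lemma norm2Z (c : C) x : M x -> norm2 (c *: x) = Num.sqrt (sqmod c) * norm2 x.
Proof.
move=> Mx; rewrite /Defs.norm2 -sqrtrM ?sqmod_ge0//; congr Num.sqrt.
have Mx' := vN_adjM hip hM Mx; have Mxx := vN_mul hM Mx' Mx.
rewrite (vN_adjZ hip hM)// bop_scale_mull bop_scale_mulr !tauZ//; last exact: (vN_scale hM).
by rewrite mulrA [c^* * c]mulrC mulcJ reM /= mul0r subr0.
Qed.

Lemma norm2N x : M x -> norm2 (- x) = norm2 x.
Proof.
by move=> Mx; rewrite -scaleN1r norm2Z// /sqmod reN imN /= oppr0 sqrrN expr0n addr0 expr1n sqrtr1 mul1r.
Qed.

Lemma norm2B x y : M x -> M y -> norm2 (x - y) = norm2 (y - x).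
Proof. by move=> Mx My; rewrite -opprB norm2N//; exact: (vN_sub hM). Qed.

Lemma re_tau_mul_le x y : M x -> M y -> `|re (tau (x * y))| <= norm2 x * norm2 y.
Proof.
move=> Mx My; have Mx' := vN_adjM hip hM Mx.
rewrite -{1}(vN_adjK hip hM Mx) -/(tform y (adj x)) mulrC -(norm2_adj Mx).
exact: normr_tform_le.
Qed.

Lemma im_tau_mul_le x y : M x -> M y -> `|im (tau (x * y))| <= norm2 x * norm2 y.
Proof.
move=> Mx My.
have := re_tau_mul_le (vN_scale hM im_unit Mx) My.
rewrite bop_scale_mull tauZ; last exact: (vN_mul hM).
by rewrite reM /= mul0r mul1r sub0r normrN norm2Z// /sqmod /= expr0n expr1n add0r sqrtr1 mul1r.
Qed.

Lemma norm2_1 : norm2 1 = 1.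
Proof. by rewrite /Defs.norm2 (vN_adj1 hip) mulr1 (tau_one htau) /= sqrtr1. Qed.

Section StrongApproximation.
Context {I : Type} (Z : I -> bop H).
Hypotheses (Zsa : forall i, selfadjoint ip (Z i)) (ZM : forall i, M (Z i)).

(** [dot] sees real parts only; the imaginary part is obtained by multiplying the second factor by
    i. *)
Lemma cvg_ip_series (D : bop H) (u v : ell2 ip) :
  series (fun k => ip (D (u k)) (D (v k))) @ \oo -->
  mkC (dot (ell2_act hip D u) (ell2_act hip D v))
      (dot (ell2_act hip D u) (ell2_act hip (im_unit *: D) v)).
Proof.
apply/cplx_cvgP; split=> /=.
  have -> : (fun n => re (series (fun k => ip (D (u k)) (D (v k))) n)) =
      series (fun k => rip ip (ell2_act hip D u k) (ell2_act hip D v k)).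
    by apply/funext => n; rewrite /series /= re_sum.
  exact: dot_cvg.
have -> : (fun n => im (series (fun k => ip (D (u k)) (D (v k))) n)) =
    series (fun k => rip ip (ell2_act hip D u k) (ell2_act hip (im_unit *: D) v k)).
  by apply/funext => n; rewrite /series /= im_sum; apply: eq_bigr => k _ /=; rewrite rip_i.
exact: dot_cvg.
Qed.

Lemma normsq_act_scale (D : bop H) c (w : ell2 ip) :
  dot (ell2_act hip D (ell2_act hip (mkC c 0 *: (1 : bop H)) w))
      (ell2_act hip D (ell2_act hip (mkC c 0 *: (1 : bop H)) w)) =
  c ^+ 2 * dot (ell2_act hip D w) (ell2_act hip D w).
Proof.
pose w' := ell2_act hip (mkC c 0 *: (1 : bop H)) (ell2_act hip D w).
rewrite (@eq_dot _ _ _ _ w' _ w'); last 2 first.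
- by move=> k /=; rewrite bop_mapZ.
- by move=> k /=; rewrite bop_mapZ.
by rewrite dot_scale dot_sym dot_scale mulrA expr2.
Qed.

Lemma strong_filter_polys x : Wstar ip (range Z) x -> strong_filter hip Z x (polys Z).
Proof. by move=> _; exists (ell2_0 ip). Qed.

(** For D = l (y - x) r, the operator [adj D * D] tends sigma-weakly to 0: its coefficients are <D
    u, D v>, where [r] is absorbed in the vectors and [l] costs only its norm. Normality of tau then
    makes the 2-norm of D tend to 0. *)
Lemma strong_filter_small x l r eps : Wstar ip (range Z) x -> M l -> M r -> 0 < eps ->
  strong_filter hip Z x [set y | norm2 (l * (y - x) * r) < eps].
Proof.
move=> xW Ml Mr eps0.
have [Mx _] := Wstar_bicommutant hip Zsa hM ZM xW.
have FF := strong_filter_proper hip Zsa hM ZM xW.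
set F := strong_filter hip Z x in FF *.
pose D y := l * (y - x) * r.
have MD y : polys Z y -> M (D y).
  by move=> [p _ <-]; have := ev_M hM ZM p => ?; rewrite /D; inM.
pose g y := adj (D y) * D y.
have GM : (g @ F) M.
  apply: filterS (strong_filter_polys xW) => y /MD MDy; rewrite /preimage /= /g; inM.
have G0 : sigma_weak_cvg ip (g @ F) 0.
  move=> u v /(ell2_square_summable hip) u2 /(ell2_square_summable hip) v2.
  pose Us := Ell2 u2; pose Vs := Ell2 v2.
  have -> : limn (series (fun k => ip ((0 : bop H) (u k)) (v k))) = 0.
    have -> : series (fun k => ip ((0 : bop H) (u k)) (v k)) = (fun=> 0).
      apply/funext => n; rewrite /series /= big1// => k _; exact: linear0l.
    exact: lim_cst.
  have gE y : polys Z y -> limn (series (fun k => ip (g y (u k)) (v k))) =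
      mkC (dot (ell2_act hip (D y) Us) (ell2_act hip (D y) Vs))
          (dot (ell2_act hip (D y) Us) (ell2_act hip (im_unit *: D y) Vs)).
    move=> /MD MDy; have -> : (fun k => ip (g y (u k)) (v k)) =
        (fun k => ip (bop_fun (D y) (Us k)) (bop_fun (D y) (Vs k))).
      by apply/funext => k; rewrite /g /= (is_adjoint_sym (vN_isadj hip hM MDy)).
    by apply/cvg_lim => //; exact: cvg_ip_series.
  have [K K0 lK] := ell2_act_le hip l.
  have small e : 0 < e -> exists w : ell2 ip, forall y,
      dot (ell2_act hip (y - x) w) (ell2_act hip (y - x) w) <= 1 ->
      dot (ell2_act hip (D y) Us) (ell2_act hip (D y) Us) < e /\
      dot (ell2_act hip (D y) Vs) (ell2_act hip (D y) Vs) < e.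
    move=> e0; have K1 : 0 < K + 1 by rewrite ltr_wpDl.
    (* Scaling the test sequence by [c] turns the bound 1 of the filter into e / (K + 1), where [K]
       bounds the squared norm of [l]. *)
    pose c := Num.sqrt ((K + 1) / e).
    have c2 : c ^+ 2 = (K + 1) / e by rewrite sqr_sqrtr// divr_ge0// ltW.
    exists (ell2_act hip (mkC c 0 *: (1 : bop H))
      (ell2_interleave (ell2_act hip r Us) (ell2_act hip r Vs))) => y.
    rewrite normsq_act_scale c2.
    have [] := normsq_act_interleave hip (y - x) (ell2_act hip r Us) (ell2_act hip r Vs).
    move: (dot (ell2_act hip (y - x) (ell2_interleave _ _)) _) => q qU qV q1.
    have qe : K * q < e.
      have q0 : 0 <= q by apply: le_trans qU; exact: dot_ge0.
      move: q1; rewrite mulrAC ler_pdivrMr// mul1r => q1.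
      have [->|q0'] := eqVneq q 0; first by rewrite mulr0.
      have : 0 < q by rewrite lt_neqAle eq_sym q0'.
      by move: q1; nra.
    split; apply: le_lt_trans qe.
      apply: le_trans (lK (ell2_act hip (y - x) (ell2_act hip r Us))) _.
      by rewrite ler_wpM2l.
    apply: le_trans (lK (ell2_act hip (y - x) (ell2_act hip r Vs))) _.
    by rewrite ler_wpM2l.
  have sq_lt (p a b e : R) : 0 < e -> 0 <= a -> 0 <= b -> p ^+ 2 <= a * b -> a < e -> b < e -> `|p| < e.
    move=> e0 a0 b0 pab ae be.
    rewrite -(ltr_pXn2r (n := 2)) ?nnegrE ?(ltW e0)// real_normK ?num_real//.
    by apply: le_lt_trans pab _; rewrite expr2 ltr_pM.
  have iV y : dot (ell2_act hip (im_unit *: D y) Vs) (ell2_act hip (im_unit *: D y) Vs)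
      = dot (ell2_act hip (D y) Vs) (ell2_act hip (D y) Vs).
    by apply: eq_limn_series => k; exact: ripiZ.
  apply/cplx_cvgP; split; apply/cvgrPdist_lt => e e0; have [w Hw] := small _ e0.
    exists w => y yA /Hw[h1 h2]; rewrite /= (gE _ yA) sub0r normrN /=.
    by apply: sq_lt (dot_CauchySchwarz _ _) h1 h2; rewrite ?dot_ge0.
  exists w => y yA /Hw[h1 h2]; rewrite /= (gE _ yA) sub0r normrN /=.
  by apply: sq_lt (dot_CauchySchwarz _ _) h1 _; rewrite ?dot_ge0// iV.
have := tau_normal htau (fmap_proper_filter g FF) GM vN0 G0; rewrite tau0 => /cplx_cvgP[/cvgrPdist_lt/(_ _ (exprn_gt0 2 eps0)) + _].
apply: filterS2 (strong_filter_polys xW) => y yA /=.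
rewrite sub0r normrN /= -/(tform (D y) (D y)) -sqr_norm2; last exact: MD.
by rewrite ger0_norm ?sqr_ge0// ltr_pXn2r ?nnegrE ?norm2_ge0// ltW.
Qed.

End StrongApproximation.

End Trace.

Section SquareIntegrable.
Context {R : realType}.
Local Notation C := (cplx R).
Context {H : completeNormedModType C} (ip : {dot H for Num.conj}).
Hypothesis hip : hilbert ip.
Variables (M : set (bop H)) (tau : bop H -> C).
Hypotheses (hM : is_vNalgebra ip M) (htau : is_tracial_state ip M tau).
Local Notation adj := (adj ip).
Local Notation norm2 := (norm2 ip tau).
Local Notation tform := (tform ip tau).

Ltac inM := solve [repeat first [assumption | apply: (vN_sub hM)
  | apply: (vN_add hM) | apply: (vN_mul hM) | apply: (vN_scale hM)
  | apply: (vN_adjM hip hM) | exact: (vN_one hM)]].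

Section Elements.
Variables (N : set (bop H)) (NM : N `<=` M) (xi : L2 ip N tau).

Lemma L2_M k : M (xi k). Proof. exact: (NM (L2_mem xi k)). Qed.

Lemma norm2_dist_le x y : M x -> M y -> `|norm2 x - norm2 y| <= norm2 (x - y).
Proof.
move=> Mx My; have Mxy : M (x - y) by inM.
have := norm2D hip hM htau Mxy My; rewrite subrK.
have Myx : M (y - x) by inM.
have := norm2D hip hM htau Myx Mx; rewrite subrK (norm2B hip hM htau My Mx).
by move=> h1 h2; rewrite ler_norml; apply/andP; split; lra.
Qed.

Lemma L2_norm_cvg : norm2 (xi k) @[k --> \oo] --> L2_norm xi.
Proof.
apply: real_cauchy_cvg => e e0; have [K HK] := L2_cauchy xi e0.
exists K => k l Kk Kl; apply: le_lt_trans (HK _ _ Kk Kl).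
by apply: norm2_dist_le; exact: L2_M.
Qed.

Lemma L2_norm_ge0 : 0 <= L2_norm xi.
Proof.
rewrite -(cvg_lim _ L2_norm_cvg)//; apply: limr_ge; first exact: cvgP L2_norm_cvg.
by near=> k; exact: norm2_ge0.
Unshelve. all: by end_near. Qed.

Lemma L2_tau_cvg a : M a -> tau (xi k * a) @[k --> \oo] --> L2_tau xi a.
Proof.
move=> Ma; suff [z hz] : exists z : C, tau (xi k * a) @[k --> \oo] --> z.
  by rewrite /L2_tau (cvg_lim _ hz).
have n1 : 0 < norm2 a + 1 by rewrite ltr_wpDl ?norm2_ge0.
have key (f : C -> R) : (forall x, M x -> `|f (tau (x * a))| <= norm2 x * norm2 a) ->
    (forall z w, f (z - w) = f z - f w) ->
    cvgn (fun k => f (tau (xi k * a))).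
  move=> fle fB; apply: real_cauchy_cvg => e e0.
  have [K HK] := L2_cauchy xi (divr_gt0 e0 n1).
  exists K => k l Kk Kl; have Mk := L2_M k; have Ml := L2_M l.
  rewrite -fB -(tauB hM htau); try inM; rewrite -mulrBl.
  have Mkl : M (xi k - xi l) by inM.
  apply: le_lt_trans (fle _ Mkl) _.
  have := HK _ _ Kk Kl; rewrite ltr_pdivlMr//; apply: le_lt_trans.
  by rewrite ler_wpM2l ?norm2_ge0// lerDl.
have /cvg_ex[/= p hp] := key (@re R) (fun x Mx => re_tau_mul_le hip hM htau Mx Ma) (@reB R).
have /cvg_ex[/= q hq] := key (@im R) (fun x Mx => im_tau_mul_le hip hM htau Mx Ma) (@imB R).
by exists (mkC p q); apply/cplx_cvgP.
Qed.

Lemma L2_tau_comb c a b : M a -> M b ->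
  L2_tau xi (c *: a + b) = c * L2_tau xi a + L2_tau xi b.
Proof.
move=> Ma Mb; apply/cvg_lim => //.
have -> : (fun k => tau (xi k * (c *: a + b))) =
    (fun k => c * tau (xi k * a) + tau (xi k * b)).
  apply/funext => k; have Mk := L2_M k.
  by rewrite mulrDr bop_scale_mulr (tau_linear htau)//; inM.
by apply: cvgD; [apply: cvgM; [exact: cvg_cst|exact: L2_tau_cvg]|exact: L2_tau_cvg].
Qed.

(** [f] stands for the real or the imaginary part, so that both are treated at once. *)
Lemma L2_tau_le (f : C -> R) a : M a ->
  (forall x y, M x -> M y -> `|f (tau (x * y))| <= norm2 x * norm2 y) ->
  (forall (u : nat -> C) z, u @ \oo --> z -> f (u k) @[k --> \oo] --> f z) ->
  `|f (L2_tau xi a)| <= L2_norm xi * norm2 a.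
Proof.
move=> Ma fle fc.
have h1 : `|f (tau (xi k * a))| @[k --> \oo] --> `|f (L2_tau xi a)|.
  by apply: cvg_norm; exact: (fc _ _ (L2_tau_cvg Ma)).
have h2 : norm2 (xi k) * norm2 a @[k --> \oo] --> L2_norm xi * norm2 a.
  by apply: cvgM; [exact: L2_norm_cvg|exact: cvg_cst].
rewrite -(cvg_lim _ h1)// -(cvg_lim _ h2)//.
apply: ler_lim; [exact: cvgP h1|exact: cvgP h2|].
by near=> k; apply: fle => //; exact: L2_M.
Unshelve. all: by end_near. Qed.

Lemma re_L2_tau_le a : M a -> `|re (L2_tau xi a)| <= L2_norm xi * norm2 a.
Proof.
move=> Ma; apply: L2_tau_le => // [x y Mx My|u z /cplx_cvgP[]//].
exact: (re_tau_mul_le hip hM htau).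
Qed.
Lemma im_L2_tau_le a : M a -> `|im (L2_tau xi a)| <= L2_norm xi * norm2 a.
Proof.
move=> Ma; apply: L2_tau_le => // [x y Mx My|u z /cplx_cvgP[]//].
exact: (im_tau_mul_le hip hM htau).
Qed.

End Elements.

Section Polynomials.
Context {J : Type} (Z : J -> bop H).
Hypotheses (Zsa : forall i, selfadjoint ip (Z i)) (ZM : forall i, M (Z i)).
Local Notation ev := (ev Z).

Lemma strong_cvg (phi : bop H -> C) (x l r : bop H) (K : R) :
  Wstar ip (range Z) x -> M l -> M r -> 0 <= K ->
  (forall y, M y -> `|re (phi y - phi x)| <= K * norm2 (l * (y - x) * r)) ->
  (forall y, M y -> `|im (phi y - phi x)| <= K * norm2 (l * (y - x) * r)) ->
  phi @ strong_filter hip Z x --> phi x.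
Proof.
move=> xW Ml Mr K0 hre him.
have FF := strong_filter_proper hip Zsa hM ZM xW.
have key (f : C -> R) : (forall z w, f (z - w) = f z - f w) ->
  (forall y, M y -> `|f (phi y - phi x)| <= K * norm2 (l * (y - x) * r)) ->
  (fun y => f (phi y)) @ strong_filter hip Z x --> f (phi x).
  move=> fB hf; apply/cvgrPdist_lt => e e0.
  have K1 : 0 < K + 1 by rewrite ltr_wpDl.
  have := strong_filter_small hip hM htau Zsa ZM xW Ml Mr (divr_gt0 e0 K1).
  apply: filterS2 (strong_filter_polys hip xW) => y [p _ <-] /=.
  have My := ev_M hM ZM p; rewrite ltr_pdivlMr// distrC -fB.
  apply: le_lt_trans; apply: le_trans (hf _ My) _.
  by rewrite mulrC ler_wpM2l ?norm2_ge0// lerDl.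
by apply/cplx_cvgP; split; apply: key => //; [exact: reB|exact: imB].
Qed.

Lemma strong_cvg_tau (x l r : bop H) : Wstar ip (range Z) x -> M l -> M r ->
  (fun y => tau (l * y * r)) @ strong_filter hip Z x --> tau (l * x * r).
Proof.
move=> xW Ml Mr; have [Mx _] := Wstar_bicommutant hip Zsa hM ZM xW.
have M1 := vN_one hM.
have n1 := norm2_1 hip htau.
apply: (@strong_cvg (fun y => tau (l * y * r)) x l r 1) => // y My;
  have My' : M (l * (y - x) * r) by inM.
  have := re_tau_mul_le hip hM htau M1 My'; rewrite n1 mul1r.
  by rewrite -(tauB hM htau) -?mulrBl -?mulrBr//; inM.
have := im_tau_mul_le hip hM htau M1 My'; rewrite n1 mul1r.
by rewrite -(tauB hM htau) -?mulrBl -?mulrBr//; inM.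
Qed.

Lemma strong_cvg_L2_tau (N : set (bop H)) (NM : N `<=` M) (xi : L2 ip N tau) (x l r : bop H) :
  Wstar ip (range Z) x -> M l -> M r ->
  (fun y => L2_tau xi (l * y * r)) @ strong_filter hip Z x --> L2_tau xi (l * x * r).
Proof.
move=> xW Ml Mr; have [Mx _] := Wstar_bicommutant hip Zsa hM ZM xW.
have E y : M y -> L2_tau xi (l * y * r) - L2_tau xi (l * x * r) = L2_tau xi (l * (y - x) * r).
  move=> My; rewrite mulrBr mulrBl.
  have -> : l * y * r - l * x * r = (-1) *: (l * x * r) + l * y * r.
    by rewrite scaleN1r addrC.
  by rewrite (L2_tau_comb NM); [rewrite mulN1r addrC|inM..].
apply: (@strong_cvg (fun y => L2_tau xi (l * y * r)) x l r (L2_norm xi)) => //.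
- exact: (L2_norm_ge0 NM).
- by move=> y My; rewrite E//; apply: (re_L2_tau_le NM); inM.
- by move=> y My; rewrite E//; apply: (im_L2_tau_le NM); inM.
Qed.

(* [ev p] approximates [xi^*] in L^2, whence tau (xi p) is close to |xi|^2. *)
Lemma L2_approx (N : set (bop H)) (NM : N `<=` M) (NZ : N `<=` Wstar ip (range Z))
    (hN : is_vNalgebra ip N) (xi : L2 ip N tau) eta : 0 < eta ->
  exists p, L2_norm xi ^+ 2 - eta <= re (L2_tau xi (ev p)) /\
            tform (ev p) (ev p) <= L2_norm xi ^+ 2 + eta.
Proof.
move=> eta0; set n := L2_norm xi; have n0 : 0 <= n := L2_norm_ge0 NM xi.
have n1 : 0 < 4 * (n + 1) by rewrite mulr_gt0// ltr_wpDl.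
(* Each estimate loses at most dl (4 n + 4), as dl <= 1: the first loses 2 dl (n + dl) in the two
   outer terms and dl (2 n + dl) in passing from [t] to [n]; the second expands (n + 2 dl)^2. *)
pose dl := Num.min 1 (eta / (4 * (n + 1))).
have dl0 : 0 < dl by rewrite lt_min ltr01 divr_gt0.
have dl1 : dl <= 1 by rewrite ge_min lexx.
have dle : dl * (4 * (n + 1)) <= eta by rewrite -ler_pdivlMr// ge_min lexx orbT.
have [K1 H1] := L2_cauchy xi dl0.
have /cvgrPdist_lt/(_ _ dl0)[K2 _ H2] := @L2_norm_cvg _ NM xi.
pose K := maxn K1 K2.
have MK := L2_M NM xi K; have MK' : M (adj (xi K)) by inM.
have aW : Wstar ip (range Z) (adj (xi K)).
  by apply: NZ; apply: (vN_adjM hip hN); exact: (L2_mem xi K).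
have := strong_filter_small hip hM htau Zsa ZM aW (vN_one hM) (vN_one hM) dl0.
have FF := strong_filter_proper hip Zsa hM ZM aW.
move=> /(filterI (strong_filter_polys hip aW))/filter_ex[_ [[p _ <-] /=]].
rewrite mul1r mulr1; have Mp := ev_M hM ZM p => pa.
have := H2 K (leq_maxr _ _); rewrite /= -/n.
have t0 := norm2_ge0 ip tau (xi K).
set t := norm2 (xi K) in t0 * => tn.
have {tn}[tn1 tn2] : t < n + dl /\ n - dl < t.
  by move: tn; rewrite ltr_norml => /andP[]; lra.
exists p; split.
  have hc : re (tau (xi k * ev p)) @[k --> \oo] --> re (L2_tau xi (ev p)).
    by have /cplx_cvgP[] := @L2_tau_cvg _ NM xi _ Mp.
  rewrite -(cvg_lim _ hc)//; apply: limr_ge; first exact: cvgP hc.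
  near=> k.
  have Mk := L2_M NM xi k.
  have kK1 : (K1 <= k)%N by near: k; exact: nbhs_infty_ge.
  have kK2 : (K2 <= k)%N by near: k; exact: nbhs_infty_ge.
  (* The middle term is the squared norm of [xi K]; the outer ones are small by the Cauchy property
     and by the choice of [p]. *)
  have -> : tau (xi k * ev p) = tau ((xi k - xi K) * adj (xi K)) +
      tau (xi K * adj (xi K)) + tau (xi k * (ev p - adj (xi K))).
    rewrite -!(tauD htau); try inM.
    by rewrite mulrBl mulrBr subrK addrC subrK.
  rewrite !reD.
  have MkK : M (xi k - xi K) by inM.
  have MpK : M (ev p - adj (xi K)) by inM.
  have := re_tau_mul_le hip hM htau MkK MK'; have := re_tau_mul_le hip hM htau Mk MpK.
  rewrite (norm2_adj hip hM htau)// -/t.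
  have -> : re (tau (xi K * adj (xi K))) = t ^+ 2.
    by rewrite (sqr_norm2 htau)// /tform (tau_tracial htau).
  have := H1 _ _ kK1 (leq_maxl K1 K2); rewrite -/K.
  have := H2 k kK2; rewrite /= -/n.
  have := norm2_ge0 ip tau (xi k); have := norm2_ge0 ip tau (xi k - xi K).
  have := norm2_ge0 ip tau (ev p - adj (xi K)).
  move: (norm2 (xi k)) (norm2 (xi k - xi K)) pa => s q.
  move: (norm2 (ev p - _)) => v pv v0 q0 s0.
  rewrite ltr_norml => /andP[sn1 sn2] qd.
  rewrite !ler_norml => /andP[h1 _] /andP[h2 _].
  have e1 : s * v <= (n + dl) * dl by apply: ler_pM => //; lra.
  have e2 : q * t <= dl * (n + dl) by apply: ler_pM => //; lra.
  have e3 : n ^+ 2 - t ^+ 2 <= dl * (2 * n + dl).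
    by nra.
  have e4 : dl * dl <= dl by rewrite -[leRHS]mulr1 ler_pM2l.
  move: h1 h2 e1 e2 e3 e4 dle; rewrite !mulrDr !mulrDl; lra.
rewrite -(sqr_norm2 htau)//.
have := norm2D hip hM htau (vN_sub hM Mp MK') MK'; rewrite subrK (norm2_adj hip hM htau)// -/t => h.
have h2 : norm2 (ev p) <= n + 2 * dl by lra.
apply: (@le_trans _ _ ((n + 2 * dl) ^+ 2)).
  by rewrite ler_pXn2r ?nnegrE ?norm2_ge0//; lra.
have e4 : dl * dl <= dl by rewrite -[leRHS]mulr1 ler_pM2l.
move: dle; rewrite sqrrD; lra.
Unshelve. all: by end_near. Qed.

End Polynomials.

End SquareIntegrable.

(** * Free scores *)

Lemma cvg_sum_seq (K : numFieldType) (V : normedModType K) (T : Type)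
    (F : set_system T) (FF : Filter F) (I : Type) (r : seq I) (f : I -> T -> V) (l : I -> V) :
  (forall i, f i @ F --> l i) -> (fun t => \sum_(i <- r) f i t) @ F --> \sum_(i <- r) l i.
Proof.
move=> fl; elim: r => [|i r IH].
  have -> : (fun t => \sum_(i <- [::]) f i t) = (fun=> 0) by apply/funext => t; rewrite big_nil.
  by rewrite big_nil; exact: cvg_cst.
have -> : (fun t => \sum_(j <- i :: r) f j t) = (fun t => f i t + \sum_(j <- r) f j t).
  by apply/funext => t; rewrite big_cons.
by rewrite big_cons; apply: cvgD.
Qed.

Section DerivativeSums.
Context {K : Type} {I : eqType} {A : pzRingType} {V : nmodType}.
Variables (coef : K -> A) (x : I -> A) (i : I).

(** An arbitrary [F] lets the product rule relate sums of the same kind: the undifferentiated factor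
    is absorbed in [F]. Inductions on polynomials therefore generalize [F]. *)
Definition dsum (F : A -> A -> V) (p : ncpoly K I) : V :=
  \sum_(t <- ncderiv i p) F (nceval coef x t.1) (nceval coef x t.2).

Lemma dsum_add F p q : dsum F (NCadd p q) = dsum F p + dsum F q.
Proof. by rewrite /dsum /= big_cat. Qed.

Lemma dsum_mul F p q : dsum F (NCmul p q) =
  dsum (fun a b => F a (b * nceval coef x q)) p +
  dsum (fun a b => F (nceval coef x p * a) b) q.
Proof. by rewrite /dsum /= big_cat !big_map. Qed.

Lemma dsum_const F c : dsum F (NCconst c) = 0.
Proof. by rewrite /dsum big_nil. Qed.

Lemma dsum_one F : dsum F NCone = 0.
Proof. by rewrite /dsum big_nil. Qed.

Lemma dsum_var F j : dsum F (NCvar j) = if j == i then F 1 1 else 0.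
Proof. by rewrite /dsum /=; case: eqP => _; rewrite ?big_cons ?big_nil ?addr0. Qed.

Lemma eq_dsum_in (S : A -> Prop) F G p : (forall q, S (nceval coef x q)) ->
  (forall a b, S a -> S b -> F a b = G a b) -> dsum F p = dsum G p.
Proof. by move=> Sev FG; apply: eq_bigr => t _; apply: FG. Qed.

Lemma eq_dsum F G p : (forall a b, F a b = G a b) -> dsum F p = dsum G p.
Proof. by move=> FG; apply: eq_bigr => t _; apply: FG. Qed.

Lemma dsum_split F G p : dsum (fun a b => F a b + G a b) p = dsum F p + dsum G p.
Proof. by rewrite /dsum big_split. Qed.

End DerivativeSums.

Section Score.
Context {R : realType}.
Local Notation C := (cplx R).
Context {H : completeNormedModType C} (ip : {dot H for Num.conj}).
Hypothesis hip : hilbert ip.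
Variables (M : set (bop H)) (tau : bop H -> C).
Hypotheses (hM : is_vNalgebra ip M) (htau : is_tracial_state ip M tau).
Local Notation adj := (adj ip).
Local Notation norm2 := (norm2 ip tau).
Local Notation tform := (tform ip tau).
Variables (m : nat) (X : 'I_m -> bop H) (B : set (bop H)) (Y : nat -> bop H).
Hypotheses (XM : forall i, M (X i)) (Xsa : forall i, selfadjoint ip (X i))
  (hB : is_vNalgebra ip B) (BM : B `<=` M) (Ysa : forall j, selfadjoint ip (Y j))
  (hYB : Wstar ip (range Y) = B).
Local Notation N := (Wstar ip (B `|` range X)).
Local Notation J := ('I_m + nat)%type.

Ltac inM := solve [repeat first [assumption | apply: (vN_sub hM)
  | apply: (vN_add hM) | apply: (vN_mul hM) | apply: (vN_scale hM)
  | apply: (vN_adjM hip hM) | exact: (vN_one hM)]].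

Let Z : J -> bop H := join_tuple X Y.
Local Notation evZ := (ev Z).

Lemma YB j : B (Y j). Proof. by rewrite -hYB; apply: Wstar_sub; exists j. Qed.
Lemma ZM k : M (Z k). Proof. by case: k => [i|j]; [exact: XM|exact/BM/YB]. Qed.
Lemma Zsa k : selfadjoint ip (Z k).
Proof. by case: k => [i|j]; [exact: Xsa|exact: Ysa]. Qed.
Lemma BXM : B `|` range X `<=` M.
Proof. by move=> x [/BM//|[i _ <-]]; exact: XM. Qed.
Lemma NM : N `<=` M. Proof. exact: (Wstar_min hM BXM). Qed.
Lemma hN : is_vNalgebra ip N. Proof. exact: (Wstar_vN hip hM BXM). Qed.
Lemma hWZ : is_vNalgebra ip (Wstar ip (range Z)).
Proof. by apply: (Wstar_vN hip hM) => _ [k _ <-]; exact: ZM. Qed.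
Lemma BZ : B `<=` Wstar ip (range Z).
Proof.
rewrite -hYB; apply: (Wstar_min hWZ) => _ [j _ <-].
by apply: Wstar_sub; exists (inr j).
Qed.
Lemma NZ : N `<=` Wstar ip (range Z).
Proof.
apply: (Wstar_min hWZ) => x [/BZ//|[i _ <-]].
by apply: Wstar_sub; exists (inl i).
Qed.
Lemma ZN : Wstar ip (range Z) `<=` N.
Proof.
apply: (Wstar_min hN) => _ [[i|j] _ <-]; apply: Wstar_sub.
  by right; exists i.
by left; exact: YB.
Qed.
Lemma evM p : M (evZ p). Proof. exact: (ev_M hM ZM). Qed.

Definition toB (x : bop H) (Bx : B x) : B := exist _ x (mem_set Bx).
Lemma B_scalar (c : C) : B (c *: (1 : bop H)).
Proof. exact/(vN_scale hB)/(vN_one hB). Qed.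

Local Notation evB := (@ncpoly_eval R H 'I_m B X).

Fixpoint trB (p : ncpoly C J) : ncpoly B 'I_m :=
  match p with
  | NCone => NCone
  | NCconst c => NCconst (toB (B_scalar c))
  | NCvar (inl i) => NCvar i
  | NCvar (inr j) => NCconst (toB (YB j))
  | NCadd p q => NCadd (trB p) (trB q)
  | NCmul p q => NCmul (trB p) (trB q)
  end.

Lemma trB_eval p : evB (trB p) = evZ p.
Proof.
by elim: p => [|c|[i|j]|p IHp q IHq|p IHp q IHq] //=;
  rewrite /ncpoly_eval /= -!/(ncpoly_eval _ _) IHp IHq.
Qed.

Local Notation dB i := (dsum (fun b : B => \val b) X i).
Local Notation dZ i := (dsum (fun c : C => c *: (1 : bop H)) Z (inl i)).

(** The variables [Y j] become coefficients, and the derivative in an [X] variable kills both. *)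
Lemma trB_dsum i (F : bop H -> bop H -> C) p : dB i F (trB p) = dZ i F p.
Proof.
elim: p F => [|c|[j|j]|p IHp q IHq|p IHp q IHq] F; rewrite /= ?dsum_one ?dsum_const ?dsum_var//.
  by rewrite !dsum_add IHp IHq.
rewrite !dsum_mul IHp IHq; congr (_ + _).
  by apply: eq_dsum => a b; rewrite -[nceval _ X _]/(evB _) trB_eval.
by apply: eq_dsum => a b; rewrite -[nceval _ X _]/(evB _) trB_eval.
Qed.

Definition tt (a b : bop H) : C := tau a * tau b.
Definition free_div i p : C := dZ i tt p.

Section Extension.
Variables (xi : L2 ip N tau) (i : 'I_m).
Hypothesis xi_poly : forall p, L2_tau xi (evZ p) = free_div i p.

Definition holds (p : ncpoly B 'I_m) := L2_tau xi (evB p) = dB i tt p.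

Lemma evB_M p : M (evB p).
Proof.
elim: p => [|c|j|p IHp q IHq|p IHp q IHq]; rewrite /ncpoly_eval /=.
- exact: (vN_one hM).
- by apply: BM; apply: set_mem; exact: valP.
- exact: XM.
- exact: (vN_add hM).
- exact: (vN_mul hM).
Qed.

Fixpoint embY (p : ncpoly C nat) : ncpoly C J :=
  match p with
  | NCone => NCone
  | NCconst c => NCconst c
  | NCvar j => NCvar (inr j)
  | NCadd p q => NCadd (embY p) (embY q)
  | NCmul p q => NCmul (embY p) (embY q)
  end.
Lemma ev_embY p : evZ (embY p) = ev Y p.
Proof.
elim: p => [|c|j|p IHp q IHq|p IHp q IHq] //=.
  by rewrite -[LHS]/(evZ (embY p) + evZ (embY q)) IHp IHq.
by rewrite -[LHS]/(evZ (embY p) * evZ (embY q)) IHp IHq.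
Qed.
Lemma dsum_embY F p : dZ i F (embY p) = 0 :> C.
Proof.
elim: p F => [|c|j|p IHp q IHq|p IHp q IHq] F; rewrite /= ?dsum_one ?dsum_const ?dsum_var//.
  by rewrite dsum_add IHp IHq addr0.
by rewrite dsum_mul IHp IHq addr0.
Qed.

(** [b] is approximated by polynomials in [Y], whose derivatives vanish. It occurs once in each
    term, between fixed factors, so both sides of the identity are continuous along the strong
    filter. *)
Lemma holds_const (l r : ncpoly B 'I_m) (b : B) :
  (forall q, holds (NCmul (NCmul l (trB q)) r)) -> holds (NCmul (NCmul l (NCconst b)) r).
Proof.
move=> lr.
have YM j : M (Y j) by exact/BM/YB.
have bW : Wstar ip (range Y) (\val b) by rewrite hYB; exact: (set_mem (valP b)).
have FF := strong_filter_proper hip Ysa hM YM bW.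
pose L := evB l; pose Q := evB r.
have [ML MQ] : M L /\ M Q by split; exact: evB_M.
pose rhs y := dB i (fun a c => tt a (c * y * Q)) l + dB i (fun a c => tt (L * y * a) c) r.
have rhsE q : (forall F, dB i F q = 0 :> C) ->
    dB i tt (NCmul (NCmul l q) r) = rhs (evB q).
  by move=> q0; rewrite !dsum_mul q0 addr0.
have rhs_cvg : rhs @ strong_filter hip Y (\val b) --> rhs (\val b).
  rewrite /rhs /dsum; apply: cvgD.
    apply: cvg_sum_seq => t; apply: cvgM; first exact: cvg_cst.
    by apply: (strong_cvg_tau hip hM htau Ysa YM) => //; exact: evB_M.
  apply: cvg_sum_seq => t; apply: cvgM; last exact: cvg_cst.
  have ME : M (evB t.1) by exact: evB_M.
  have -> : (fun y => tau (L * y * nceval (fun b : B => \val b) X t.1)) =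
            (fun y => tau (L * y * evB t.1)) by [].
  exact: (strong_cvg_tau hip hM htau Ysa YM).
have lhs_cvg := strong_cvg_L2_tau (xi := xi) hip hM htau Ysa YM NM bW ML MQ.
have E : L2_tau xi (L * \val b * Q) = rhs (\val b).
  apply: (cplx_cvg_unique FF _ rhs_cvg).
  apply: cvg_trans lhs_cvg; apply: near_eq_cvg.
  apply: filterS (strong_filter_polys hip bW) => _ [q _ <-].
  have := lr (embY q); rewrite /holds rhsE; last by move=> F; rewrite trB_dsum dsum_embY.
  by rewrite trB_eval ev_embY => <-; rewrite -ev_embY -trB_eval.
by rewrite /holds rhsE//= => F; rewrite dsum_const.
Qed.

Lemma L2_tauD a b : M a -> M b -> L2_tau xi (a + b) = L2_tau xi a + L2_tau xi b.
Proof.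
by move=> Ma Mb; have := L2_tau_comb hip hM htau NM xi 1 Ma Mb; rewrite scale1r mul1r.
Qed.

Lemma holdsP p q : evB p = evB q -> dB i tt p = dB i tt q -> (holds p <-> holds q).
Proof. by rewrite /holds => -> ->. Qed.

(** Coefficients in [B] are handled one at a time. The context [l], [r] may still contain arbitrary
    ones; only the hole is filled with polynomials in (X, Y). *)
Lemma holds_context p l r :
  (forall q, holds (NCmul (NCmul l (trB q)) r)) -> holds (NCmul (NCmul l p) r).
Proof.
elim: p l r => [|b|j|p IHp q IHq|p IHp q IHq] l r lr.
- exact: (lr NCone).
- exact: holds_const.
- exact: (lr (NCvar (inl j))).
- have hp := IHp _ _ lr; have hq := IHq _ _ lr; move: hp hq; rewrite /holds.
  have -> : evB (NCmul (NCmul l (NCadd p q)) r) =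
     evB (NCmul (NCmul l p) r) + evB (NCmul (NCmul l q) r).
    by rewrite /ncpoly_eval /= mulrDr mulrDl.
  rewrite L2_tauD; [move=> -> -> |exact: evB_M..].
  pose Q := evB r; pose L := evB l.
  have MQ : M Q by exact: evB_M.
  have ML : M L by exact: evB_M.
  have [Mp Mq] : M (evB p) /\ M (evB q) by split; exact: evB_M.
  have e1 : dB i (fun a b => tt a (b * (evB p + evB q) * Q)) l =
      dB i (fun a b => tt a (b * evB p * Q)) l + dB i (fun a b => tt a (b * evB q * Q)) l.
    rewrite -dsum_split; apply: (@eq_dsum_in _ _ _ _ _ _ _ M) => [|a b Ma Mb]; first exact: evB_M.
    by rewrite /tt mulrDr mulrDl (tauD htau) ?mulrDr//; inM.
  have e2 : dB i (fun a b => tt (L * (evB p + evB q) * a) b) r =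
      dB i (fun a b => tt (L * evB p * a) b) r + dB i (fun a b => tt (L * evB q * a) b) r.
    rewrite -dsum_split; apply: (@eq_dsum_in _ _ _ _ _ _ _ M) => [|a b Ma Mb]; first exact: evB_M.
    by rewrite /tt mulrDr mulrDl (tauD htau) ?mulrDl//; inM.
  rewrite !dsum_mul !dsum_add.
  rewrite -[nceval _ X (NCmul l (NCadd p q))]/(L * (evB p + evB q)).
  rewrite -[nceval _ X (NCadd p q)]/(evB p + evB q) e1 e2.
  rewrite -/(evB p) -/(evB q) -/(evB r) -/(evB l) /=.
  rewrite -/(evB p) -/(evB q) -/(evB r) -/(evB l) -/Q -/L.
  ring.
- have assoc l1 p1 q1 r1 : holds (NCmul (NCmul l1 (NCmul p1 q1)) r1) <->
      holds (NCmul (NCmul l1 p1) (NCmul q1 r1)).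
    apply: holdsP; first by rewrite /ncpoly_eval /= !mulrA.
    rewrite !dsum_mul /= !addrA.
    by congr (_ + _ + _ + _); apply: eq_dsum => a b /=; rewrite ?mulrA.
  have assoc' l1 p1 q1 r1 : holds (NCmul (NCmul l1 (NCmul p1 q1)) r1) <->
      holds (NCmul (NCmul (NCmul l1 p1) q1) r1).
    apply: holdsP; first by rewrite /ncpoly_eval /= !mulrA.
    rewrite !dsum_mul /= !addrA.
    by congr (_ + _ + _ + _); apply: eq_dsum => a b /=; rewrite ?mulrA.
  (* In l (p q) r the factor [p] is treated first, with [q] moved into the right context; then [q],
     with the replacement of [p] in the left context. *)
  apply/assoc/IHp => q1.
  by apply/assoc/assoc'/IHq => q2; apply/assoc'; exact: (lr (NCmul q1 q2)).
Qed.

Lemma holds_all p : holds p.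
Proof.
have : holds (NCmul (NCmul NCone p) NCone).
  apply: holds_context => q; rewrite /holds /ncpoly_eval /= mul1r mulr1.
  rewrite -[nceval _ _ _]/(evB _) trB_eval xi_poly.
  rewrite !dsum_mul !dsum_one addr0 add0r trB_dsum.
  by apply: eq_dsum => a b /=; rewrite mul1r mulr1.
rewrite /holds /ncpoly_eval /= mul1r mulr1 => ->.
rewrite !dsum_mul !dsum_one addr0 add0r.
by apply: eq_dsum => a b /=; rewrite mul1r mulr1.
Qed.

End Extension.

Lemma free_div_comb i c p q :
  free_div i (nccomb c p q) = c * free_div i p + free_div i q.
Proof.
rewrite /free_div /nccomb dsum_add dsum_mul dsum_const add0r; congr (_ + _).
rewrite /dsum mulr_sumr; apply: eq_bigr => t _.
by rewrite /tt /= bop_scale_mull mul1r (tauZ hM htau) ?mulrA//; exact: evM.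
Qed.

Lemma free_div0 i c : free_div i (NCconst c) = 0.
Proof. exact: dsum_const. Qed.

Variable c : R.
Hypothesis young : forall f : 'I_m -> ncpoly C J,
  (\sum_(i < m) re (free_div i (f i))) *+ 2 <= c + \sum_(i < m) tform (evZ (f i)) (evZ (f i)).

Lemma young1 i p : re (free_div i p) *+ 2 <= c + tform (evZ p) (evZ p).
Proof.
have := young (fun j => if j == i then p else NCconst 0).
rewrite (bigD1 i) //= eqxx big1 ?addr0; last first.
  by move=> j /negbTE ->; rewrite free_div0.
rewrite (bigD1 i) //= eqxx big1 ?addr0// => j /negbTE ->.
by rewrite /(tform _ _) /ev /= scale0r mulr0 (tau0 hM htau).
Qed.

(** Riesz representation on polynomial expressions, for the form [tform] and the real part of
    [free_div]. Adjoints of the minimizing sequence are taken because [L2_tau] pairs without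
    conjugation. *)
Lemma free_score_exists i : exists xi : L2 ip N tau,
  forall p, L2_tau xi (evZ p) = free_div i p.
Proof.
pose s p q := tform (evZ p) (evZ q).
have s_comb (a : R) f g h : s (nccomb (mkC a 0) f g) h = a * s f h + s g h.
  by rewrite /s ev_comb (tform_comb hip hM htau)//; exact: evM.
have s_sym f g : s f g = s g f by apply: (tform_sym hip hM htau); exact: evM.
have s_ge0 f : 0 <= s f f by apply: (tform_ge0 htau); exact: evM.
pose phi p := re (free_div i p).
have phi_comb (a : R) f g : phi (nccomb (mkC a 0) f g) = a * phi f + phi g.
  by rewrite /phi free_div_comb reD reM /= mul0r subr0.
have [a [aC aphi]] := form_Riesz s_comb s_sym s_ge0 NCone phi_comb (young1 i).
pose xs k := adj (evZ (a k)).
have xsN k : N (xs k) by apply: (vN_adjM hip hN); apply: ZN; exact: ev_Wstar.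
have xsC eps : 0 < eps -> exists K, forall k l, (K <= k)%N -> (K <= l)%N ->
    norm2 (xs k - xs l) < eps.
  move=> e0; have [K HK] := aC _ (exprn_gt0 2 e0); exists K => k l Kk Kl.
  have := HK _ _ Kl Kk; rewrite /s ev_comb mkCN1 scaleN1r addrC => h.
  have Mk := evM (a k); have Ml := evM (a l).
  have -> : norm2 (xs k - xs l) = norm2 (evZ (a k) - evZ (a l)).
    rewrite -(norm2_adj hip hM htau (vN_sub hM Mk Ml)); congr norm2.
    by rewrite (vN_adjB hip hM).
  rewrite -(ltr_pXn2r (n := 2)) ?nnegrE ?norm2_ge0 ?(ltW e0)//.
  by rewrite (sqr_norm2 htau)//; inM.
pose xi := MkL2 xsN xsC; exists xi => p.
have Mp := evM p.
have tE k q : re (tau (xi k * evZ q)) = s q (a k) by [].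
have re_xi q : re (L2_tau xi (evZ q)) = re (free_div i q).
  have /cplx_cvgP[h _] := @L2_tau_cvg _ _ _ hip _ _ hM htau _ NM xi _ (evM q).
  by rewrite -(cvg_lim _ h)// (cvg_lim _ (aphi q)).
apply: cplxP; first exact: re_xi.
(* The real identity for -i p is the imaginary one for p. *)
have := re_xi (nccomb (mkC 0 (-1)) p (NCconst 0)).
rewrite ev_comb free_div_comb free_div0 addr0.
have -> : evZ (NCconst 0) = 0 by exact: scale0r.
rewrite (L2_tau_comb hip hM htau NM)//; last exact: (vN0 hM).
have -> : L2_tau xi 0 = 0.
  rewrite /L2_tau (_ : (fun k => _) = fun=> 0) ?lim_cst//.
  by apply/funext => k; rewrite mulr0 (tau0 hM htau).
by rewrite addr0 !reM /=; lra.
Qed.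

Lemma free_fisher_le : (free_fisher ip tau B X <= c%:E)%E.
Proof.
rewrite /free_fisher; case: pselect => [h|[]]; last first.
  have [xi hxi] := choice free_score_exists.
  by exists xi => p i; exact: holds_all (hxi i) p.
case: (cid h) => /= xi hxi; rewrite lee_fin.
have xi_poly i p : L2_tau (xi i) (evZ p) = free_div i p.
  by rewrite -trB_eval hxi /free_div -trB_dsum.
apply/ler_addgt0Pr => e e0.
have m1 : 0 < 3 * m%:R + 1 :> R by rewrite ltr_wpDl// mulr_ge0.
(* With S the sum of the squared norms, the inequality for [f] gives 2 (S - m eta) <= c + S + m eta,
   that is S <= c + 3 m eta; the added 1 covers m = 0. *)
pose eta := e / (3 * m%:R + 1).
have eta0 : 0 < eta by rewrite divr_gt0.
have [f hf] := choice (fun i => L2_approx hip hM htau Zsa ZM NM NZ hN (xi i) eta0).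
have := young f.
have h1 : \sum_(i < m) (L2_norm (xi i) ^+ 2 - eta) <= \sum_(i < m) re (free_div i (f i)).
  by apply: ler_sum => i _; have [+ _] := hf i; rewrite xi_poly.
have h2 : \sum_(i < m) tform (evZ (f i)) (evZ (f i)) <= \sum_(i < m) (L2_norm (xi i) ^+ 2 + eta).
  by apply: ler_sum => i _; have [] := hf i.
move: h1 h2; rewrite !big_split /= !sumr_const card_ord mulNrn -!(mulr_natr eta).
have : eta * (3 * m%:R + 1) = e by rewrite /eta divfK// gt_eqF.
rewrite mulrDr mulr1 mulrCA; move: (\sum_(i < m) _ ^+ 2) => S.
move: (\sum_(i < m) re _) (\sum_(i < m) tform _ _) => U V; lra.
Qed.

End Score.

(** * Normalized traces of matrix polynomials *)

Section Chessboard.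
Context {R : realType} {T : finType} (phi : seq T -> R).
Hypotheses (phi_rot : forall u v, phi (u ++ v) = phi (v ++ u))
  (phi_ge0 : forall u, 0 <= phi (u ++ rev u))
  (phi_CS : forall u v, phi (u ++ v) ^+ 2 <= phi (u ++ rev u) * phi (rev v ++ v)).

(* Reflecting a word of maximal |phi| in its middle gives a word that is again
   maximal, and doubles a run of equal letters at the cut. *)
Lemma chessboard k (K : R) : (forall t, phi (nseq (2 ^ k.+1) t) <= K) ->
  forall w, size w = (2 ^ k.+1)%N -> `|phi w| <= K.
Proof.
move=> HK w sw; set L := (2 ^ k.+1)%N in sw HK *.
have L2 : L = (2 ^ k + 2 ^ k)%N by rewrite /L expnS mul2n addnn.
have sw' : size w == L by apply/eqP.
pose F (u : L.-tuple T) := `|phi u|.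
(* A finite alphabet has finitely many words of length [L], so |phi| attains its maximum. *)
have [w0 _ w0max] := @arg_maxP _ _ _ (Tuple sw') xpredT F isT.
set Mx := F w0.
have phi_le u : size u = L -> `|phi u| <= Mx.
  by move=> /eqP su; exact: (w0max (Tuple su) isT).
apply: (@le_trans _ _ Mx); first exact: phi_le.
have t0 : exists t v, (w0 : seq T) = t :: v.
  case: (tval w0) (size_tuple w0) => [|t v] /=; last by exists t, v.
  by rewrite /L => /esym/eqP; rewrite expn_eq0.
have [t [v0 w0E]] := t0.
have nseqP : phi (nseq L t) = phi (nseq (2 ^ k) t ++ rev (nseq (2 ^ k) t)).
  by rewrite rev_nseq L2 nseqD.
have [Mx0|Mx0] := eqVneq Mx 0.
  by rewrite Mx0; apply: le_trans (HK t); rewrite nseqP.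
have Mxp : 0 < Mx by rewrite lt_neqAle eq_sym Mx0 /Mx /F normr_ge0.
suff [v [sv vM]] : exists v, size (nseq L t ++ v) = L /\ `|phi (nseq L t ++ v)| = Mx.
  have v0' : v = [::].
    move: sv; rewrite size_cat size_nseq -[RHS]addn0 => /eqP; rewrite eqn_add2l.
    by move=> /eqP/size0nil.
  by rewrite -vM v0' cats0 nseqP ger0_norm ?phi_ge0// -nseqP.
(* Induction on the length 2^s of an initial run of [t] in a maximal word. *)
suff: forall s, (s <= k.+1)%N -> exists v,
    size (nseq (2 ^ s) t ++ v) = L /\ `|phi (nseq (2 ^ s) t ++ v)| = Mx.
  by move=> /(_ k.+1 (leqnn _)).
elim=> [_|s IH sk].
  by exists v0; rewrite expn0 -[nseq 1 t ++ v0]/(t :: v0) -w0E size_tuple.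
have [v [sv vM]] := IH (ltnW sk).
have sk2 : (2 ^ s <= 2 ^ k)%N by rewrite leq_exp2l.
set r := nseq (2 ^ s) t in sv vM.
have sr : size r = (2 ^ s)%N by rewrite size_nseq.
(* The cut is in the middle of the word, and the run lies in the first half [r ++ v1]. *)
pose v1 := take (2 ^ k - 2 ^ s) v; pose v2 := drop (2 ^ k - 2 ^ s) v.
have vE : r ++ v = (r ++ v1) ++ v2 by rewrite -catA cat_take_drop.
have sv' : size v = (2 ^ k + 2 ^ k - 2 ^ s)%N by rewrite -L2 -sv size_cat sr addKn.
have s1 : size (r ++ v1) = (2 ^ k)%N.
  rewrite size_cat sr size_take sv'.
  by case: ltnP; lia.
have s2 : size v2 = (2 ^ k)%N.
  by apply/eqP; rewrite -(eqn_add2l (size (r ++ v1))) -size_cat -vE sv s1 L2.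
have := phi_CS (r ++ v1) v2; rewrite -vE.
rewrite -(real_normK (num_real (phi (r ++ v)))) vM => h.
have h1 : phi ((r ++ v1) ++ rev (r ++ v1)) <= Mx.
  by apply: le_trans (ler_norm _) _; apply: phi_le; rewrite size_cat size_rev s1 L2.
have h2 : phi (rev v2 ++ v2) <= Mx.
  by apply: le_trans (ler_norm _) _; apply: phi_le; rewrite size_cat size_rev s2 L2.
(* Cauchy-Schwarz bounds Mx^2 by the reflected value times a value at most Mx. *)
have h3 : Mx <= phi ((r ++ v1) ++ rev (r ++ v1)).
  rewrite -(ler_pM2r Mxp) -expr2; apply: le_trans h _.
  by rewrite ler_wpM2l// phi_ge0.
exists (v1 ++ rev v1).
have E : nseq (2 ^ s.+1) t = r ++ r by rewrite -nseqD addnn -mul2n -expnS.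
have rr : rev r = r by rewrite rev_nseq.
rewrite E; split.
  by move: s1; rewrite !size_cat size_rev; lia.
(* Reflection puts a copy of the run at the end of the word, and rotation joins it to the initial
   one. *)
have -> : phi ((r ++ r) ++ v1 ++ rev v1) = phi ((r ++ v1) ++ rev (r ++ v1)).
  by rewrite -catA phi_rot rev_cat rr -!catA.
apply/eqP; rewrite eq_le; apply/andP; split.
  by apply: phi_le; rewrite size_cat size_rev s1 L2.
exact: le_trans h3 (ler_norm _).
Qed.

End Chessboard.

Section NormalizedTrace.
Context {R : realType}.
Local Notation C := (cplx R).
Variable n : nat.
Implicit Types A B : 'M[C]_n.

Definition adjm A : 'M[C]_n := \matrix_(i, j) (A j i)^*.

Lemma adjmM A B : adjm (A * B) = adjm B * adjm A.
Proof.
apply/matrixP => i j; rewrite !mxE rmorph_sum; apply: eq_bigr => k _.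
by rewrite !mxE rmorphM mulrC.
Qed.
Lemma adjmD A B : adjm (A + B) = adjm A + adjm B.
Proof. by apply/matrixP => i j; rewrite !mxE rmorphD. Qed.
Lemma adjmK A : adjm (adjm A) = A.
Proof. by apply/matrixP => i j; rewrite !mxE conjCK. Qed.
Lemma adjm_scalar (c : C) : adjm c%:M = (c^*)%:M.
Proof. by apply/matrixP => i j; rewrite !mxE eq_sym rmorphMn. Qed.
Lemma adjm1 : adjm 1 = 1.
Proof. by rewrite -[1]/(1%:M) adjm_scalar rmorph1. Qed.
Lemma scalM (a b : C) : (a * b)%:M = a%:M * b%:M :> 'M[C]_n.
Proof. exact: scalar_mxM. Qed.
Lemma scalD (a b : C) : (a + b)%:M = a%:M + b%:M :> 'M[C]_n.
Proof. exact: raddfD. Qed.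
Lemma hermP A : A \is hermsymmx -> adjm A = A.
Proof.
move=> /is_hermitianmxP; rewrite expr0 scale1r => h.
by apply/matrixP => i j; rewrite mxE [in RHS]h !mxE.
Qed.

Lemma ntrD A B : ntr (A + B) = ntr A + ntr B.
Proof. by rewrite /ntr linearD mulrDl. Qed.
Lemma ntr0 : ntr (0 : 'M[C]_n) = 0.
Proof. by rewrite /ntr linear0 mul0r. Qed.
Lemma ntr_scalarM (c : C) A : ntr (c%:M * A) = c * ntr A.
Proof. by rewrite /ntr -[c%:M * A]/(c%:M *m A) mul_scalar_mx linearZ /= mulrA. Qed.
Lemma ntr_mulC A B : ntr (A * B) = ntr (B * A).
Proof. by rewrite /ntr -[A * B]/(A *m B) mxtrace_mulC. Qed.
Lemma ntr_sum I (r : seq I) (F : I -> 'M[C]_n) :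
  ntr (\sum_(i <- r) F i) = \sum_(i <- r) ntr (F i).
Proof. by elim/big_rec2: _ => [|i y1 y2 _ <-]; rewrite ?ntr0 ?ntrD. Qed.
Lemma ntr_adjm A : ntr (adjm A) = (ntr A)^*.
Proof.
rewrite /ntr rmorphM fmorphV rmorph_nat rmorph_sum; congr (_ / _).
by apply: eq_bigr => i _; rewrite mxE.
Qed.
Lemma re_divn (z : C) : re (z / n%:R) = re z / n%:R.
Proof.
rewrite natr_mkC; have -> : (mkC n%:R 0)^-1 = mkC n%:R^-1 0 :> C.
  apply: cplxP => /=; rewrite ?expr0n ?addr0 ?oppr0 ?mul0r//.
  by have [->|n0] := eqVneq (n%:R : R) 0; [rewrite mul0r invr0|rewrite expr2 invfM mulrA mulfV ?mul1r].
  exact: oppr0.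
by rewrite reM /= mulr0 subr0.
Qed.
(** An inequality because of n = 0, where the quotient is 0. *)
Lemma re_ntr_1 : re (ntr (1 : 'M[C]_n)) <= 1.
Proof.
rewrite /ntr re_divn -[1]/(1%:M) mxtrace_scalar natr_mkC /=.
by have [->|n0] := eqVneq (n%:R : R) 0; [rewrite mul0r|rewrite mulfV].
Qed.

Definition mform A B : R := re (ntr (A * adjm B)).

Lemma mform_sum A B : mform A B = (\sum_i \sum_j re (A i j * (B i j)^*)) / n%:R.
Proof.
rewrite /mform /ntr re_divn re_sum; congr (_ / _); apply: eq_bigr => i _.
by rewrite mxE re_sum; apply: eq_bigr => j _; rewrite mxE.
Qed.
Lemma mform_comb (c : R) A B D :
  mform ((mkC c 0)%:M * A + B) D = c * mform A D + mform B D.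
Proof. by rewrite /mform mulrDl ntrD -mulrA ntr_scalarM reD reM /= mul0r subr0. Qed.
Lemma mform_sym A B : mform A B = mform B A.
Proof. by rewrite /mform -reJ -ntr_adjm adjmM adjmK. Qed.
Lemma mform_ge0 A : 0 <= mform A A.
Proof.
rewrite mform_sum divr_ge0//; apply: sumr_ge0 => i _; apply: sumr_ge0 => j _.
by rewrite mulcJ sqmod_ge0.
Qed.
Lemma mform_CauchySchwarz A B : mform A B ^+ 2 <= mform A A * mform B B.
Proof. exact: (form_CauchySchwarz mform_comb mform_sym mform_ge0). Qed.

Section Words.
Context {T : finType} (Z : T -> 'M[C]_n).
Hypothesis Zh : forall t, adjm (Z t) = Z t.

Definition word (w : seq T) : 'M[C]_n := \prod_(t <- w) Z t.
Definition wtr w : R := re (ntr (word w)).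

Lemma word_cat u v : word (u ++ v) = word u * word v.
Proof. exact: big_cat. Qed.
Lemma word_rev u : word (rev u) = adjm (word u).
Proof.
elim: u => [|t u IH]; first by rewrite /word big_nil adjm1.
by rewrite rev_cons -cats1 word_cat IH [in RHS]/word big_cons adjmM Zh /word big_seq1.
Qed.

Lemma wtr_chessboard k (K : R) :
  (forall t, re (ntr (Z t ^+ (2 ^ k.+1))) <= K) ->
  forall w, size w = (2 ^ k.+1)%N -> `|wtr w| <= K.
Proof.
move=> HK; apply: chessboard.
- by move=> u v; rewrite /wtr !word_cat ntr_mulC.
- by move=> u; rewrite /wtr word_cat word_rev; exact: mform_ge0.
- move=> u v; rewrite /wtr !word_cat !word_rev.
  have := mform_CauchySchwarz (word u) (adjm (word v)).
  by rewrite /mform adjmK.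
- move=> t; have -> // : wtr (nseq (2 ^ k.+1) t) = re (ntr (Z t ^+ (2 ^ k.+1))).
  by rewrite /wtr /word big_nseq iter_mulr_1.
Qed.

End Words.

End NormalizedTrace.

Lemma leq_sum_mem (I : eqType) (r : seq I) (F : I -> nat) x :
  x \in r -> (F x <= \sum_(y <- r) F y)%N.
Proof. by move=> xr; rewrite (big_rem x)//= leq_addr. Qed.

Section Words.
Context {R : realType} {J : Type}.
Local Notation C := (cplx R).

Fixpoint ncwords (p : ncpoly C J) : seq (C * seq J) :=
  match p with
  | NCone => [:: (1, [::])]
  | NCconst c => [:: (c, [::])]
  | NCvar i => [:: (1, [:: i])]
  | NCadd p q => ncwords p ++ ncwords q
  | NCmul p q => [seq (s.1 * t.1, s.2 ++ t.2) | s <- ncwords p, t <- ncwords q]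
  end.

Variables (n : nat) (Z : J -> 'M[C]_n).
Definition mev (p : ncpoly C J) : 'M[C]_n := nceval (fun c : C => c%:M) Z p.

Lemma mev_words p : mev p = \sum_(s <- ncwords p) (s.1)%:M * \prod_(x <- s.2) Z x.
Proof.
elim: p => [|c|i|p IHp q IHq|p IHp q IHq]; rewrite /mev /=.
- by rewrite big_seq1 big_nil mulr1.
- by rewrite big_seq1 big_nil mulr1.
- by rewrite big_seq1 big_seq1 mul1r.
- by rewrite big_cat -IHp -IHq.
rewrite -/(mev p) -/(mev q) IHp IHq big_allpairs_dep /= mulr_suml.
apply: eq_bigr => s _; rewrite mulr_sumr; apply: eq_bigr => t _ /=.
rewrite big_cat /= scalar_mxM -[_ *m _]/(_ * _) -!mulrA; congr (_ * _).
rewrite !mulrA; congr (_ * _).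
exact: scalar_mxC.
Qed.

End Words.

Section Bound.
Context {R : realType}.
Local Notation C := (cplx R).
Variable m : nat.
Local Notation J := ('I_m + nat)%type.

(** The summand 1 accounts for the identity matrix, used as an extra letter to pad words to a length
    that is a power of two. *)
Definition moment_sum n (X : 'I_m -> 'M[C]_n) (Y : nat -> 'M[C]_n) (k b : nat) : R :=
  1 + \sum_i re (ntr (X i ^+ (2 ^ k.+1))) + \sum_(j < b) re (ntr (Y j ^+ (2 ^ k.+1))).

Lemma re_ntr_even_ge0 n (A : 'M[C]_n) k : adjm A = A -> 0 <= re (ntr (A ^+ (2 ^ k.+1))).
Proof.
move=> hA; have -> : (2 ^ k.+1 = 2 ^ k + 2 ^ k)%N by rewrite expnS mul2n addnn.
have -> : A ^+ (2 ^ k + 2 ^ k) = A ^+ (2 ^ k) * adjm (A ^+ (2 ^ k)).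
  rewrite exprD; congr (_ * _); elim: (2 ^ k)%N => [|i IH]; first by rewrite expr0 adjm1.
  by rewrite [in RHS]exprS adjmM -IH hA -exprSr.
exact: mform_ge0.
Qed.

(** The left side is the trace of the word followed by its reversal. Padded with identities to
    length 2^(k+1), it falls under the chessboard estimate; the bound on the indices makes the
    alphabet finite. *)
Lemma word_bound n (X : 'I_m -> 'M[C]_n) (Y : nat -> 'M[C]_n) k b (w : seq J) :
  (forall i, adjm (X i) = X i) -> (forall j, adjm (Y j) = Y j) ->
  (size w + size w <= 2 ^ k.+1)%N ->
  (forall j, inr j \in w -> (j < b.+1)%N) ->
  mform (\prod_(x <- w) join_tuple X Y x) (\prod_(x <- w) join_tuple X Y x)
    <= moment_sum X Y k b.+1.
Proof.
move=> hX hY sw wb.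
pose T := option ('I_m + 'I_b.+1).
pose Zt (t : T) : 'M[C]_n := match t with
  | None => 1 | Some (inl i) => X i | Some (inr j) => Y j end.
have Zh t : adjm (Zt t) = Zt t by case: t => [[i|j]|] //=; exact: adjm1.
pose enc (x : J) : T := match x with
  | inl i => Some (inl i) | inr j => Some (inr (inord j)) end.
have wE : \prod_(x <- w) join_tuple X Y x = word Zt (map enc w).
  rewrite /word big_map big_seq [RHS]big_seq; apply: eq_bigr => -[i|j] xw //=.
  by rewrite inordK// wb.
pose V : seq T := nseq (2 ^ k.+1 - (size w + size w)) None.
have -> : mform (\prod_(x <- w) join_tuple X Y x) (\prod_(x <- w) join_tuple X Y x) =
    wtr Zt ((map enc w ++ rev (map enc w)) ++ V).
  rewrite wE /wtr !word_cat (word_rev Zh) /mform.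
  by rewrite [word Zt V]/word /V big_nseq iter_mulr_1 expr1n mulr1.
apply: le_trans (ler_norm _) _; apply: (wtr_chessboard Zh (k := k)); last first.
  by rewrite !size_cat size_rev size_map size_nseq subnKC.
have sX : 0 <= \sum_i re (ntr (X i ^+ (2 ^ k.+1))).
  by apply: sumr_ge0 => i _; exact: re_ntr_even_ge0.
have sY : 0 <= \sum_(j < b.+1) re (ntr (Y j ^+ (2 ^ k.+1))).
  by apply: sumr_ge0 => j _; exact: re_ntr_even_ge0.
case=> [[i|j]|] /=; rewrite /moment_sum.
- have : re (ntr (X i ^+ (2 ^ k.+1))) <= \sum_i re (ntr (X i ^+ (2 ^ k.+1))).
    rewrite (bigD1 i) //= lerDl; apply: sumr_ge0 => i' _; exact: re_ntr_even_ge0.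
  lra.
- have : re (ntr (Y j ^+ (2 ^ k.+1))) <= \sum_(j < b.+1) re (ntr (Y j ^+ (2 ^ k.+1))).
    rewrite (bigD1 j) //= lerDl; apply: sumr_ge0 => i' _; exact: re_ntr_even_ge0.
  lra.
by rewrite expr1n; have := @re_ntr_1 R n; lra.
Qed.

Lemma mform_scale n (c : C) (A : 'M[C]_n) : mform (c%:M * A) (c%:M * A) = sqmod c * mform A A.
Proof.
rewrite /mform adjmM adjm_scalar -mulrA ntr_scalarM mulrA ntr_mulC ntr_scalarM mulrA mulcJ.
by rewrite reM /= mul0r subr0.
Qed.

(** The constants depend on [p] alone, not on the size of the matrices. Each monomial is paired with
    1 by Cauchy-Schwarz, and [word_bound] controls its squared norm. *)
Lemma re_ntr_bound (p : ncpoly C J) : exists k b K, 0 <= K /\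
  forall n (X : 'I_m -> 'M[C]_n) (Y : nat -> 'M[C]_n),
  (forall i, adjm (X i) = X i) -> (forall j, adjm (Y j) = Y j) ->
  `|re (ntr (mev (join_tuple X Y) p))| <= K * moment_sum X Y k b.
Proof.
pose ws := ncwords p.
pose k := (\sum_(s <- ws) size s.2)%N.
pose lt (x : J) := if x is inr j then j else 0%N.
pose b := (\sum_(s <- ws) \sum_(x <- s.2) lt x)%N.
have kP s : s \in ws -> (size s.2 <= k)%N.
  exact: (leq_sum_mem (fun s : C * seq J => size s.2)).
have bP s j : s \in ws -> inr j \in s.2 -> (j < b.+1)%N.
  move=> sws js; rewrite ltnS.
  apply: leq_trans (leq_sum_mem (fun s : C * seq J => \sum_(x <- s.2) lt x)%N sws).
  exact: (leq_sum_mem lt js).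
move: k b kP bP => k b kP bP.
exists k, b.+1, (\sum_(s <- ws) Num.sqrt (sqmod s.1)); split.
  by apply: sumr_ge0 => s _; exact: sqrtr_ge0.
move=> n X Y hX hY; rewrite mev_words ntr_sum re_sum.
apply: le_trans (ler_norm_sum _ _ _) _; rewrite mulr_suml big_seq [leRHS]big_seq.
apply: ler_sum => s sws.
set P := \prod_(x <- s.2) join_tuple X Y x; set K := moment_sum X Y k b.+1.
(* The bound [K] obtained for the squared trace of the word is weakened to K^2, so that the final
   estimate is linear in the moments. *)
have K1 : 1 <= K.
  rewrite /K /moment_sum -addrA lerDl addr_ge0// sumr_ge0// => i _; exact: re_ntr_even_ge0.
have hP : mform P P <= K.
  apply: word_bound => //.
    (* Twice the length is at most 2 k, hence at most 2^(k+1). *)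
    have h2 := ltnW (leq_ltn_trans (kP _ sws) (ltn_expl k (isT : (1 < 2)%N))).
    by rewrite expnS mul2n -addnn leq_add.
  by move=> j; exact: bP.
have := mform_CauchySchwarz (s.1%:M * P) 1.
rewrite mform_scale {1}/mform adjm1 mulr1 => h.
rewrite -(ler_pXn2r (n := 2)) ?nnegrE ?mulr_ge0 ?sqrtr_ge0//; last lra.
rewrite real_normK ?num_real// exprMn sqr_sqrtr ?sqmod_ge0//.
apply: le_trans h _.
have h1 : mform (1 : 'M[C]_n) 1 <= 1 by rewrite /mform adjm1 mulr1 re_ntr_1.
have h0 := mform_ge0 (1 : 'M[C]_n); have hP0 := mform_ge0 P.
rewrite -mulrA ler_wpM2l ?sqmod_ge0//.
apply: (@le_trans _ _ (mform P P)); first by rewrite ler_piMr.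
apply: le_trans hP _; rewrite expr2 ler_pMr//; lra.
Qed.

End Bound.

(** * Smooth cutoffs and polynomial vector fields *)

Section Bump.
Context {R : realType}.
Implicit Types (P : {poly R}) (t s : R).

(* A family of functions on R closed under differentiation, containing the
   standard flat function exp (-1/t) (P = 1); see [dflat]. *)
Definition flat P t : R := if 0 < t then P.[t^-1] * expR (- t^-1) else 0.

(** Chain rule: differentiating P(1/t) exp(-1/t) brings out 1/t^2 and turns P into P - P'. *)
Definition dflat P : {poly R} := 'X^2 * (P - P^`()).

Lemma expR_ge_exprn s n : 0 <= s -> s ^+ n.+1 / n.+1`!%:R <= expR s.
Proof. by move=> s0; have := expR_ge1Dxn n s0; lra. Qed.

(** exp s exceeds s^(n+2) / (n+2)!. Two spare powers of s are kept because the difference quotient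
    of [flat P] at 0 consumes one and must still tend to 0. *)
Lemma flat_bound P : exists2 A, 0 <= A & forall s, 1 <= s ->
  `|P.[s] * expR (- s)| <= A / s ^+ 2.
Proof.
pose n := size P; pose B := \sum_(i < n) `|P`_i|.
have B0 : 0 <= B by apply: sumr_ge0.
exists (B * (n.+2)`!%:R); first by rewrite mulr_ge0.
move=> s s1; have s0 : 0 < s by apply: lt_le_trans s1.
have hP : `|P.[s]| <= B * s ^+ n.
  rewrite horner_coef; apply: le_trans (ler_norm_sum _ _ _) _.
  rewrite mulr_suml; apply: ler_sum => i _; rewrite normrM ler_wpM2l//.
  by rewrite ger0_norm ?exprn_ge0 ?(ltW s0)// ler_weXn2l// ltnW.
rewrite normrM [`|expR _|]gtr0_norm ?expR_gt0// expRN.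
apply: (@le_trans _ _ (B * s ^+ n * ((n.+2)`!%:R / s ^+ n.+2))).
  apply: ler_pM => //.
  have := expR_ge_exprn n.+1 (ltW s0) => h.
  rewrite -[leRHS]invrK lef_pV2 ?posrE ?expR_gt0 ?invr_gt0 ?divr_gt0 ?exprn_gt0 ?ltr0n ?fact_gt0//.
  by rewrite invf_div.
rewrite le_eqVlt; apply/orP; left; apply/eqP.
rewrite -[n.+2]addn2 exprD; field; rewrite ?expf_neq0 ?gt_eqF//.
Qed.

Lemma is_derive_flat P t : is_derive t (1 : R) (flat P) (flat (dflat P) t).
Proof.
have [t0|t0|->] := ltgtP t 0.
- have fE u : u < 0 -> flat P u = 0 by move=> u0; rewrite /flat ltNge ltW.
  have -> : flat (dflat P) t = 0 by rewrite /flat ltNge ltW.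
  apply: (@near_eq_is_derive _ _ _ (cst 0)).
  near=> u; rewrite fE//; near: u; exact: lt_nbhsl.
- rewrite {2}/flat t0.
  have h1 : is_derive t 1 (fun u : R => u^-1) (- t ^- 2 *: 1).
    apply: (is_deriveV (f := id)); exact: lt0r_neq0.
  have h2 : is_derive t 1 (fun u : R => P.[u^-1]) (P^`().[t^-1] * (- t ^- 2 *: 1)).
    exact: (is_derive1_comp (f := horner P)).
  have h3 : is_derive t 1 (fun u : R => - u^-1) (- (- t ^- 2 *: 1)).
    exact: is_deriveN.
  have h4 : is_derive t 1 (fun u : R => expR (- u^-1)) (expR (- t^-1) * (- (- t ^- 2 *: 1))).
    exact: (is_derive1_comp (f := expR)).
  have h5 : is_derive t 1 (fun u : R => P.[u^-1] * expR (- u^-1))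
      ((dflat P).[t^-1] * expR (- t^-1)).
    apply: (is_derive_eq (is_deriveM h2 h4)).
    by rewrite /dflat !hornerE /= /GRing.scale /= -exprVn; ring.
  apply: (near_eq_is_derive _ h5).
  by near=> u; rewrite /flat ifT//; near: u; exact: lt_nbhsr.
- have -> : flat (dflat P) 0 = 0 by rewrite /flat ltxx.
  have f0 : flat P 0 = 0 by rewrite /flat ltxx.
  have [A A0 HA] := flat_bound P.
  suff h : (fun h : R => h^-1 *: ((flat P \o shift 0) (h *: 1) - flat P 0)) @ 0^' --> (0 : R).
    by apply: DeriveDef; [exact: cvgP h|exact: cvg_lim h].
  apply/cvgrPdist_lt => e e0.
  have A1 : 0 < A + 1 by rewrite ltr_wpDl.
  near=> h.
  rewrite /= sub0r normrN f0 subr0 addr0 [_ *: 1]mulr1 /GRing.scale /= /flat.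
  case: ifP => [h0|_]; last by rewrite mulr0 normr0.
  have : h < Num.min 1 (e / (A + 1)).
    apply: le_lt_trans (ler_norm h) _; near: h; apply: dnbhs0_lt.
    by rewrite lt_min ltr01 divr_gt0.
  rewrite lt_min => /andP[h1 he].
  have := HA h^-1; rewrite invf_ge1// => /(_ (ltW h1)) hA.
  rewrite normrM gtr0_norm ?invr_gt0//.
  apply: (@le_lt_trans _ _ (h^-1 * (A / h^-1 ^+ 2))).
    by rewrite ler_wpM2l// invr_ge0 ltW.
  have -> : h^-1 * (A / h^-1 ^+ 2) = A * h by field; rewrite gt_eqF.
  move: he; rewrite ltr_pdivlMr// => he; apply: le_lt_trans he.
  by rewrite mulrC ler_wpM2l ?(ltW h0)// lerDl.
Unshelve. all: by end_near. Qed.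

Lemma continuous_flat P : continuous (flat P).
Proof.
move=> t; apply/differentiable_continuous/derivable1_diffP.
by have [] := is_derive_flat P t.
Qed.

Lemma flat1_ge0 t : 0 <= flat 1 t.
Proof. by rewrite /flat; case: ifP => // _; rewrite hornerE mul1r expR_ge0. Qed.
Lemma flat1_le1 t : flat 1 t <= 1.
Proof.
rewrite /flat; case: ifP => // t0; rewrite hornerE mul1r.
by rewrite expR_le1 oppr_le0 invr_ge0 ltW.
Qed.
Lemma dflat1_ge0 t : 0 <= flat (dflat 1) t.
Proof.
rewrite /flat; case: ifP => // _.
by rewrite /dflat derivC subr0 !hornerE mulr_ge0 ?expR_ge0 ?sqr_ge0.
Qed.
Lemma dflat1_le t : flat (dflat 1) t <= 2.
Proof.
rewrite /flat; case: ifP => // t0.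
rewrite /dflat derivC subr0 !hornerE.
have ti : 0 <= t^-1 by rewrite invr_ge0 ltW.
have h : t^-1 ^+ 2 / 2 <= expR t^-1 := expR_ge_exprn 1 ti.
rewrite expRN ler_pdivrMr ?expR_gt0//. lra.
Qed.

End Bump.

Section LineDerivative.
Context {R : realType} {V : normedModType R}.
Implicit Types f g : V -> R.

Lemma is_derive_line f (a v : V) (l : R) :
  is_derive a v f l <-> is_derive (0 : R) 1 (fun h : R => f (h *: v + a)) l.
Proof.
have E : (fun h : R => h^-1 *: ((f \o shift a) (h *: v) - f a)) =
    (fun h : R => h^-1 *: (((fun h : R => f (h *: v + a)) \o shift 0) (h *: 1) - f (0 *: v + a))).
  by apply/funext => h /=; rewrite addr0 [_ *: 1]mulr1 scale0r add0r.
split=> -[]; rewrite /derivable /derive.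
  by rewrite E => h1 h2; apply: DeriveDef.
by rewrite -E => h1 h2; apply: DeriveDef.
Qed.

End LineDerivative.

Section SmoothClass.
Context {R : realType} {N : nat}.
Implicit Types f g : 'rV[R]_N -> R.

Definition sqnorm (x : 'rV[R]_N) : R := \sum_k x 0 k ^+ 2.

(* Functions built from coordinates and from cutoffs flat P (1 - c |x|^2);
   polynomials are those which use no cutoff. *)
Inductive smf (cut : bool) : ('rV[R]_N -> R) -> Prop :=
| SFconst c : smf cut (fun=> c)
| SFcoord k : smf cut (fun x => x 0 k)
| SFcut P c : cut -> smf cut (fun x => flat P (1 - c * sqnorm x))
| SFadd f g : smf cut f -> smf cut g -> smf cut (fun x => f x + g x)
| SFmul f g : smf cut f -> smf cut g -> smf cut (fun x => f x * g x).

Lemma smf_cut f : smf false f -> smf true f.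
Proof.
elim=> [c|k|P c //|f1 f2 _ h1 _ h2|f1 f2 _ h1 _ h2].
- exact: SFconst.
- exact: SFcoord.
- exact: SFadd.
- exact: SFmul.
Qed.

Lemma smf_opp b f : smf b f -> smf b (fun x => - f x).
Proof.
move=> bf; have -> : (fun x => - f x) = (fun x => -1 * f x).
  by apply/funext => x; rewrite mulN1r.
by apply: SFmul => //; exact: SFconst.
Qed.
Lemma smf_sub b f g : smf b f -> smf b g -> smf b (fun x => f x - g x).
Proof. by move=> bf bg; apply: SFadd => //; exact: smf_opp. Qed.
Lemma smf_sum b (I : Type) (r : seq I) (F : I -> 'rV[R]_N -> R) :
  (forall i, smf b (F i)) -> smf b (fun x => \sum_(i <- r) F i x).
Proof.
move=> bF; elim: r => [|i r IH].
  rewrite (_ : (fun _ => _) = fun=> 0); first exact: SFconst.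
  by apply/funext => x; rewrite big_nil.
rewrite (_ : (fun _ => _) = fun x => F i x + \sum_(j <- r) F j x); first exact: SFadd.
by apply/funext => x; rewrite big_cons.
Qed.
Lemma smf_sqnorm b : smf b sqnorm.
Proof.
apply: (@smf_sum b _ _ (fun k x => x 0 k ^+ 2)) => k.
have -> : (fun x : 'rV[R]_N => x 0 k ^+ 2) = (fun x => x 0 k * x 0 k).
  by apply/funext => x; rewrite expr2.
by apply: SFmul; exact: SFcoord.
Qed.

Lemma continuous_coord k : continuous (fun x : 'rV[R]_N => x 0 k).
Proof. exact: coord_continuous. Qed.

Lemma is_derive_coord k j x : is_derive x (delta_mx 0 k) (fun x : 'rV[R]_N => x 0 j) ((j == k)%:R).
Proof.
apply/is_derive_line.
have -> : (fun h : R => (h *: delta_mx 0 k + x) 0 j) = (fun h : R => h * (j == k)%:R + x 0 j).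
  by apply/funext => h; rewrite !mxE eqxx /=.
have i1 : is_derive (0 : R) (1 : R) (fun h : R => h) 1 := is_derive_id _ _.
have i2 := is_deriveM i1 (is_derive_cst ((j == k)%:R : R) (0 : R) (1 : R)).
have i3 := is_deriveD i2 (is_derive_cst (x 0 j) (0 : R) (1 : R)).
by apply: (is_derive_eq i3); rewrite /GRing.scale /= /cst; ring.
Qed.

Lemma is_derive_flat_sqnorm P c k x : is_derive x (delta_mx 0 k)
  (fun x => flat P (1 - c * sqnorm x)) (flat (dflat P) (1 - c * sqnorm x) * ((- c * 2) * x 0 k)).
Proof.
apply/is_derive_line.
have q (h : R) : 1 - c * sqnorm (h *: delta_mx 0 k + x) =
    1 - c * sqnorm x + (- c * 2 * x 0 k * h + (- c) * (h * h)).
  rewrite /sqnorm (bigD1 k) //= [in RHS](bigD1 k) //= !mxE !eqxx /=.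
  rewrite (eq_bigr (fun i => x 0 i ^+ 2)) => [|i /negbTE ik]; first by ring.
  by rewrite !mxE ik andbF mulr0 add0r.
have -> : (fun h : R => flat P (1 - c * sqnorm (h *: delta_mx 0 k + x))) =
    flat P \o (fun h : R => 1 - c * sqnorm x + (- c * 2 * x 0 k * h + (- c) * (h * h))).
  by apply/funext => h /=; rewrite q.
apply: is_derive1_comp.
  by rewrite mulr0 mulr0 mulr0 !addr0; exact: is_derive_flat.
have i1 : is_derive (0 : R) (1 : R) (fun h : R => h) 1 := is_derive_id _ _.
have i2 := is_deriveM i1 i1.
have i3 := is_deriveM (is_derive_cst (- c) (0 : R) (1 : R)) i2.
have i4 := is_deriveM (is_derive_cst (- c * 2 * x 0 k) (0 : R) (1 : R)) i1.
have i5 := is_deriveD (is_derive_cst (1 - c * sqnorm x) (0 : R) (1 : R)) (is_deriveD i4 i3).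
by apply: (is_derive_eq i5); rewrite /GRing.scale /=; ring.
Qed.

Lemma smf_derive b f k : smf b f ->
  exists2 f', smf b f' & forall x, is_derive x (delta_mx 0 k) f (f' x).
Proof.
elim=> [c|j|P c cut|f1 f2 h1 [f1' d1 D1] h2 [f2' d2 D2]|f1 f2 h1 [f1' d1 D1] h2 [f2' d2 D2]].
- by exists (fun=> 0) => [|x]; [exact: SFconst|exact: is_derive_cst].
- by exists (fun=> (j == k)%:R) => [|x]; [exact: SFconst|exact: is_derive_coord].
- exists (fun x => flat (dflat P) (1 - c * sqnorm x) * ((- c * 2) * x 0 k)) => [|x].
    apply: SFmul; first exact: SFcut.
    by apply: SFmul; [exact: SFconst|exact: SFcoord].
  exact: is_derive_flat_sqnorm.
- exists (fun x => f1' x + f2' x) => [|x]; [exact: SFadd|exact: (is_deriveD (D1 x) (D2 x))].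
- exists (fun x => f1 x * f2' x + f2 x * f1' x) => [|x].
    by apply: SFadd; exact: SFmul.
  have := is_deriveM (D1 x) (D2 x); exact.
Qed.

Lemma smf_affine b c : smf b (fun x => 1 - c * sqnorm x).
Proof.
apply: smf_sub; first exact: SFconst.
by apply: SFmul; [exact: SFconst|exact: smf_sqnorm].
Qed.

Lemma smf_poly_continuous b f : smf b f -> b = false -> continuous f.
Proof.
elim=> [c|j|P c -> //|f1 f2 h1 c1 h2 c2|f1 f2 h1 c1 h2 c2] b0.
- by move=> x; apply: cst_continuous.
- exact: continuous_coord.
- by move=> x; exact: (cvgD (c1 b0 x) (c2 b0 x)).
- by move=> x; exact: (cvgM (c1 b0 x) (c2 b0 x)).
Qed.

Lemma smf_continuous b f : smf b f -> continuous f.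
Proof.
elim=> [c|j|P c cut|f1 f2 h1 c1 h2 c2|f1 f2 h1 c1 h2 c2].
- by move=> x; apply: cst_continuous.
- exact: continuous_coord.
- have cq := smf_poly_continuous (smf_affine false c) erefl.
  move=> x; apply: (@continuous_comp _ _ _ (fun x => 1 - c * sqnorm x) (flat P)).
    exact: cq.
  exact: continuous_flat.
- by move=> x; exact: (cvgD (c1 x) (c2 x)).
- by move=> x; exact: (cvgM (c1 x) (c2 x)).
Qed.

Lemma smf_partial b f k : smf b f -> smf b (partial k f).
Proof.
move=> /(smf_derive k)[f' bf' D]; have -> // : partial k f = f'.
by apply/funext => x; exact: derive_val.
Qed.

Lemma smf_smooth b f : smf b f -> smooth f.
Proof.
move=> bf s; have : smf b (foldr (@partial R N) f s).
  by elim: s => [|k s IH] //=; exact: smf_partial.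
move: (foldr _ _ _) => g bg; split; first exact: (smf_continuous bg).
by move=> x i; have [g' _ D] := smf_derive i bg; have [] := D x.
Qed.

Definition cutoff (c : R) (x : 'rV[R]_N) : R := flat 1 (1 - c * sqnorm x).

Lemma smf_cutoff c : smf true (cutoff c).
Proof. exact: SFcut. Qed.

Lemma cutoff_compact f c : 0 < c ->
  compact (closure [set x | f x * cutoff c x != 0]).
Proof.
(* On the support each squared coordinate is below 1/c, hence below M^2; this [M] avoids a square
   root. *)
move=> c0; pose M := 1 + c^-1.
pose box := [set v : 'rV[R]_N | forall i, v ord0 i \in `[(- M), M]].
have cbox : compact box.
  apply: (@rV_compact _  _ (fun=> `[(- M), M]%classic)).
  by move=> _; apply: segment_compact.
apply: (subclosed_compact (@closed_closure _ _) cbox).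
rewrite [X in _ `<=` X](closure_id box).1; last exact: compact_closed.
apply: closure_subset => x /=; rewrite mulf_eq0 negb_or => /andP[_].
rewrite /cutoff /flat; case: ifP => [+ _|_]; last by rewrite eqxx.
rewrite subr_gt0 mulrC -ltr_pdivlMr// mul1r => xc i.
have xi : x 0 i ^+ 2 <= c^-1.
  apply: le_trans (ltW xc); rewrite /sqnorm (bigD1 i) //= lerDl.
  by apply: sumr_ge0 => k _; exact: sqr_ge0.
have ci : 0 < c^-1 by rewrite invr_gt0.
have xM : `|x 0 i| <= M.
  rewrite -(ler_pXn2r (n := 2)) ?nnegrE// ?real_normK ?num_real//.
    by rewrite /M; nra.
  by rewrite /M; lra.
by rewrite in_itv /= -ler_norml.
Qed.

Lemma cutoff_test f c : 0 < c -> smf false f -> smooth_cc (fun x => f x * cutoff c x).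
Proof.
move=> c0 sf; split; last exact: cutoff_compact.
apply: (@smf_smooth true); apply: SFmul; [exact: smf_cut|exact: smf_cutoff].
Qed.

End SmoothClass.

Section ComplexSmooth.
Context {R : realType} {N : nat}.
Local Notation C := (cplx R).
Implicit Types F G : 'rV[R]_N -> C.

Definition csmf F := smf false (fun x => re (F x)) /\ smf false (fun x => im (F x)).

Lemma csmf_eq F G : F =1 G -> csmf F -> csmf G.
Proof. by move=> /funext ->. Qed.
Lemma csmf_const c : csmf (fun=> c).
Proof. by split; exact: SFconst. Qed.
Lemma csmfD F G : csmf F -> csmf G -> csmf (fun x => F x + G x).
Proof.
move=> [F1 F2] [G1 G2]; split.
  by rewrite (_ : (fun _ => _) = fun x => re (F x) + re (G x)); [exact: SFadd|apply/funext => x; rewrite reD].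
by rewrite (_ : (fun _ => _) = fun x => im (F x) + im (G x)); [exact: SFadd|apply/funext => x; rewrite imD].
Qed.
Lemma csmfM F G : csmf F -> csmf G -> csmf (fun x => F x * G x).
Proof.
move=> [F1 F2] [G1 G2]; split.
  rewrite (_ : (fun _ => _) = fun x => re (F x) * re (G x) - im (F x) * im (G x)).
    by apply: smf_sub; exact: SFmul.
  by apply/funext => x; rewrite reM.
rewrite (_ : (fun _ => _) = fun x => re (F x) * im (G x) + im (F x) * re (G x)).
  by apply: SFadd; exact: SFmul.
by apply/funext => x; rewrite imM.
Qed.
Lemma csmf_sum (I : Type) (r : seq I) (F : I -> 'rV[R]_N -> C) :
  (forall i, csmf (F i)) -> csmf (fun x => \sum_(i <- r) F i x).
Proof.
move=> bF; elim: r => [|i r IH].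
  by apply: (csmf_eq (F := fun=> 0)) => [x|]; [rewrite big_nil|exact: csmf_const].
apply: (csmf_eq (F := fun x => F i x + \sum_(j <- r) F j x)) => [x|]; first by rewrite big_cons.
exact: csmfD.
Qed.

Definition cder (k : 'I_N) F G := forall x,
  is_derive x (delta_mx 0 k) (fun y => re (F y)) (re (G x)) /\
  is_derive x (delta_mx 0 k) (fun y => im (F y)) (im (G x)).

Variable k : 'I_N.

Lemma cder_eq F F' G G' : F =1 F' -> G =1 G' -> cder k F G -> cder k F' G'.
Proof. by move=> /funext -> /funext ->. Qed.
Lemma cder_const c : cder k (fun=> c) (fun=> 0).
Proof. by move=> x; split; exact: is_derive_cst. Qed.
Lemma cderD F G F' G' : cder k F F' -> cder k G G' ->
  cder k (fun x => F x + G x) (fun x => F' x + G' x).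
Proof.
move=> dF dG x; have [F1 F2] := dF x; have [G1 G2] := dG x; split.
  have -> : (fun y => re (F y + G y)) = (fun y => re (F y) + re (G y)).
    by apply/funext => y; rewrite reD.
  by rewrite reD; have := is_deriveD F1 G1; exact.
have -> : (fun y => im (F y + G y)) = (fun y => im (F y) + im (G y)).
  by apply/funext => y; rewrite imD.
by rewrite imD; have := is_deriveD F2 G2; exact.
Qed.
Lemma cderM F G F' G' : cder k F F' -> cder k G G' ->
  cder k (fun x => F x * G x) (fun x => F' x * G x + F x * G' x).
Proof.
move=> dF dG x; have [F1 F2] := dF x; have [G1 G2] := dG x; split.
  have -> : (fun y => re (F y * G y)) = (fun y => re (F y) * re (G y) - im (F y) * im (G y)).
    by apply/funext => y; rewrite reM.
  have D := is_deriveB (is_deriveM F1 G1) (is_deriveM F2 G2).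
  by apply: (is_derive_eq D); rewrite reD !reM /GRing.scale /=; ring.
have -> : (fun y => im (F y * G y)) = (fun y => re (F y) * im (G y) + im (F y) * re (G y)).
  by apply/funext => y; rewrite imM.
have D := is_deriveD (is_deriveM F1 G2) (is_deriveM F2 G1).
by apply: (is_derive_eq D); rewrite imD !imM /GRing.scale /=; ring.
Qed.
Lemma cder_sum (I : Type) (r : seq I) (F G : I -> 'rV[R]_N -> C) :
  (forall i, cder k (F i) (G i)) ->
  cder k (fun x => \sum_(i <- r) F i x) (fun x => \sum_(i <- r) G i x).
Proof.
move=> bF; elim: r => [|i r IH].
  apply: (cder_eq _ _ (cder_const 0)) => x; by rewrite big_nil.
by apply: (cder_eq _ _ (cderD (bF i) IH)) => x; rewrite big_cons.
Qed.
Lemma cder_coord l : cder k (fun x => mkC (x 0 l) 0) (fun=> (l == k)%:R).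
Proof.
move=> x; rewrite natr_mkC; split; first exact: is_derive_coord.
exact: is_derive_cst.
Qed.

End ComplexSmooth.

(** * Orthonormal bases of Hermitian tuples and the divergence of polynomial fields *)

Section OrthonormalBasis.
Context {R : realType}.
Local Notation C := (cplx R).
Variables (m n : nat) (e : 'I_(m * n ^ 2) -> 'I_m -> 'M[C]_n).
Hypothesis he : is_onb e.
Local Notation N := (m * n ^ 2)%N.

Lemma onb_herm k j : adjm (e k j) = e k j.
Proof. exact/hermP/(onb_selfadjoint he). Qed.

(** The complex-linear extension of the real coordinates, with which it agrees on Hermitian tuples
    ([cip_herm]): a real orthonormal basis of the Hermitian tuples is a complex one of all
    tuples. *)
Definition cip (A : 'I_m -> 'M[C]_n) k : C := \sum_j ntr (A j * e k j).

Lemma cip_herm (A : 'I_m -> 'M[C]_n) k : (forall j, adjm (A j) = A j) ->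
  mkC (mx_ip A (e k)) 0 = cip A k.
Proof.
move=> hA; rewrite /mx_ip /cip; apply: cplxP; rewrite ?re_sum ?im_sum//=.
apply/esym/big1 => j _.
have : ntr (A j * e k j) = (ntr (A j * e k j))^*.
  by rewrite -ntr_adjm adjmM hA onb_herm ntr_mulC.
by move/(congr1 (@im R)); rewrite imJ; lra.
Qed.

Lemma mx_herm_is (A : 'M[C]_n) : adjm A = A -> A \is hermsymmx.
Proof.
move=> hA; apply/is_hermitianmxP; rewrite expr0 scale1r -[LHS]hA.
by apply/matrixP => i j; rewrite !mxE.
Qed.

Lemma onb_expand_herm (A : 'I_m -> 'M[C]_n) : (forall j, adjm (A j) = A j) ->
  forall j, A j = \sum_k cip A k *: e k j.
Proof.
move=> hA j; rewrite {1}(onb_span he (A := A)) => [|i]; last exact: mx_herm_is.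
by apply: eq_bigr => k _; rewrite cip_herm.
Qed.

Lemma cip_comb (c : C) A B k :
  cip (fun j => c%:M * A j + B j) k = c * cip A k + cip B k.
Proof.
rewrite /cip mulr_sumr -big_split; apply: eq_bigr => j _ /=.
by rewrite mulrDl ntrD -mulrA ntr_scalarM.
Qed.

Lemma adjm_comb (c : C) (A B : 'M[C]_n) : adjm (c%:M * A + B) = (c^*)%:M * adjm A + adjm B.
Proof. by rewrite adjmD adjmM adjm_scalar; congr (_ + _); exact: scalar_mxC. Qed.

(** By linearity from the Hermitian case, since A = A1 + i A2 with Hermitian parts A1 = (A + adjm A)
    / 2 and A2 = -i (A - adjm A) / 2. *)
Lemma onb_expand (A : 'I_m -> 'M[C]_n) j : A j = \sum_k cip A k *: e k j.
Proof.
pose c : C := mkC 2^-1 0; pose d : C := mkC 0 (- 2^-1); pose ii : C := mkC 0 1.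
pose A1 j := c%:M * A j + c%:M * adjm (A j).
pose A2 j := d%:M * A j + (- d)%:M * adjm (A j).
have h1 i : adjm (A1 i) = A1 i.
  rewrite /A1 adjm_comb adjmM adjmK adjm_scalar.
  have -> : c^* = c by apply: cplxP; rewrite ?reJ ?imJ //= oppr0.
  by rewrite addrC; congr (_ + _); rewrite -[RHS]scalar_mxC.
have h2 i : adjm (A2 i) = A2 i.
  rewrite /A2 adjm_comb adjmM adjmK adjm_scalar.
  have -> : d^* = - d by apply: cplxP; rewrite ?reJ ?imJ ?reN ?imN//= oppr0.
  have -> : (- d)^* = d by apply: cplxP; rewrite ?reJ ?imJ ?reN ?imN//= ?oppr0 ?opprK.
  by rewrite addrC; congr (_ + _); rewrite -[RHS]scalar_mxC.
have AE i : A i = ii%:M * A2 i + A1 i.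
  rewrite /A1 /A2 mulrDr !mulrA -!scalM.
  have -> : ii * d = c by apply: cplxP; rewrite ?reM ?imM /=; ring.
  have -> : ii * - d = - c by apply: cplxP; rewrite ?reM ?imM ?reN ?imN /=; ring.
  rewrite addrACA -!mulrDl -!scalD addNr raddf0 mul0r addr0.
  have -> : c + c = 1 by apply: cplxP; rewrite ?reD ?imD /=; lra.
  by rewrite mul1r.
rewrite AE (onb_expand_herm h1 j) (onb_expand_herm h2 j).
rewrite -[_%:M * _]/(_%:M *m _) mul_scalar_mx scaler_sumr -big_split /=.
apply: eq_bigr => k _; rewrite scalerA -scalerDl -cip_comb.
by congr (_ *: _); apply: eq_bigr => i _; rewrite -AE.
Qed.

Lemma cip_delta a b i k : cip (fun j => if j == i then delta_mx a b else 0) k = e k i b a / n%:R.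
Proof.
rewrite /cip (bigD1 i) //= eqxx big1 ?addr0; last first.
  by move=> j /negbTE ->; rewrite mul0r ntr0.
rewrite /ntr; congr (_ / _); rewrite /mxtrace (bigD1 a) //= big1 ?addr0.
  rewrite mxE (bigD1 b) //= big1 ?addr0 ?mxE ?eqxx ?mul1r// => l /negbTE lb.
  by rewrite mxE lb andbF mul0r.
move=> l /negbTE la; rewrite mxE big1// => l' _.
by rewrite mxE la mul0r.
Qed.

Hypothesis n0 : (0 < n)%N.
Lemma nC_neq0 : n%:R != 0 :> C. Proof. by rewrite pnatr_eq0 -lt0n. Qed.

(** The completeness relation of the basis: the expansion of a matrix unit, read at one entry. The
    factor n undoes the normalization of the trace. *)
Lemma onb_contraction i j a b c d :
  \sum_k e k i b a * e k j c d = ((i == j) && (a == c) && (b == d))%:R * n%:R.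
Proof.
have := congr1 (fun M : 'M[C]_n => M c d)
  (onb_expand (fun j => if j == i then delta_mx a b else 0) j).
rewrite /= summxE => h.
have -> : \sum_k e k i b a * e k j c d = n%:R * \sum_k
    (cip (fun j => if j == i then delta_mx a b else 0) k *: e k j) c d.
  rewrite mulr_sumr; apply: eq_bigr => k _.
  by rewrite cip_delta mxE mulrA mulrC [n%:R * _]mulrC divfK ?nC_neq0// mulrC.
rewrite -h mulrC; congr (_ * _); rewrite (eq_sym i); case: eqP => _ /=; last by rewrite mxE.
by rewrite mxE (eq_sym a) (eq_sym b).
Qed.

(** Contracting over the basis splits a trace into a product of two. This is the mechanism that
    turns a divergence into tr (x) tr of free difference quotients. *)
Lemma onb_trace i j (A B : 'M[C]_n) :
  \sum_k ntr (A * e k i * B * e k j) = (i == j)%:R * n%:R ^+ 2 * (ntr A * ntr B).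
Proof.
have trE k : ntr (A * e k i * B * e k j) =
   (\sum_p \sum_q \sum_r \sum_s A p q * B r s * (e k i q r * e k j s p)) / n%:R.
  rewrite /ntr; congr (_ / _); apply: eq_bigr => p _.
  rewrite mxE; under eq_bigr => s _.
    rewrite mxE mulr_suml; under eq_bigr => r _.
      rewrite mxE !mulr_suml.
      over.
    over.
  rewrite exchange_big /=; under [RHS]eq_bigr => q _ do under eq_bigr => r _ do idtac.
  rewrite [RHS]exchange_big /=; apply: eq_bigr => r _.
  rewrite exchange_big /=; apply: eq_bigr => q _.
  by apply: eq_bigr => s _; ring.
under eq_bigr => k _ do rewrite trE.
rewrite -mulr_suml exchange_big /=.
have step p : \sum_k \sum_q \sum_r \sum_s A p q * B r s * (e k i q r * e k j s p) =
    (i == j)%:R * n%:R * (A p p * \tr B).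
  rewrite exchange_big /=; under eq_bigr => q _ do rewrite exchange_big /=.
  under eq_bigr => q _ do under eq_bigr => r _ do rewrite exchange_big /=.
  under eq_bigr => q _ do under eq_bigr => r _ do under eq_bigr => s _ do
    rewrite -mulr_sumr onb_contraction.
  rewrite (bigD1 p) //= [X in _ + X]big1 ?addr0; last first.
    move=> q /negbTE qp; rewrite big1// => r _; rewrite big1// => s _.
    by rewrite qp andbF mul0r mulr0.
  rewrite /mxtrace mulr_sumr mulr_sumr; apply: eq_bigr => r _.
  rewrite (bigD1 r) //= big1 ?addr0; last first.
    by move=> s /negbTE sr; rewrite (eq_sym r) sr andbF /= mul0r mulr0.
  rewrite !eqxx !andbT; ring.
under eq_bigr => p _ do rewrite step.
rewrite -mulr_sumr -mulr_suml -/(\tr A) /ntr.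
by field; exact: nC_neq0.
Qed.

Lemma onb_parseval (A : 'I_m -> 'M[C]_n) :
  \sum_k sqmod (cip A k) = \sum_j mform (A j) (A j).
Proof.
have cipJ k : (cip A k)^* = \sum_j ntr (e k j * adjm (A j)).
  rewrite /cip rmorph_sum; apply: eq_bigr => j _.
  by rewrite -[LHS]/((ntr (A j * e k j))^*) -ntr_adjm adjmM onb_herm.
have h : \sum_k cip A k * (cip A k)^* = \sum_j ntr (A j * adjm (A j)).
  under eq_bigr => k _ do rewrite cipJ mulr_sumr.
  rewrite exchange_big /=; apply: eq_bigr => j _.
  rewrite {2}(onb_expand A j) mulr_suml ntr_sum; apply: eq_bigr => k _.
  by rewrite -mul_scalar_mx -[_%:M *m _]/(_%:M * _) -mulrA ntr_scalarM.
have := congr1 (@re R) h; rewrite !re_sum => h'.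
rewrite /mform -h'; apply: eq_bigr => k _; by rewrite mulcJ.
Qed.

End OrthonormalBasis.

Section PolynomialFields.
Context {R : realType}.
Local Notation C := (cplx R).
Variables (m n : nat) (e : 'I_(m * n ^ 2) -> 'I_m -> 'M[C]_n) (Y : nat -> 'M[C]_n).
Hypothesis he : is_onb e.
Local Notation N := (m * n ^ 2)%N.
Local Notation J := ('I_m + nat)%type.

Definition mx_of (x : 'rV[R]_N) (j : 'I_m) : 'M[C]_n := \sum_k mkC (x 0 k) 0 *: e k j.
Local Notation Zx x := (join_tuple (mx_of x) Y).
Local Notation pev p x := (mev (Zx x) p).
Local Notation dsumx x i := (dsum (fun c : C => c%:M) (Zx x) (inl i)).

Lemma mx_of_coord (A : 'I_m -> 'M[C]_n) j : (forall j, A j \is hermsymmx) ->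
  mx_of (mx_coord e A) j = A j.
Proof.
move=> hA; rewrite [RHS](onb_span he hA); apply: eq_bigr => k _.
by rewrite mxE.
Qed.

Lemma csmf_entry p a b : csmf (fun x => pev p x a b).
Proof.
elim: p a b => [|c|[i|j]|p IHp q IHq|p IHp q IHq] a b.
- exact: csmf_const.
- exact: csmf_const.
- apply: (csmf_eq (F := fun x => \sum_k mkC (x 0 k) 0 * e k i a b)) => [x|].
    by rewrite /mev /= /mx_of summxE; apply: eq_bigr => k _; rewrite mxE.
  apply: csmf_sum => k; apply: csmfM; last exact: csmf_const.
  by split; [exact: SFcoord|exact: SFconst].
- exact: csmf_const.
- apply: (csmf_eq (F := fun x => pev p x a b + pev q x a b)) => [x|].
    by rewrite /mev /= mxE.
  exact: csmfD.
apply: (csmf_eq (F := fun x => \sum_c pev p x a c * pev q x c b)) => [x|].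
  by rewrite /mev /= mxE.
by apply: csmf_sum => c; exact: csmfM.
Qed.

Definition pder k p x : 'M[C]_n := \sum_i dsumx x i (fun s t => s * e k i * t) p.

Lemma pder_mul k p q x : pder k (NCmul p q) x = pder k p x * pev q x + pev p x * pder k q x.
Proof.
rewrite /pder mulr_suml mulr_sumr -big_split /=; apply: eq_bigr => i _.
rewrite dsum_mul; congr (_ + _).
  rewrite /dsum mulr_suml; apply: eq_bigr => t _; by rewrite mulrA.
rewrite /dsum mulr_sumr; apply: eq_bigr => t _; by rewrite -!mulrA.
Qed.

Lemma cder_entry k p a b : cder k (fun x => pev p x a b) (fun x => pder k p x a b).
Proof.
elim: p a b => [|c|[i|j]|p IHp q IHq|p IHp q IHq] a b.
- apply: (cder_eq _ _ (cder_const k ((1 : 'M[C]_n) a b))) => // x.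
  by rewrite /pder big1 ?mxE// => i _; rewrite dsum_one.
- apply: (cder_eq _ _ (cder_const k (c%:M a b))) => // x.
  by rewrite /pder big1 ?mxE// => i _; rewrite dsum_const.
- have h := cder_sum (index_enum _) (fun l => cderM (cder_coord k l) (cder_const k (e l i a b))).
  apply: (cder_eq _ _ h) => x.
    by rewrite /mev /= /mx_of summxE; apply: eq_bigr => l _; rewrite mxE.
  rewrite (bigD1 k) //= eqxx mul1r mulr0 addr0 big1 ?addr0; last first.
    by move=> l /negbTE ->; rewrite mul0r mulr0 addr0.
  rewrite /pder (bigD1 i) //= dsum_var eqxx mul1r mulr1 big1 ?addr0// => l /negbTE li.
  rewrite dsum_var; case: eqP => // -[il]; by rewrite il eqxx in li.
- apply: (cder_eq _ _ (cder_const k (Y j a b))) => // x.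
  by rewrite /pder big1 ?mxE// => i _; rewrite dsum_var.
- apply: (cder_eq _ _ (cderD (IHp a b) (IHq a b))) => x; first by rewrite /mev /= mxE.
  rewrite /pder -[RHS]/((pder k (NCadd p q) x) a b) /pder.
  under [in RHS]eq_bigr => i _ do rewrite dsum_add.
  by rewrite big_split /= [in RHS]mxE.
apply: (cder_eq _ _ (cder_sum (index_enum _) (fun c => cderM (IHp a c) (IHq c b)))) => x.
  by rewrite /mev /= mxE.
by rewrite pder_mul big_split /= !mxE.
Qed.

Variable f : 'I_m -> ncpoly C J.

Definition field k x : C := cip e (fun j => pev (f j) x) k.
Definition field_der k x : C := \sum_j ntr (pder k (f j) x * e k j).

Lemma ntr_mulE (A B : 'M[C]_n) : ntr (A * B) = \sum_a \sum_b A a b * (B b a * n%:R^-1).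
Proof.
rewrite /ntr /mxtrace mulr_suml; apply: eq_bigr => a _; rewrite mxE mulr_suml.
by apply: eq_bigr => b _; rewrite mulrA.
Qed.

Lemma csmf_field k : csmf (field k).
Proof.
apply: csmf_sum => j; apply: (csmf_eq (F := fun x => \sum_a \sum_b
  pev (f j) x a b * (e k j b a * n%:R^-1))) => [x|]; first by rewrite ntr_mulE.
apply: csmf_sum => a; apply: csmf_sum => b; apply: csmfM; last exact: csmf_const.
exact: csmf_entry.
Qed.

Lemma cder_field k : cder k (field k) (field_der k).
Proof.
apply: cder_sum => j.
have h := cder_sum (index_enum _) (fun a => cder_sum (index_enum _)
  (fun b => cderM (cder_entry k (f j) a b) (cder_const k (e k j b a * n%:R^-1)))).
apply: (cder_eq _ _ h) => x; rewrite ntr_mulE; first by [].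
apply: eq_bigr => a _; apply: eq_bigr => b _.
by rewrite mulr0 addr0.
Qed.

Definition mdiv (Z : J -> 'M[C]_n) : C :=
  \sum_i dsum (fun c : C => c%:M) Z (inl i) (fun a b => ntr a * ntr b) (f i).

Lemma field_div x : (0 < n)%N -> \sum_k field_der k x = n%:R ^+ 2 * mdiv (Zx x).
Proof.
move=> n0; rewrite /field_der exchange_big /= /mdiv mulr_sumr.
apply: eq_bigr => j _.
under eq_bigr => k _ do rewrite /pder mulr_suml ntr_sum.
rewrite exchange_big /= (bigD1 j) //= [X in _ + X]big1 ?addr0; last first.
  move=> i /negbTE ij; under eq_bigr => k _ do rewrite /dsum mulr_suml ntr_sum.
  rewrite exchange_big big1//= => t _; rewrite (onb_trace he n0) ij.
  by rewrite !mul0r.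
under eq_bigr => k _ do rewrite /dsum mulr_suml ntr_sum.
rewrite exchange_big /= /dsum mulr_sumr; apply: eq_bigr => t _.
by rewrite (onb_trace he n0) eqxx mul1r.
Qed.

Lemma field_parseval x : \sum_k sqmod (field k x) = \sum_j mform (pev (f j) x) (pev (f j) x).
Proof. exact: onb_parseval. Qed.

End PolynomialFields.

(** * Integration by parts against polynomials *)

Section Expectations.
Context {R : realType} (d : measure_display) (T : measurableType d) (P : probability T R).
Implicit Types g h : T -> R.

Definition rint g := P.-integrable [set: T] (EFin \o g).
Definition EI g : R := Rintegral P [set: T] g.
Local Notation mfun g := (measurable_fun [set: T] g).

Lemma rint_measurable g : rint g -> mfun g.
Proof. by move=> /integrableP[/measurable_EFinP]. Qed.
Lemma rint_le g h : mfun g -> (forall w, `|g w| <= h w) -> rint h -> rint g.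
Proof.
move=> mg gh; apply: le_integrable => //; first exact/measurable_EFinP.
move=> w _ /=; rewrite lee_fin; apply: le_trans (gh w) _; exact: ler_norm.
Qed.
Lemma rintD g h : rint g -> rint h -> rint (fun w => g w + h w).
Proof. by move=> ig ih; have := integrableD measurableT ig ih; apply: eq_integrable. Qed.
Lemma rintZ c g : rint g -> rint (fun w => c * g w).
Proof. by move=> ig; have := integrableZl measurableT c ig; apply: eq_integrable. Qed.
Lemma rintN g : rint g -> rint (fun w => - g w).
Proof. by move=> ig; have := integrableN ig; apply: eq_integrable. Qed.
Lemma rintB g h : rint g -> rint h -> rint (fun w => g w - h w).
Proof. by move=> ig ih; apply: rintD => //; exact: rintN. Qed.
Lemma rint_cst c : rint (fun=> c).
Proof. exact: finite_measure_integrable_cst. Qed.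
Lemma rint_sum (I : Type) (r : seq I) (F : I -> T -> R) :
  (forall i, rint (F i)) -> rint (fun w => \sum_(i <- r) F i w).
Proof.
move=> iF; elim: r => [|i r IH].
  by rewrite (_ : (fun _ => _) = fun=> 0); [exact: rint_cst|apply/funext => w; rewrite big_nil].
rewrite (_ : (fun _ => _) = fun w => F i w + \sum_(j <- r) F j w); first exact: rintD.
by apply/funext => w; rewrite big_cons.
Qed.
Lemma rint_norm g : rint g -> rint (fun w => `|g w|).
Proof. exact: integrable_norm. Qed.
Lemma rint_fin g : mfun g -> (forall w, 0 <= g w) ->
  (\int[P]_w (g w)%:E < +oo)%E -> rint g.
Proof.
move=> mg g0 fin; apply/integrableP; split; first exact/measurable_EFinP.
rewrite (eq_integral (fun w => (g w)%:E))// => w _ /=.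
by rewrite ger0_norm.
Qed.

Lemma EID g h : rint g -> rint h -> EI (fun w => g w + h w) = EI g + EI h.
Proof. exact: RintegralD. Qed.
Lemma EIB g h : rint g -> rint h -> EI (fun w => g w - h w) = EI g - EI h.
Proof. exact: RintegralB. Qed.
Lemma EIZ c g : rint g -> EI (fun w => c * g w) = c * EI g.
Proof. by move=> ig; exact: RintegralZl. Qed.
Lemma EI_cst c : EI (fun=> c) = c.
Proof. by rewrite /EI Rintegral_cst// -[fine _]/(fine (P setT)) probability_setT /= mulr1. Qed.
Lemma EI_le g h : rint g -> rint h -> (forall w, g w <= h w) -> EI g <= EI h.
Proof. by move=> ig ih gh; apply: le_Rintegral. Qed.
Lemma EI_ge0 g : (forall w, 0 <= g w) -> 0 <= EI g.
Proof. by move=> g0; apply: Rintegral_ge0. Qed.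
Lemma EI_sum (I : Type) (r : seq I) (F : I -> T -> R) :
  (forall i, rint (F i)) -> EI (fun w => \sum_(i <- r) F i w) = \sum_(i <- r) EI (F i).
Proof.
move=> iF; elim: r => [|i r IH].
  rewrite big_nil (_ : (fun _ => _) = fun=> 0); first exact: EI_cst.
  by apply/funext => w; rewrite big_nil.
rewrite big_cons -IH -EID//; last exact: rint_sum.
by congr EI; apply/funext => w; rewrite big_cons.
Qed.
Lemma EI_norm g : rint g -> `|EI g| <= EI (fun w => `|g w|).
Proof. by move=> ig; exact: le_normr_Rintegral. Qed.
Lemma EFin_EI g : rint g -> (\int[P]_w (g w)%:E)%E = (EI g)%:E.
Proof.
move=> ig; rewrite /EI /Rintegral fineK//.
by have := integrable_fin_num measurableT ig.
Qed.

Lemma EI_dct (u : nat -> T -> R) g h : (forall k, mfun (u k)) -> mfun g ->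
  (forall w, u k w @[k --> \oo] --> g w) ->
  (forall k w, `|u k w| <= h w) -> rint h ->
  EI (u k) @[k --> \oo] --> EI g.
Proof.
move=> mu mg ug uh ih.
have [|||||ig _ c] := @dominated_convergence _ _ _ P setT measurableT (fun k => EFin \o u k)
  (EFin \o g) (EFin \o h).
- by move=> k; exact/measurable_EFinP.
- exact/measurable_EFinP.
- apply: aeW => w _; apply/fine_cvgP; split; first by near=> k.
  exact: ug.
- exact: ih.
- by apply: aeW => w k _; rewrite /= lee_fin.
by move: c; rewrite EFin_EI// => /fine_cvg.
Unshelve. all: by end_near. Qed.

End Expectations.

Section PolynomialGrowth.
Context {R : realType} {N : nat}.
Implicit Types f g : 'rV[R]_N -> R.

Lemma sqnorm_ge0 (x : 'rV[R]_N) : 0 <= sqnorm x.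
Proof. by apply: sumr_ge0 => k _; exact: sqr_ge0. Qed.

Lemma smf_growth f : smf false f -> exists C K, 0 <= C /\
  forall x, `|f x| <= C * (1 + sqnorm x) ^+ K.
Proof.
suff H b : smf b f -> b = false -> exists C K, 0 <= C /\
  forall x, `|f x| <= C * (1 + sqnorm x) ^+ K by move=> /H; exact.
have s1 (x : 'rV[R]_N) : 1 <= 1 + sqnorm x by rewrite lerDl sqnorm_ge0.
elim=> [c|j|P c -> //|f1 f2 h1 c1 h2 c2|f1 f2 h1 c1 h2 c2] b0.
- by exists `|c|, 0%N; split=> // x; rewrite expr0 mulr1.
- exists 1, 1%N; split=> // x; rewrite mul1r expr1.
  have h : x 0 j ^+ 2 <= sqnorm x.
    rewrite /sqnorm (bigD1 j) //= lerDl; apply: sumr_ge0 => k _; exact: sqr_ge0.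
  have := sqr_ge0 (`|x 0 j| - 1); rewrite sqrrB real_normK ?num_real//; have := sqnorm_ge0 x; lra.
- have [C1 [K1 [C10 H1]]] := c1 b0; have [C2 [K2 [C20 H2]]] := c2 b0.
  exists (C1 + C2), (K1 + K2)%N; split=> [|x]; first exact: addr_ge0.
  apply: le_trans (ler_normD _ _) _; rewrite mulrDl; apply: lerD.
    apply: le_trans (H1 x) _; rewrite ler_wpM2l// ler_weXn2l// leq_addr.
    by [].
  apply: le_trans (H2 x) _; rewrite ler_wpM2l// ler_weXn2l// leq_addl.
  by [].
- have [C1 [K1 [C10 H1]]] := c1 b0; have [C2 [K2 [C20 H2]]] := c2 b0.
  exists (C1 * C2), (K1 + K2)%N; split=> [|x]; first exact: mulr_ge0.
  rewrite normrM exprD mulrACA; apply: ler_pM => //.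
Qed.

Lemma onep_exp_le (s : R) K : 0 <= s -> (1 + s) ^+ K <= 2 ^+ K * (1 + s ^+ K).
Proof.
move=> s0; have [s1|s1] := leP s 1.
  apply: (@le_trans _ _ (2 ^+ K)).
    by apply: lerXn2r; rewrite ?nnegrE; lra.
  by rewrite ler_peMr ?exprn_ge0// lerDl exprn_ge0.
apply: (@le_trans _ _ ((2 * s) ^+ K)).
  by apply: lerXn2r; rewrite ?nnegrE; lra.
by rewrite exprMn ler_wpM2l ?exprn_ge0// lerDr.
Qed.

End PolynomialGrowth.

Section RandomMatrix.
Context {R : realType}.
Local Notation C := (cplx R).
Variables (m n : nat) (e : 'I_(m * n ^ 2) -> 'I_m -> 'M[C]_n) (Y : nat -> 'M[C]_n).
Hypothesis he : is_onb e.
Local Notation N := (m * n ^ 2)%N.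
Local Notation J := ('I_m + nat)%type.
Context (d : measure_display) (T : measurableType d) (P : probability T R).
Variable X : T -> 'I_m -> 'M[C]_n.
Hypotheses (hX : random_mx_tuple X) (hmom : finite_moments P X).
Local Notation mfun g := (measurable_fun [set: T] g).

Definition xc (w : T) : 'rV[R]_N := mx_coord e (X w).

Lemma X_herm w j : adjm (X w j) = X w j.
Proof. exact/hermP/(proj1 hX). Qed.

Lemma mx_of_xc w j : mx_of e (xc w) j = X w j.
Proof. by apply: mx_of_coord => // i; exact: (proj1 hX). Qed.

Lemma measurable_sum_fun (I : Type) (r : seq I) (F : I -> T -> R) :
  (forall i, mfun (F i)) -> mfun (fun w => \sum_(i <- r) F i w).
Proof. exact: measurable_sum. Qed.

Lemma xc_measurable k : mfun (fun w => xc w 0 k).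
Proof.
have -> : (fun w => xc w 0 k) = (fun w => \sum_j \sum_a \sum_b
   (re (X w j a b) * re (e k j b a * n%:R^-1) - im (X w j a b) * im (e k j b a * n%:R^-1))).
  apply/funext => w; rewrite mxE /mx_ip; apply: eq_bigr => j _.
  rewrite -[X w j *m _]/(X w j * _) ntr_mulE re_sum; apply: eq_bigr => a _.
  by rewrite re_sum; apply: eq_bigr => b _; rewrite reM.
apply: measurable_sum_fun => j; apply: measurable_sum_fun => a; apply: measurable_sum_fun => b.
have [mr mi] := proj2 hX j a b.
apply: measurable_funB; apply: measurable_funM => //; exact: measurable_cst.
Qed.

Lemma smf_measurable b f : smf b f -> mfun (fun w => f (xc w)).
Proof.
elim=> [c|k|p c _|f1 f2 _ h1 _ h2|f1 f2 _ h1 _ h2].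
- exact: measurable_cst.
- exact: xc_measurable.
- apply: (@measurableT_comp _ _ _ _ _ _ (flat p)).
    by apply: continuous_measurable_fun; exact: continuous_flat.
  apply: measurable_funB; first exact: measurable_cst.
  apply: measurable_funM; first exact: measurable_cst.
  apply: measurable_sum_fun => k; apply: measurable_funX; exact: xc_measurable.
- exact: measurable_funD.
- exact: measurable_funM.
Qed.

Lemma mform_herm w j : mform (X w j) (X w j) = re (ntr (X w j *m X w j)).
Proof. by rewrite /mform X_herm. Qed.

Lemma sqnorm_xc w : sqnorm (xc w) = mx_norm2 (X w) ^+ 2.
Proof.
have ipE : mx_ip (X w) (X w) = \sum_j mform (X w j) (X w j).
  by apply: eq_bigr => j _; rewrite mform_herm.
rewrite /mx_norm2 sqr_sqrtr ipE; last by apply: sumr_ge0 => j _; exact: mform_ge0.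
rewrite -(onb_parseval he); apply: eq_bigr => k _.
rewrite -(cip_herm he) => [|j]; last exact: X_herm.
by rewrite /sqmod /= expr0n addr0 mxE.
Qed.

Lemma rint_growth K : rint P (fun w => (1 + sqnorm (xc w)) ^+ K).
Proof.
have ms : mfun (fun w => sqnorm (xc w)) by apply: smf_measurable (smf_sqnorm false).
have ms' : mfun (fun w => 1 + sqnorm (xc w)) by apply: measurable_funD => //; exact: measurable_cst.
apply: (@rint_le _ _ _ _ _ (fun w => 2 ^+ K * (1 + sqnorm (xc w) ^+ K))).
- exact: measurable_funX.
- move=> w; rewrite ger0_norm ?onep_exp_le ?sqnorm_ge0// exprn_ge0// addr_ge0// sqnorm_ge0.
  by [].
apply: rintZ; apply: rintD; first exact: rint_cst.
apply: rint_fin.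
- exact: measurable_funX.
- by move=> w; rewrite exprn_ge0// sqnorm_ge0.
have := hmom (2 * K); congr (_ < _)%E; apply: eq_integral => w _.
by rewrite sqnorm_xc exprM.
Qed.

Lemma smf_rint f : smf false f -> rint P (fun w => f (xc w)).
Proof.
move=> sf; have [K1 [K [K10 H]]] := smf_growth sf.
apply: (rint_le (smf_measurable sf) (fun w => H (xc w))).
by apply: rintZ; exact: rint_growth.
Qed.

End RandomMatrix.

Section IntegrationByParts.
Context {R : realType}.
Local Notation C := (cplx R).
Variables (m n : nat) (e : 'I_(m * n ^ 2) -> 'I_m -> 'M[C]_n) (Y : nat -> 'M[C]_n).
Hypothesis he : is_onb e.
Local Notation N := (m * n ^ 2)%N.
Local Notation J := ('I_m + nat)%type.
Context (d : measure_display) (T : measurableType d) (P : probability T R).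
Variable X : T -> 'I_m -> 'M[C]_n.
Hypotheses (hX : random_mx_tuple X) (hmom : finite_moments P X).
Local Notation mfun g := (measurable_fun [set: T] g).
Local Notation xc := (xc e X).
Variable f : 'I_m -> ncpoly C J.
Local Notation F := (field e Y f).
Local Notation G := (field_der e Y f).

Section ForScore.
Variable Xi : T -> 'rV[C]_N.
Hypothesis hXi : is_score P xc Xi.

Let A w : R := \sum_k (re (Xi w 0 k) * re (F k (xc w)) + im (Xi w 0 k) * im (F k (xc w))).
Let D w : R := \sum_k re (G k (xc w)).

Lemma smf_reG k : smf false (fun x => re (G k x)).
Proof.
have [sF _] := csmf_field e Y f k.
have -> : (fun x => re (G k x)) = partial k (fun x => re (F k x)).
  by apply/funext => x; have [h _] := cder_field e Y f k x; rewrite /partial derive_val.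
exact: smf_partial.
Qed.

Lemma rint_score k : rint P (fun w => sqmod (Xi w 0 k)).
Proof.
have [mr mi] := score_measurable hXi k.
apply: rint_fin; last exact: (score_L2 hXi).
  by apply: measurable_funD; exact: measurable_funX.
by move=> w; exact: sqmod_ge0.
Qed.

Lemma rint_field k : rint P (fun w => sqmod (F k (xc w))).
Proof.
have [sr si] := csmf_field e Y f k.
apply: (smf_rint he hX hmom (f := fun x => re (F k x) ^+ 2 + im (F k x) ^+ 2)).
have -> : (fun x => re (F k x) ^+ 2 + im (F k x) ^+ 2) =
    (fun x => re (F k x) * re (F k x) + im (F k x) * im (F k x)).
  by apply/funext => x; rewrite !expr2.
by apply: SFadd; exact: SFmul.
Qed.

Lemma rint_A : rint P A.
Proof.
apply: rint_sum => k; have [mr mi] := score_measurable hXi k.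
have [sr si] := csmf_field e Y f k.
apply: (@rint_le _ _ _ _ _ (fun w => sqmod (Xi w 0 k) + sqmod (F k (xc w)))).
- apply: measurable_funD; apply: measurable_funM => //.
    exact: (smf_measurable e hX sr).
  exact: (smf_measurable e hX si).
- move=> w; rewrite /sqmod; move: (re _) (im _) (re (F _ _)) (im (F _ _)) => a b c g.
  have := sqr_ge0 (a - c); have := sqr_ge0 (a + c).
  have := sqr_ge0 (b - g); have := sqr_ge0 (b + g).
  have := sqr_ge0 a; have := sqr_ge0 b; have := sqr_ge0 c; have := sqr_ge0 g.
  rewrite !expr2 => *; rewrite ler_norml; apply/andP; split; lra.
- by apply: rintD; [exact: rint_score|exact: rint_field].
Qed.

Lemma rint_D : rint P D.
Proof. by apply: rint_sum => k; exact: (smf_rint he hX hmom (smf_reG k)). Qed.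

(** The cutoff with parameter [cr r] is supported in |x|^2 <= r + 1. *)
Let cr (r : nat) : R := r.+1%:R^-1.
(** The partial derivative of [cutoff c] in the coordinate [k], by [is_derive_flat_sqnorm]. *)
Let dcut c k (x : 'rV[R]_N) : R := flat (dflat 1) (1 - c * sqnorm x) * ((- c * 2) * x 0 k).
Let tf r k (x : 'rV[R]_N) : C :=
  mkC (re (F k x) * cutoff (cr r) x) (im (F k x) * cutoff (cr r) x).

Lemma cr_gt0 r : 0 < cr r. Proof. by rewrite invr_gt0 ltr0n. Qed.
Lemma cr_le1 r : cr r <= 1. Proof. by rewrite invf_le1 ?ltr0n// ler1n. Qed.
Lemma cr_cvg : cr r @[r --> \oo] --> (0 : R).
Proof. exact: cvg_harmonic. Qed.

Lemma truncated_ibp r : EI P (fun w => cutoff (cr r) (xc w) * A w) =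
  EI P (fun w => cutoff (cr r) (xc w) * D w +
    \sum_k re (F k (xc w)) * dcut (cr r) k (xc w)).
Proof.
have tfP k : test_function (tf r k).
  have [sr si] := csmf_field e Y f k.
  by split; [apply: (cutoff_test (cr_gt0 r) sr)|apply: (cutoff_test (cr_gt0 r) si)].
have := congr1 (@re R) (score_ibp hXi tfP); rewrite /cexpectation !re_mkC.
have -> : (fun w => re (\sum_(k < N) (Xi w 0 k)^* * tf r k (xc w))) =
   (fun w => cutoff (cr r) (xc w) * A w).
  apply/funext => w; rewrite re_sum /A mulr_sumr; apply: eq_bigr => k _.
  by rewrite reM reJ imJ /=; ring.
rewrite -/(EI P (fun w => cutoff (cr r) (xc w) * A w)) => ->.
rewrite /EI; congr (Rintegral _ _ _); apply/funext => w.
rewrite /divergence re_sum /D mulr_sumr -big_split /=; apply: eq_bigr => k _.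
have [h _] := cder_field e Y f k (xc w).
have h2 := is_derive_flat_sqnorm 1 (cr r) k (xc w).
have h3 := is_deriveM h h2.
rewrite /partial -[LHS]/('D_(delta_mx 0 k) ((fun x => re (F k x)) * cutoff (cr r)) (xc w)).
rewrite (@derive_val _ _ _ _ _ _ _ h3) /GRing.scale /= addrC /dcut /cutoff.
by [].
Qed.

(** The cutoffs are not normalized: the limit exp(-1) appears on both sides of the integration by
    parts and is cancelled there. *)
Lemma cutoff_cvg (x : 'rV[R]_N) : cutoff (cr r) x @[r --> \oo] --> flat 1 (1 : R).
Proof.
have h : 1 - cr r * sqnorm x @[r --> \oo] --> (1 : R).
  rewrite -[X in _ --> X]subr0 -(mul0r (sqnorm x)).
  by apply: cvgB; [exact: cvg_cst|apply: cvgM; [exact: cr_cvg|exact: cvg_cst]].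
exact: (cvg_comp _ _ h (@continuous_flat R 1 1)).
Qed.

Lemma dcut_cvg k (x : 'rV[R]_N) : dcut (cr r) k x @[r --> \oo] --> (0 : R).
Proof.
have h : 1 - cr r * sqnorm x @[r --> \oo] --> (1 : R).
  rewrite -[X in _ --> X]subr0 -(mul0r (sqnorm x)).
  by apply: cvgB; [exact: cvg_cst|apply: cvgM; [exact: cr_cvg|exact: cvg_cst]].
have h1 := cvg_comp _ _ h (@continuous_flat R (dflat 1) 1).
rewrite -(mulr0 (flat (dflat 1) (1 : R))).
apply: cvgM; first exact: h1.
have -> : (0 : R) = - 0 * 2 * x 0 k by rewrite oppr0 !mul0r.
apply: cvgM; last exact: cvg_cst.
apply: cvgM; last exact: cvg_cst.
by apply: cvgN; exact: cr_cvg.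
Qed.

Lemma dcut_le r k x : `|dcut (cr r) k x| <= 4 * `|x 0 k|.
Proof.
rewrite /dcut normrM ger0_norm ?dflat1_ge0//.
apply: (@le_trans _ _ (2 * `|- cr r * 2 * x 0 k|)).
  by rewrite ler_wpM2r ?dflat1_le.
rewrite !normrM normrN (ger0_norm (ltW (cr_gt0 r))) [`|2|]ger0_norm//.
have := cr_le1 r; have := cr_gt0 r; have := normr_ge0 (x 0 k).
move: `|x 0 k| => y y0 c0 c1.
have : cr r * y <= y by rewrite ler_piMl.
lra.
Qed.

Lemma cutoff_norm c (x : 'rV[R]_N) : `|cutoff c x| <= 1.
Proof. by rewrite ger0_norm ?flat1_ge0 ?flat1_le1. Qed.

(** Dominated convergence in the truncated identity. The terms with a derivative of the cutoff tend
    to 0 and are dominated, uniformly in r by [dcut_le], by absolute values of polynomials, which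
    finite moments make integrable. *)
Lemma field_ibp : EI P A = EI P D.
Proof.
have k0 : flat 1 (1 : R) != 0 by rewrite /flat ltr01 hornerE mul1r gt_eqF// expR_gt0.
apply: (mulfI k0); rewrite -!EIZ ?rint_D ?rint_A//.
have mcut r : mfun (fun w => cutoff (cr r) (xc w)).
  by apply: (@smf_measurable _ _ _ e _ _ _ hX true); exact: smf_cutoff.
have mA := rint_measurable rint_A; have mD := rint_measurable rint_D.
have cA : EI P (fun w => cutoff (cr r) (xc w) * A w) @[r --> \oo] -->
    EI P (fun w => flat 1 (1 : R) * A w).
  apply: (EI_dct (h := fun w => `|A w|)); last exact/rint_norm/rint_A.
  - by move=> r; exact: measurable_funM.
  - by apply: measurable_funM => //; exact: measurable_cst.
  - by move=> w; apply: cvgM; [exact: cutoff_cvg|exact: cvg_cst].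
  - by move=> r w; rewrite normrM ler_piMl ?cutoff_norm.
have cD : EI P (fun w => cutoff (cr r) (xc w) * D w +
     \sum_k re (F k (xc w)) * dcut (cr r) k (xc w)) @[r --> \oo] -->
    EI P (fun w => flat 1 (1 : R) * D w).
  pose h w := `|D w| + \sum_k `|re (F k (xc w)) * (4 * xc w 0 k)|.
  apply: (EI_dct (h := h)).
  - move=> r; apply: measurable_funD; first exact: measurable_funM.
    apply: measurable_sum_fun => k.
    apply: (@smf_measurable _ _ _ e _ _ _ hX true (fun x => re (F k x) * dcut (cr r) k x)).
    apply: SFmul; first by apply: smf_cut; have [] := csmf_field e Y f k.
    by apply: SFmul; [exact: SFcut|apply: SFmul; [exact: SFconst|exact: SFcoord]].
  - by apply: measurable_funM => //; exact: measurable_cst.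
  - move=> w; rewrite -[X in _ --> X]addr0; apply: cvgD.
      by apply: cvgM; [exact: cutoff_cvg|exact: cvg_cst].
    have z : \sum_k re (F k (xc w)) * 0 = 0 by rewrite big1// => k _; rewrite mulr0.
    rewrite -[X in _ --> X]z.
    apply: (@cvg_sum_seq _ _ _ _ _ _ _ (fun k r => re (F k (xc w)) * dcut (cr r) k (xc w))
      (fun k => re (F k (xc w)) * 0)) => k.
    by apply: cvgM; [exact: cvg_cst|exact: dcut_cvg].
  - move=> r w; apply: le_trans (ler_normD _ _) _; apply: lerD.
      by rewrite normrM ler_piMl ?cutoff_norm.
    apply: le_trans (ler_norm_sum _ _ _) _; apply: ler_sum => k _.
    rewrite [leLHS]normrM [leRHS]normrM ler_wpM2l//.
    by apply: le_trans (dcut_le _ _ _) _; rewrite [leRHS]normrM [`|4|]ger0_norm.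
  - apply: rintD; first exact/rint_norm/rint_D.
    apply: rint_sum => k; apply: (@rint_norm _ _ _ _ (fun w => re (F k (xc w)) * (4 * xc w 0 k))).
    apply: (smf_rint he hX hmom (f := fun x => re (F k x) * (4 * x 0 k))).
    apply: SFmul; first by have [] := csmf_field e Y f k.
    by apply: SFmul; [exact: SFconst|exact: SFcoord].
have E : (fun r => EI P (fun w => cutoff (cr r) (xc w) * A w)) =
    (fun r => EI P (fun w => cutoff (cr r) (xc w) * D w +
      \sum_k re (F k (xc w)) * dcut (cr r) k (xc w))).
  by apply/funext => r; exact: truncated_ibp.
by rewrite E in cA; rewrite -(cvg_lim _ cA)// (cvg_lim _ cD).
Qed.

Hypothesis n0 : (0 < n)%N.
Local Notation Zw w := (join_tuple (X w) Y).

Lemma Zx_xc w : join_tuple (mx_of e (xc w)) Y = Zw w.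
Proof. by apply/funext => -[i|j] //=; exact: mx_of_xc. Qed.

Lemma D_mdiv w : D w = n%:R ^+ 2 * re (mdiv f (Zw w)).
Proof.
rewrite /D -re_sum (field_div Y he f (xc w) n0) Zx_xc -[n%:R ^+ 2]/(n%:R * n%:R) natr_mkC.
by rewrite !reM !imM /=; ring.
Qed.

Definition field_norm w : R := \sum_j mform (mev (Zw w) (f j)) (mev (Zw w) (f j)).

Lemma field_normE w : \sum_k sqmod (F k (xc w)) = field_norm w.
Proof. by rewrite (field_parseval Y he f (xc w)) Zx_xc. Qed.

Lemma rint_field_norm : rint P field_norm.
Proof.
have -> : field_norm = (fun w => \sum_k sqmod (F k (xc w))).
  by apply/funext => w; rewrite field_normE.
by apply: rint_sum => k; exact: rint_field.
Qed.

(** With q = n^-2, the pointwise inequality 2 q <Xi, F> <= q^2 |Xi|^2 + |F|^2 compensates the factor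
    n^2 of the divergence; its first term is the source of n^-4. *)
Lemma score_young : 2 * EI P (fun w => re (mdiv f (Zw w))) <=
  n%:R ^- 4 * EI P (fun w => \sum_k sqmod (Xi w 0 k)) + EI P field_norm.
Proof.
have nR : n%:R ^+ 2 != 0 :> R by rewrite expf_neq0// pnatr_eq0 -lt0n.
have -> : (fun w => re (mdiv f (Zw w))) = (fun w => n%:R ^- 2 * D w).
  by apply/funext => w; rewrite D_mdiv mulKf.
have rS : rint P (fun w => \sum_k sqmod (Xi w 0 k)) by apply: rint_sum => k; exact: rint_score.
have rA := rint_A; have rN := rint_field_norm.
rewrite EIZ; last exact: rint_D.
rewrite -field_ibp -!EIZ//; last exact: rintZ.
rewrite -EID//; last exact: rintZ.
apply: EI_le; [exact/rintZ/rintZ|by apply: rintD => //; exact: rintZ|] => w.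
rewrite -field_normE /A !mulr_sumr -big_split /=; apply: ler_sum => k _.
have -> : n%:R ^- 4 = (n%:R ^- 2) ^+ 2 :> R by rewrite exprVn -exprM.
rewrite /sqmod; move: (n%:R ^- 2) (re _) (im _) (re (F _ _)) (im (F _ _)) => q a b c g.
have := sqr_ge0 (q * a - c); have := sqr_ge0 (q * b - g).
rewrite !expr2 => *; lra.
Qed.

End ForScore.

Lemma fisher_young : (0 < n)%N ->
  ((2 * EI P (fun w => re (mdiv f (join_tuple (X w) Y))))%:E <=
   (n%:R ^- 4)%:E * mx_fisher P e X + (EI P field_norm)%:E)%E.
Proof.
move=> n0; rewrite /mx_fisher /fisher; case: pselect => [h|_]; last first.
  (* Without a score the right side is +oo, since n is positive. *)
  by rewrite gt0_muley ?lte_fin ?invr_gt0 ?exprn_gt0 ?ltr0n// addye// leey.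
case: (cid h) => /= Xi hXi.
have rS : rint P (fun w => \sum_k sqmod (Xi w 0 k)).
  by apply: rint_sum => k; exact: (rint_score hXi).
rewrite EFin_EI// -EFinM -EFinD lee_fin.
exact: (score_young hXi).
Qed.

End IntegrationByParts.

(** * Limits along the ultrafilter *)

Section UltrafilterLimits.
Context {R : realType}.
Variables (U : set_system nat) (hU : UltraFilter U).

Let PU : ProperFilter U := @ultra_proper _ _ hU.

Lemma ultra_lt_ge (f : nat -> \bar R) c : U [set n | (f n < c)%E] \/ U [set n | (c <= f n)%E].
Proof.
have [h|h] := in_ultra_setVsetC [set n | (f n < c)%E] hU; first by left.
by right; apply: filterS h => n /= /negP; rewrite -leNgt.
Qed.

(** An ultrafilter decides every comparison with a constant, so the supremum of the eventual lower
    bounds is the limit. Each [lim] of extended reals in the theorem is thus a genuine limit. *)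
Lemma ultra_cvg_ereal (f : nat -> \bar R) : f n @[n --> U] --> ereal_sup [set x | U [set n | (x <= f n)%E]].
Proof.
set S := [set x | _]; set l := ereal_sup S.
have above c : (l < c)%E -> U [set n | (f n < c)%E].
  move=> lc; have [//|h] := ultra_lt_ge f c.
  have Sc : S c by exact: h.
  by have := ereal_sup_ubound Sc; rewrite leNgt lc.
have below c : (c < l)%E -> U [set n | (c < f n)%E].
  move=> /ereal_sup_gt[x Sx cx]; apply: filterS Sx => n /=; exact: lt_le_trans.
move: above below; case: l => [r| |] above below.
- apply/fine_cvgP; split.
    have h1 : U [set n | (f n < (r + 1)%:E)%E] by apply: above; rewrite lte_fin ltrDl.
    have h2 : U [set n | ((r - 1)%:E < f n)%E] by apply: below; rewrite lte_fin gtrBl.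
    apply: filterS2 h1 h2 => n /=.
    by case: (f n).
  apply/cvgrPdist_lt => e e0.
  have h1 : U [set n | (f n < (r + e)%:E)%E] by apply: above; rewrite lte_fin ltrDl.
  have h2 : U [set n | ((r - e)%:E < f n)%E] by apply: below; rewrite lte_fin gtrBl.
  apply: filterS2 h1 h2 => n /=.
  case: (f n) => [s| |] //=; rewrite !lte_fin => s1 s2.
  by rewrite ltr_norml; apply/andP; split; lra.
- apply/cvgeyPge => A; have := below A%:E (ltry A); apply: filterS => n; exact: ltW.
- apply/cvgeNyPle => A; have := above A%:E (ltNyr A); apply: filterS => n; exact: ltW.
Qed.

Lemma ultra_lim_lt (f : nat -> \bar R) (c : \bar R) : (lim (f n @[n --> U]) < c)%E ->
  U [set n | (f n < c)%E].
Proof.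
have [//|h] := ultra_lt_ge f c.
rewrite (cvg_lim _ (@ultra_cvg_ereal f))//.
have Sc : [set x | U [set n | (x <= f n)%E]] c by exact: h.
by rewrite ltNge (ereal_sup_ubound Sc).
Qed.

End UltrafilterLimits.

Section MatrixPolynomials.
Context {R : realType}.
Local Notation C := (cplx R).

Lemma mev_adj (I : Type) n (Z : I -> 'M[C]_n) (p : ncpoly C I) :
  (forall i, adjm (Z i) = Z i) -> mev Z (ncadj p) = adjm (mev Z p).
Proof.
move=> hZ; elim: p => [|c|i|p IHp q IHq|p IHp q IHq]; rewrite /mev /=.
- by rewrite adjm1.
- by rewrite adjm_scalar.
- by rewrite hZ.
- by rewrite adjmD -[nceval _ _ _]/(mev Z (ncadj p)) IHp -[nceval _ _ (ncadj q)]/(mev Z (ncadj q)) IHq.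
- by rewrite adjmM -[nceval _ _ (ncadj q)]/(mev Z (ncadj q)) IHq -[nceval _ _ (ncadj p)]/(mev Z (ncadj p)) IHp.
Qed.

Lemma sq_re_ntr_le n (A : 'M[C]_n) : re (ntr A) ^+ 2 <= mform A A.
Proof.
have := mform_CauchySchwarz A 1; rewrite {1}/mform adjm1 mulr1 => h.
apply: le_trans h _; apply: ler_piMr; first exact: mform_ge0.
by rewrite /mform adjm1 mulr1 re_ntr_1.
Qed.

Definition ncsq (I : Type) (p : ncpoly C I) := NCmul p (ncadj p).

Lemma re_ntr_ncsq (I : Type) n (Z : I -> 'M[C]_n) (p : ncpoly C I) :
  (forall i, adjm (Z i) = Z i) ->
  re (ntr (mev Z (ncsq p))) = mform (mev Z p) (mev Z p).
Proof. by move=> hZ; rewrite /mform -mev_adj. Qed.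

(** Cauchy-Schwarz for the trace, applied twice. Fourth moments of traces are thereby at most the
    mean trace of one polynomial, which [EI_rv_bounded] controls. *)
Lemma re_ntr_pow4 (I : Type) n (Z : I -> 'M[C]_n) (p : ncpoly C I) :
  (forall i, adjm (Z i) = Z i) ->
  re (ntr (mev Z p)) ^+ 4 <= re (ntr (mev Z (ncsq (ncsq p)))).
Proof.
move=> hZ; rewrite re_ntr_ncsq//; apply: le_trans (sq_re_ntr_le _).
rewrite re_ntr_ncsq// -[4%N]/(2 * 2)%N exprM.
apply: lerXn2r; rewrite ?nnegrE ?sqr_ge0 ?mform_ge0//; exact: sq_re_ntr_le.
Qed.

End MatrixPolynomials.

Section Convergence.
Context {R : realType}.
Local Notation C := (cplx R).
Variables (U : set_system nat) (hU : UltraFilter U) (hUnp : forall n, ~ U [set n]).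
Variables (m : nat).
Local Notation J := ('I_m + nat)%type.
Variable (Yn : forall n, nat -> 'M[C]_n).
Hypothesis hY : forall n j, adjm (Yn n j) = Yn n j.
Variables (d : nat -> measure_display) (T : forall n, measurableType (d n))
  (P : forall n, probability (T n) R) (Xn : forall n, T n -> 'I_m -> 'M[C]_n).
Arguments Xn : clear implicits.
Hypotheses (hXn : forall n, random_mx_tuple (Xn n))
  (hXnmom : forall n, finite_moments (P n) (Xn n)).
Variable nu : nclaw_space R J.
Local Notation Zn n w := (join_tuple (Xn n w) (Yn n)).
Hypothesis hcvg : cvg_law_in_probability U P (fun n w => mx_law (Zn n w)) nu.
Hypotheses (hXlim : forall (k : nat) (j : 'I_m),
    (lim ((\int[P n]_w (re (ntr (Xn n w j ^+ (2 * k))))%:E) @[n --> U]) < +oo)%E)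
  (hYlim : forall k j : nat,
    (lim ((re (ntr (Yn n j ^+ (2 * k))))%:E @[n --> U]) < +oo)%E).
Variable e : forall n, 'I_(m * n ^ 2) -> 'I_m -> 'M[C]_n.
Arguments e : clear implicits.
Hypothesis he : forall n, is_onb (e n).

Let PU : ProperFilter U := @ultra_proper _ _ hU.

Definition rv (p : ncpoly C J) n (w : T n) : R := re (ntr (mev (Zn n w) p)).

Lemma Zn_herm n w k : adjm (Zn n w k) = Zn n w k.
Proof. by case: k => [i|j] /=; [exact/hermP/(proj1 (hXn n))|exact: hY]. Qed.

Lemma rv_smf p n : exists2 F, smf false F & forall w, rv p w = F (xc (e n) (Xn n) w).
Proof.
exists (fun x => re (ntr (mev (join_tuple (mx_of (e n) x) (Yn n)) p))); last first.
  by move=> w; rewrite (Zx_xc (Yn n) (he n) (hXn n)).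
have [] // : csmf (fun x => ntr (mev (join_tuple (mx_of (e n) x) (Yn n)) p)).
apply: (csmf_eq (F := fun x => (\sum_a mev (join_tuple (mx_of (e n) x) (Yn n)) p a a) * n%:R^-1)) => //.
by apply: csmfM; [apply: csmf_sum => a; exact: csmf_entry|exact: csmf_const].
Qed.

(** Polynomials in the real coordinates of the random tuple: finite moments make them integrable,
    and products, differences and powers stay in the class. *)
Definition pv n (g : T n -> R) := exists2 F, smf false F & forall w, g w = F (xc (e n) (Xn n) w).

Lemma pv_rint n g : pv g -> rint (P n) g.
Proof.
move=> [F sF gF]; have -> : g = (fun w => F (xc (e n) (Xn n) w)) by apply/funext.
exact: (smf_rint (he n) (hXn n) (hXnmom n)).
Qed.
Lemma pv_cst n c : pv (fun _ : T n => c).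
Proof. by exists (fun=> c) => //; exact: SFconst. Qed.
Lemma pvM n (g h : T n -> R) : pv g -> pv h -> pv (fun w => g w * h w).
Proof.
move=> [F sF gF] [G sG hG]; exists (fun x => F x * G x); first exact: SFmul.
by move=> w; rewrite gF hG.
Qed.
Lemma pvB n (g h : T n -> R) : pv g -> pv h -> pv (fun w => g w - h w).
Proof.
move=> [F sF gF] [G sG hG]; exists (fun x => F x - G x); first exact: smf_sub.
by move=> w; rewrite gF hG.
Qed.
Lemma pvX n (g : T n -> R) k : pv g -> pv (fun w => g w ^+ k).
Proof.
move=> pg; elim: k => [|k IH]; first exact: pv_cst.
have -> : (fun w => g w ^+ k.+1) = (fun w => g w * g w ^+ k).
  by apply/funext => w; rewrite exprS.
exact: pvM.
Qed.

Lemma U_gt0 : U [set n | (0 < n)%N].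
Proof.
have [h|h] := in_ultra_setVsetC [set 0%N] hU; first by case: (hUnp h).
by apply: filterS h => n /= n0; rewrite lt0n; apply/eqP.
Qed.

Lemma EI_moment_bounded k b : exists K, U [set n |
  rint (P n) (fun w => moment_sum (Xn n w) (Yn n) k b) /\
  EI (P n) (fun w => moment_sum (Xn n w) (Yn n) k b) <= K].
Proof.
have hX j : exists K, U [set n | rint (P n) (fun w => re (ntr (Xn n w j ^+ (2 ^ k.+1)))) /\
    EI (P n) (fun w => re (ntr (Xn n w j ^+ (2 ^ k.+1)))) <= K].
  pose p : ncpoly C J := iter (2 ^ k.+1) (NCmul (NCvar (inl j))) NCone.
  have pE n w : re (ntr (Xn n w j ^+ (2 ^ k.+1))) = rv p w.
    rewrite /rv; congr (re (ntr _)); rewrite /p.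
    elim: (2 ^ k.+1)%N => [|i IH]; first by rewrite expr0.
    by rewrite exprS IH.
  have ip n : rint (P n) (fun w => re (ntr (Xn n w j ^+ (2 ^ k.+1)))).
    have -> : (fun w => re (ntr (Xn n w j ^+ (2 ^ k.+1)))) = rv p (n := n).
      by apply/funext => w; exact: pE.
    by apply: pv_rint; exact: rv_smf.
  have := hXlim (2 ^ k) j.
  rewrite -expnS => h.
  have [c hc] : exists c : R, (lim ((\int[P n]_w (re (ntr (Xn n w j ^+ (2 ^ k.+1))))%:E) @[n --> U]) < c%:E)%E.
    move: h; case: (lim _) => [r| |] // _.
      by exists (r + 1); rewrite lte_fin ltrDl.
    by exists 0; exact: ltNyr.
  exists c; apply: filterS (ultra_lim_lt hU hc) => n /=.
  by rewrite EFin_EI// lte_fin => /ltW.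
have hYb j : exists K, U [set n | re (ntr (Yn n j ^+ (2 ^ k.+1))) <= K].
  have := hYlim (2 ^ k) j; rewrite -expnS => h.
  have [c hc] : exists c : R, (lim ((re (ntr (Yn n j ^+ (2 ^ k.+1))))%:E @[n --> U]) < c%:E)%E.
    move: h; case: (lim _) => [r| |] // _.
      by exists (r + 1); rewrite lte_fin ltrDl.
    by exists 0; exact: ltNyr.
  by exists c; apply: filterS (ultra_lim_lt hU hc) => n /=; rewrite lte_fin => /ltW.
have [KX hKX] := choice hX; have [KY hKY] := choice hYb.
exists (1 + \sum_i KX i + \sum_(j < b) KY j).
have h1 : U [set n | forall i, rint (P n) (fun w => re (ntr (Xn n w i ^+ (2 ^ k.+1)))) /\
    EI (P n) (fun w => re (ntr (Xn n w i ^+ (2 ^ k.+1)))) <= KX i].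
  exact: filter_forall.
have h2 : U [set n | forall j : 'I_b, re (ntr (Yn n j ^+ (2 ^ k.+1))) <= KY j].
  by apply: filter_forall => j; exact: hKY.
apply: filterS2 h1 h2 => n /= h1 h2.
have r1 : rint (P n) (fun w => 1 + \sum_i re (ntr (Xn n w i ^+ (2 ^ k.+1)))).
  by apply: rintD; [exact: rint_cst|apply: rint_sum => i; exact: (h1 i).1].
split; first by apply: rintD => //; exact: rint_cst.
rewrite /moment_sum EID//; last exact: rint_cst.
rewrite EI_cst EID ?EI_cst; [|exact: rint_cst|by apply: rint_sum => i; exact: (h1 i).1].
rewrite EI_sum; last by move=> i; exact: (h1 i).1.
by apply: lerD; [rewrite lerD2l|]; apply: ler_sum => i _; [exact: (h1 i).2|exact: h2].
Qed.

Lemma rv_pv p n : pv (rv p (n := n)). Proof. exact: rv_smf. Qed.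

Lemma EI_rv_bounded p : exists K, U [set n | EI (P n) (rv p (n := n)) <= K].
Proof.
have [k [b [K [K0 HK]]]] := re_ntr_bound p.
have [L HL] := EI_moment_bounded k b.
exists (K * L); apply: filterS HL => n /= [ri Ei].
apply: (@le_trans _ _ (EI (P n) (fun w => K * moment_sum (Xn n w) (Yn n) k b))).
  apply: EI_le; [exact/pv_rint/rv_pv|exact: rintZ|move=> w].
  apply: le_trans (ler_norm _) _; apply: HK => // i; exact: (Zn_herm w (inl i)).
by rewrite EIZ// ler_wpM2l.
Qed.

Lemma open_law (p : ncpoly C J) (c eps : R) :
  open [set mu : nclaw_space R J | `|re (mu p) - c| < eps].
Proof.
have -> : [set mu : nclaw_space R J | `|re (mu p) - c| < eps] =
    (fun mu : nclaw_space R J => re (mu p)) @^-1` [set x | `|x - c| < eps] by [].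
apply: open_comp => [mu _|]; last first.
  have -> : [set x | `|x - c| < eps] = ball c eps.
    by apply/seteqP; split=> x; rewrite -ball_normE /= distrC.
  exact: ball_open.
have h : (fun mu : nclaw_space R J => mu p) @ mu --> mu p.
  (* Evaluation at [p] is a projection of the product topology, whose index type receives a
     classical equality test. *)
  pose I : eqType := HB.pack (ncpoly C J) (gen_eqMixin (ncpoly C J)).
  exact: (@proj_continuous I (fun=> (C : topologicalType)) p mu).
by have /cplx_cvgP[] := h.
Qed.

Definition bad p eps n : set (T n) := [set w | eps <= `|rv p w - re (nu p)|].

Lemma measurable_bad p eps n : measurable (bad p eps (n := n)).
Proof.
have mr : measurable_fun [set: T n] (fun w => `|rv p w - re (nu p)|).
  apply: measurableT_comp; first exact: normr_measurable.
  by apply/rint_measurable/pv_rint/pvB; [exact: rv_pv|exact: pv_cst].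
have := mr measurableT `[eps, +oo[%classic (measurable_itv _).
rewrite setTI; congr measurable; apply/seteqP; split=> w /=; by rewrite in_itv /= andbT.
Qed.

Lemma bad_small p eps dl : 0 < eps -> 0 < dl ->
  U [set n | (P n (bad p eps (n := n)) <= dl%:E)%E].
Proof.
move=> eps0 dl0.
have := hcvg (open_law p (re (nu p)) eps).
rewrite /= subrr normr0 => /(_ eps0) h.
have h2 : U [set n | ((1 - dl)%:E <= P n [set w | (`|re (mx_law (Zn n w) p) - re (nu p)| < eps)%R])%E].
  have [h2|//] := ultra_lt_ge hU
    (fun n => P n [set w | (`|re (mx_law (Zn n w) p) - re (nu p)| < eps)%R]) (1 - dl)%:E.
  have : (1%E <= (1 - dl)%:E :> \bar R)%E.
    by apply: cvge_le h; apply: filterS h2 => n; exact: ltW.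
  by rewrite lee_fin; lra.
apply: filterS h2 => n /=.
have -> : [set w | `|re (mx_law (Zn n w) p) - re (nu p)| < eps] = ~` bad p eps (n := n).
  by apply/seteqP; split=> w /=; rewrite /bad /= ltNge => /negP.
rewrite probability_setC; last exact: measurable_bad.
have fB : P n (bad p eps (n := n)) \is a fin_num by apply: fin_num_measure; exact: measurable_bad.
by rewrite -(fineK fB) -EFinB !lee_fin; lra.
Qed.

(** Positivity of n matters: for n = 0 the normalized trace of a scalar is 0. *)
Lemma rv_shift p c n (w : T n) : (0 < n)%N ->
  rv (NCadd p (NCconst (mkC (- c) 0))) w = rv p w - c :> R.
Proof.
move=> n0; rewrite /rv -[mev _ _]/(mev (Zn n w) p + (mkC (- c) 0)%:M) ntrD reD.
congr (_ + _); rewrite -[_%:M]mulr1 ntr_scalarM reM /= mul0r subr0.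
rewrite /ntr re_divn -[1]/(1%:M) mxtrace_scalar natr_mkC /= mulfV ?mulr1//.
by rewrite pnatr_eq0 -lt0n.
Qed.

(** Off the rare event [bad] the square is at most eps/4; on it, the bounded fourth moment pays
    through y <= s y^2 / 2 + 1 / (2 s). *)
Lemma rv_L2 p : EI (P n) (fun w => (rv p w - re (nu p)) ^+ 2) @[n --> U] --> (0 : R).
Proof.
set c := re (nu p); pose q := NCadd p (NCconst (mkC (- c) 0)).
apply/cvgrPdist_lt => eps eps0.
have [K0 HK0] := EI_rv_bounded (ncsq (ncsq q)).
pose K := `|K0| + 1; have K1 : 0 < K by rewrite ltr_wpDl.
(* As the event has probability at most s eps / 4, the contributions are eps/4, s K / 2 = eps/8 and
   (s eps / 4) / (2 s) = eps/8, in total eps/2. *)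
pose s := eps / (4 * K); have s0 : 0 < s by rewrite divr_gt0 ?mulr_gt0.
pose e0 := Num.sqrt (eps / 4).
have e04 : e0 ^+ 2 = eps / 4 by rewrite sqr_sqrtr// divr_ge0 ?ltW.
have e0p : 0 < e0 by rewrite sqrtr_gt0 divr_gt0.
have dl0 : 0 < s * (eps / 4).
  by apply: mulr_gt0 => //; exact: divr_gt0.
apply: filterS (filterI HK0 (filterI (bad_small p e0p dl0) U_gt0)) => n /= [hK [hB n0]].
set h := fun w : T n => rv p w - c.
have ph : pv h by apply: pvB; [exact: rv_pv|exact: pv_cst].
have hq w : h w = rv q w by rewrite /h (rv_shift p c w n0).
have h4 : EI (P n) (fun w => h w ^+ 4) <= K.
  apply: (@le_trans _ _ (EI (P n) (rv (ncsq (ncsq q)) (n := n)))).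
    apply: EI_le; [exact/pv_rint/pvX|exact/pv_rint/rv_pv|move=> w].
    by rewrite hq; apply: re_ntr_pow4; exact: Zn_herm.
  by apply: le_trans hK _; rewrite /K (le_trans (ler_norm _))// lerDl.
pose ind (w : T n) : R := \1_(bad p e0 (n := n)) w.
have rind : rint (P n) ind by apply: integrable_indic; exact: measurable_bad.
have Eind : EI (P n) ind <= s * (eps / 4).
  rewrite -lee_fin -EFin_EI//; move: hB; congr (_ <= _)%E.
  by rewrite integral_indic ?setIT//; exact: measurable_bad.
have rh2 : rint (P n) (fun w => h w ^+ 2) by exact/pv_rint/pvX.
have rh4 : rint (P n) (fun w => h w ^+ 4) by exact/pv_rint/pvX.
rewrite sub0r normrN ger0_norm; last by apply: EI_ge0 => w; exact: sqr_ge0.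
apply: (@le_lt_trans _ _ (EI (P n) (fun w => eps / 4 + (s / 2 * h w ^+ 4 + (2 * s)^-1 * ind w)))).
  apply: EI_le => //.
    by apply: rintD; [exact: rint_cst|apply: rintD; exact: rintZ].
  move=> w; rewrite -/(h w) /ind /indic; case: (boolP (w \in bad p e0 (n := n))) => [_|wB].
    rewrite mulr1.
    have -> : h w ^+ 4 = (h w ^+ 2) ^+ 2 by rewrite -exprM.
    have e4 : 0 <= eps / 4 by rewrite ltW// divr_gt0.
    move: (h w ^+ 2) => y.
    have E : s / 2 * y ^+ 2 + (2 * s)^-1 - y = s / 2 * (y - s^-1) ^+ 2.
      by field; rewrite gt_eqF.
    have y0 : 0 <= s / 2 * (y - s^-1) ^+ 2.
      by apply: mulr_ge0; [rewrite divr_ge0// ltW|exact: sqr_ge0].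
    lra.
  rewrite mulr0 addr0 -e04.
  have : ~ (e0 <= `|h w|) by move=> hw; move/negP: wB; apply; rewrite inE.
  move/negP; rewrite -ltNge => hw.
  have : `|h w| ^+ 2 <= e0 ^+ 2 by apply: lerXn2r; rewrite ?nnegrE// ltW.
  rewrite real_normK ?num_real// => h2.
  have : 0 <= s / 2 * h w ^+ 4.
    apply: mulr_ge0; first by rewrite divr_ge0// ltW.
    by rewrite -[4%N]/(2 * 2)%N exprM sqr_ge0.
  lra.
rewrite EID ?EI_cst; [|exact: rint_cst|by apply: rintD; exact: rintZ].
rewrite EID ?EIZ//; [|exact: rintZ|exact: rintZ].
have a1 : s / 2 * EI (P n) (fun w => h w ^+ 4) <= eps / 8.
  apply: (@le_trans _ _ (s / 2 * K)); first by rewrite ler_wpM2l// divr_ge0// ltW.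
  rewrite /s le_eqVlt; apply/orP; left; apply/eqP; field; rewrite gt_eqF//.
have a2 : (2 * s)^-1 * EI (P n) ind <= eps / 8.
  apply: (@le_trans _ _ ((2 * s)^-1 * (s * (eps / 4)))).
    by rewrite ler_wpM2l// invr_ge0 mulr_ge0// ltW.
  rewrite le_eqVlt; apply/orP; left; apply/eqP; field; rewrite gt_eqF//.
lra.
Qed.

Lemma EI_rv_cvg p : EI (P n) (rv p (n := n)) @[n --> U] --> re (nu p).
Proof.
apply/cvgrPdist_lt => eps eps0.
have e2 : 0 < eps ^+ 2 by rewrite exprn_gt0.
have /cvgrPdist_lt/(_ _ e2) := rv_L2 p; apply: filterS => n /=.
rewrite sub0r normrN ger0_norm; last by apply: EI_ge0 => w; exact: sqr_ge0.
set c := re (nu p); set h := fun w : T n => rv p w - c.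
have ph : pv h by apply: pvB; [exact: rv_pv|exact: pv_cst].
move=> hE; have -> : c - EI (P n) (rv p (n := n)) = - EI (P n) h.
  by rewrite /h EIB ?EI_cst ?opprB//; [exact/pv_rint/rv_pv|exact: rint_cst].
rewrite normrN; apply: le_lt_trans (EI_norm (pv_rint ph)) _.
(* The pointwise inequality |h| <= eps/2 + h^2 / (2 eps) passes from second moments to means. *)
apply: (@le_lt_trans _ _ (EI (P n) (fun w => eps / 2 + (2 * eps)^-1 * h w ^+ 2))).
  apply: EI_le; first exact/rint_norm/pv_rint.
    by apply: rintD; [exact: rint_cst|exact/rintZ/pv_rint/pvX].
  move=> w; rewrite -(real_normK (num_real (h w))); move: `|h w| => x.
  rewrite -subr_ge0.
  have -> : eps / 2 + (2 * eps)^-1 * x ^+ 2 - x = (2 * eps)^-1 * (x - eps) ^+ 2.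
    by field; rewrite gt_eqF.
  by rewrite mulr_ge0 ?sqr_ge0// invr_ge0 mulr_ge0// ltW.
have rh : rint (P n) (fun w => h w ^+ 2) by exact/pv_rint/pvX.
rewrite EID ?EI_cst ?EIZ//; [|exact: rint_cst|exact: rintZ].
have : (2 * eps)^-1 * EI (P n) (fun w => h w ^+ 2) < (2 * eps)^-1 * eps ^+ 2.
  by rewrite ltr_pM2l// invr_gt0 mulr_gt0.
have -> : (2 * eps)^-1 * eps ^+ 2 = eps / 2 by field; rewrite gt_eqF.
lra.
Qed.

(** This is where L^2 convergence enters: the product of the centred variables tends to 0 in mean,
    and the remaining terms are linear. *)
Lemma EI_rv_mul_cvg p q :
  EI (P n) (fun w : T n => rv p w * rv q w) @[n --> U] --> re (nu p) * re (nu q).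
Proof.
set a := re (nu p); set b := re (nu q).
pose h n (w : T n) := rv p w - a; pose k n (w : T n) := rv q w - b.
have ph n : pv (h n) by apply: pvB; [exact: rv_pv|exact: pv_cst].
have pk n : pv (k n) by apply: pvB; [exact: rv_pv|exact: pv_cst].
have hk : EI (P n) (fun w => h n w * k n w) @[n --> U] --> (0 : R).
  apply/cvgrPdist_lt => eps eps0.
  have /cvgrPdist_lt/(_ _ eps0) hL := rv_L2 p; have /cvgrPdist_lt/(_ _ eps0) kL := rv_L2 q.
  apply: filterS2 hL kL => n /=.
  rewrite !sub0r !normrN => {}hL {}kL.
  rewrite ger0_norm in hL; last by apply: EI_ge0 => w; exact: sqr_ge0.
  rewrite ger0_norm in kL; last by apply: EI_ge0 => w; exact: sqr_ge0.
  apply: le_lt_trans (EI_norm (pv_rint (pvM (ph n) (pk n)))) _.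
  apply: (@le_lt_trans _ _ (EI (P n) (fun w => 2^-1 * (h n w ^+ 2 + k n w ^+ 2)))).
    apply: EI_le; first exact/rint_norm/pv_rint/pvM.
      by apply/rintZ/rintD; exact/pv_rint/pvX.
    move=> w; have := sqr_ge0 (h n w - k n w); have := sqr_ge0 (h n w + k n w).
    by rewrite !expr2 => *; rewrite ler_norml; apply/andP; split; lra.
  have rh : rint (P n) (fun w => h n w ^+ 2) by exact/pv_rint/pvX.
  have rk : rint (P n) (fun w => k n w ^+ 2) by exact/pv_rint/pvX.
  rewrite EIZ ?EID//; last exact: rintD.
  by move: hL kL; rewrite -/(h n) -/(k n); lra.
have lim : EI (P n) (fun w => h n w * k n w) + (a * EI (P n) (rv q (n := n)) +
   (b * EI (P n) (rv p (n := n)) - a * b)) @[n --> U] --> 0 + (a * b + (b * a - a * b)).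
  apply: cvgD => //; apply: cvgD; first by apply: cvgM; [exact: cvg_cst|exact: EI_rv_cvg].
  by apply: cvgB; [apply: cvgM; [exact: cvg_cst|exact: EI_rv_cvg]|exact: cvg_cst].
have -> : a * b = 0 + (a * b + (b * a - a * b)) by ring.
apply: cvg_trans lim; apply: near_eq_cvg; apply: nearW => n /=.
have rp : rint (P n) (rv p (n := n)) by exact/pv_rint/rv_pv.
have rq : rint (P n) (rv q (n := n)) by exact/pv_rint/rv_pv.
rewrite -!EIZ//.
have rc := rint_cst (P n) (a * b).
rewrite -[a * b](EI_cst (P n)) -EIB//; last exact: rintZ.
rewrite -EID; [|exact: rintZ|by apply: rintB => //; exact: rintZ].
rewrite -EID; [|exact/pv_rint/pvM|by apply: rintD; [exact: rintZ|apply: rintB => //; exact: rintZ]].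
by congr EI; apply/funext => w; rewrite /h /k; ring.
Qed.

End Convergence.

Section YoungLimit.
Context {R : realType}.
Local Notation C := (cplx R).
Context {H : completeNormedModType C} (ip : {dot H for Num.conj}).
Hypothesis hip : hilbert ip.
Variables (M : set (bop H)) (tau : bop H -> C).
Hypotheses (hM : is_vNalgebra ip M) (htau : is_tracial_state ip M tau).
Variables (U : set_system nat) (hU : UltraFilter U) (hUnp : forall n, ~ U [set n]).
Variables (m : nat) (X : 'I_m -> bop H) (Y : nat -> bop H).
Local Notation J := ('I_m + nat)%type.
Hypotheses (ZM : forall k : J, M (join_tuple X Y k))
  (Zsa : forall k : J, selfadjoint ip (join_tuple X Y k)).
Variable (Yn : forall n, nat -> 'M[C]_n).
Hypothesis hY : forall n j, adjm (Yn n j) = Yn n j.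
Variables (d : nat -> measure_display) (T : forall n, measurableType (d n))
  (P : forall n, probability (T n) R) (Xn : forall n, T n -> 'I_m -> 'M[C]_n).
Arguments Xn : clear implicits.
Hypotheses (hXn : forall n, random_mx_tuple (Xn n))
  (hXnmom : forall n, finite_moments (P n) (Xn n)).
Local Notation Zn n w := (join_tuple (Xn n w) (Yn n)).
Local Notation nu := (op_law tau (join_tuple X Y)).
Hypothesis hcvg : cvg_law_in_probability U P (fun n w => mx_law (Zn n w)) nu.
Hypotheses (hXlim : forall (k : nat) (j : 'I_m),
    (lim ((\int[P n]_w (re (ntr (Xn n w j ^+ (2 * k))))%:E) @[n --> U]) < +oo)%E)
  (hYlim : forall k j : nat,
    (lim ((re (ntr (Yn n j ^+ (2 * k))))%:E @[n --> U]) < +oo)%E).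
Variable e : forall n, 'I_(m * n ^ 2) -> 'I_m -> 'M[C]_n.
Arguments e : clear implicits.
Hypothesis he : forall n, is_onb (e n).

Let PU : ProperFilter U := @ultra_proper _ _ hU.
Local Notation rv := (rv Yn Xn).
Local Notation ev := (ev (join_tuple X Y)).

Let rvM p n : rint (P n) (rv p (n := n)).
Proof. exact/(pv_rint hXn hXnmom he)/(rv_pv Yn hXn he). Qed.
Let rvMM p q n : rint (P n) (fun w : T n => rv p w * rv q w).
Proof. by apply/(pv_rint hXn hXnmom he)/pvM; exact: (rv_pv Yn hXn he). Qed.
Let cvg1 p := EI_rv_cvg hU hUnp hY hXn hXnmom hcvg hXlim hYlim he (p := p).
Let cvg2 p q := EI_rv_mul_cvg hU hUnp hY hXn hXnmom hcvg hXlim hYlim he (p := p) (q := q).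

(** Multiplication by -i makes imaginary parts real, so that results on real parts of traces cover
    complex values. *)
Definition ncrot (p : ncpoly C J) : ncpoly C J := NCmul (NCconst (mkC 0 (-1))) p.

Lemma re_mkCN1 (z : C) : re (mkC 0 (-1) * z) = im z.
Proof. by rewrite reM /=; lra. Qed.

Lemma rv_ncrot p n (w : T n) : rv (ncrot p) w = im (ntr (mev (Zn n w) p)).
Proof.
by rewrite /(rv _ _) -[mev _ _]/((mkC 0 (-1))%:M * mev (Zn n w) p) ntr_scalarM re_mkCN1.
Qed.

Lemma nu_ncrot p : re (nu (ncrot p)) = im (nu p).
Proof.
rewrite -[nu _]/(tau (_ * ev p)) bop_scale_mull mul1r (tauZ hM htau) ?re_mkCN1//.
exact: (ev_M hM ZM).
Qed.

(** The real part of the product of the two complex traces of a tensor. *)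
Definition rv2 (t : ncpoly C J * ncpoly C J) n (w : T n) : R :=
  rv t.1 w * rv t.2 w - rv (ncrot t.1) w * rv (ncrot t.2) w.

Lemma rint_rv2 t n : rint (P n) (rv2 t (n := n)).
Proof. exact: rintB. Qed.

Lemma EI_rv2_cvg t : EI (P n) (rv2 t (n := n)) @[n --> U] --> re (nu t.1 * nu t.2).
Proof.
rewrite reM -!nu_ncrot.
have E n : EI (P n) (rv2 t (n := n)) = EI (P n) (fun w => rv t.1 w * rv t.2 w) -
    EI (P n) (fun w => rv (ncrot t.1) w * rv (ncrot t.2) w) by rewrite -EIB.
under eq_cvg do rewrite E.
by apply: cvgB; exact: cvg2.
Qed.

Lemma EI_mdiv_cvg (f : 'I_m -> ncpoly C J) :
  EI (P n) (fun w => re (mdiv f (Zn n w))) @[n --> U] -->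
  \sum_(i < m) re (free_div tau X Y i (f i)).
Proof.
have E n : EI (P n) (fun w => re (mdiv f (Zn n w))) =
    \sum_(i < m) \sum_(t <- ncderiv (inl i) (f i)) EI (P n) (rv2 t (n := n)).
  transitivity (EI (P n) (fun w => \sum_(i < m)
      \sum_(t <- ncderiv (inl i) (f i)) rv2 t w)).
    congr EI; apply/funext => w; rewrite /mdiv re_sum; apply: eq_bigr => i _.
    rewrite /dsum re_sum; apply: eq_bigr => t _.
    by rewrite reM /rv2 !rv_ncrot.
  rewrite EI_sum; last by move=> i; apply: rint_sum => t; exact: rint_rv2.
  by apply: eq_bigr => i _; rewrite EI_sum// => t; exact: rint_rv2.
under eq_cvg do rewrite E.
apply: cvg_sum_seq => i; rewrite /free_div /dsum re_sum.
by apply: cvg_sum_seq => t; exact: EI_rv2_cvg.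
Qed.

Lemma EI_field_norm_cvg (f : 'I_m -> ncpoly C J) :
  EI (P n) (field_norm (Yn n) (Xn n) f) @[n --> U] -->
  \sum_(i < m) tform ip tau (ev (f i)) (ev (f i)).
Proof.
have E n : EI (P n) (field_norm (Yn n) (Xn n) f) =
    \sum_(i < m) EI (P n) (rv (ncsq (f i)) (n := n)).
  rewrite -EI_sum//; congr EI; apply/funext => w; apply: eq_bigr => i _.
  by rewrite -re_ntr_ncsq// => k; exact: (Zn_herm hY hXn).
under eq_cvg do rewrite E.
apply: cvg_sum_seq => i; have := @cvg1 (ncsq (f i)).
suff -> : re (nu (ncsq (f i))) = tform ip tau (ev (f i)) (ev (f i)) by [].
have Mf : M (ev (f i)) by exact: (ev_M hM ZM).
have adjf : adj ip (ev (f i)) = ev (ncadj (f i)).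
  by apply: (adjE hip); exact: (ev_adj Zsa).
rewrite /tform adjf -[nu _]/(tau (ev (f i) * ev (ncadj (f i)))).
(* [ncsq] has the adjoint on the right and [tform] on the left; traciality reconciles them. *)
by rewrite (tau_tracial htau)//; exact: (ev_M hM ZM).
Qed.

Lemma young_limit (c : R)
    (hc : U [set n | ((n%:R ^- 4)%:E * mx_fisher (P n) (e n) (Xn n) <= c%:E)%E])
    (f : 'I_m -> ncpoly C J) :
  (\sum_(i < m) re (free_div tau X Y i (f i))) *+ 2 <=
    c + \sum_(i < m) tform ip tau (ev (f i)) (ev (f i)).
Proof.
rewrite -mulr_natl.
have h1 : 2 * EI (P n) (fun w => re (mdiv f (Zn n w))) @[n --> U] -->
    2 * \sum_(i < m) re (free_div tau X Y i (f i)).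
  by apply: cvgM; [exact: cvg_cst|exact: EI_mdiv_cvg].
have h2 : c + EI (P n) (field_norm (Yn n) (Xn n) f) @[n --> U] -->
    c + \sum_(i < m) tform ip tau (ev (f i)) (ev (f i)).
  by apply: cvgD; [exact: cvg_cst|exact: EI_field_norm_cvg].
apply: (ler_cvg_to h1 h2).
apply: filterS2 hc (U_gt0 hU hUnp) => n /= hc n0.
rewrite -lee_fin; apply: le_trans (fisher_young (Yn n) (he n) (hXn n) (hXnmom n) f n0) _.
by rewrite EFinD; exact: leeD2r.
Qed.

End YoungLimit.

Lemma fisher_ge0 {R : realType} d (T : measurableType d) (P : probability T R) n
  (X : T -> 'rV[R]_n) : (0 <= fisher P X)%E.
Proof.
rewrite /fisher; case: pselect => [h|_]; last exact: leey.
apply: integral_ge0 => w _; rewrite lee_fin; apply: sumr_ge0 => k _.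
by rewrite addr_ge0 ?sqr_ge0.
Qed.

Theorem proposition6p1 (R : realType)
  (* the tracial von Neumann algebra (M, tau), acting on H *)
  (H : completeNormedModType (cplx R)) (ip : {dot H for Num.conj})
  (hip : hilbert ip)
  (M : set (bop H)) (tau : bop H -> cplx R)
  (hM : is_vNalgebra ip M) (htau : is_tracial_state ip M tau)
  (U : set_system nat) (hU : UltraFilter U) (hUnp : forall n, ~ U [set n])
  (m : nat) (X : 'I_m -> bop H)
  (hXM : forall i, M (X i)) (hXsa : forall i, selfadjoint ip (X i))
  (B : set (bop H)) (hB : is_vNalgebra ip B) (hBM : B `<=` M)
  (Y : nat -> bop H) (hYsa : forall j, selfadjoint ip (Y j))
  (hYB : Wstar ip (range Y) = B)
  (Yn : forall n, nat -> 'M[cplx R]_n)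
  (hYnsa : forall n j, Yn n j \is hermsymmx)
  (hYncvg : (mx_law (Yn n) : nclaw_space R nat) @[n --> U] --> op_law tau Y)
  (hYnbd : forall j,
    (ereal_sup (range (fun n => op_norm (Yn n j))) < +oo)%E)
  (d : nat -> measure_display) (T : forall n, measurableType (d n))
  (P : forall n, probability (T n) R)
  (Xn : forall n, T n -> 'I_m -> 'M[cplx R]_n)
  (hXn : forall n, random_mx_tuple (Xn n))
  (hXnmom : forall n, finite_moments (P n) (Xn n))
  (hcvg : cvg_law_in_probability U P
    (fun n w => mx_law (join_tuple (Xn n w) (Yn n)))
    (op_law tau (join_tuple X Y)))
  (hXnlim : forall (k : nat) (j : 'I_m),
    (lim ((\int[P n]_w (re (ntr (Xn n w j ^+ (2 * k))))%:E) @[n --> U])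
       < +oo)%E)
  (hYnlim : forall k j : nat,
    (lim ((re (ntr (Yn n j ^+ (2 * k))))%:E @[n --> U]) < +oo)%E)
  (* orthonormal bases identifying M_n(C)_sa^m with R^(mn^2) *)
  (e : forall n, 'I_(m * n ^ 2) -> 'I_m -> 'M[cplx R]_n)
  (he : forall n, is_onb (e n)) :
  (free_fisher ip tau B X <=
     lim (((n%:R ^- 4)%:E * mx_fisher (P n) (e n) (Xn n)) @[n --> U]))%E
  /\ lim (((n%:R ^- 4)%:E * mx_fisher (P n) (e n) (Xn n))%E @[n --> U]) =
     lim (mx_fisher_n (P n) (e n) (Xn n) @[n --> U]).
Proof.
(* The second claim is the definition of [mx_fisher_n]. *)
split=> //.
have PU : ProperFilter U := @ultra_proper _ _ hU.
have hY n j : adjm (Yn n j) = Yn n j by apply/hermP; exact: hYnsa.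
have BY j : B (Y j) by rewrite -hYB; apply: Wstar_sub; exists j.
have ZM (k : 'I_m + nat) : M (join_tuple X Y k).
  by case: k => [i|j]; [exact: hXM|exact/hBM/BY].
have Zsa (k : 'I_m + nat) : selfadjoint ip (join_tuple X Y k).
  by case: k => [i|j]; [exact: hXsa|exact: hYsa].
(* A real [r] above the limit bounds the normalized Fisher information on a set of the ultrafilter,
   and so serves as the constant of the limiting inequality. *)
have le_r (r : R) : (lim (((n%:R ^- 4)%:E * mx_fisher (P n) (e n) (Xn n)) @[n --> U]) < r%:E ->
    free_fisher ip tau B X <= r%:E)%E.
  move=> /(ultra_lim_lt hU) hr.
  apply: (free_fisher_le hip hM htau hXM hXsa hB hBM hYsa hYB) => f.
  apply: (young_limit hip hM htau hU hUnp ZM Zsa hY hXn hXnmom hcvg hXnlim hYnlim he).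
  by apply: filterS hr => n; exact: ltW.
(* Rules out the limit -oo. *)
have lim_ge0 : ~ (lim (((n%:R ^- 4)%:E * mx_fisher (P n) (e n) (Xn n)) @[n --> U]) < 0)%E.
  move=> /(ultra_lim_lt hU) /filter_ex[n /=]; rewrite ltNge mule_ge0//.
  exact: fisher_ge0.
move: le_r lim_ge0; case: (lim _) => [s| |] le_r lim_ge0.
- by apply/lee_addgt0Pr => r r0; apply: le_r; rewrite lte_fin ltrDl.
- exact: leey.
- by case: lim_ge0; exact: ltNyr.
Qed.
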